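(* Let $S$ be an automorphism (invertible measure-preserving transformation) of a standard probability space with zero (Kolmogorov–Sinai) entropy. Then there exist a Gaussian automorphism $G$ and a sequence $P=\{P_j\}_{j\ge 1}$ of finite sets of the form $P_j=\{j,2j,\dots,L(j)j\}$, where $L(j)$ are positive integers with $L(j)\to\infty$ as $j\to\infty$, such that $h_P(S)=0$ and $G$ has completely positive $P$-entropy. Moreover, any such $S$ and $G$ (that is, with $h_P(S)=0$ and $G$ of completely positive $P$-entropy for such a sequence $P$) are disjoint: they admit no nontrivial Markov intertwining.
   Context: $P$-entropy. Let $P=\{P_j\}$ be a sequence of finite subsets of $\mathbb{Z}$ and let $T$ be an automorphism of a standard probability space $(X,\mu)$. For a finite measurable partition $\xi=\{C_1,\dots,C_n\}$ of $X$ put $H(\xi)=-\sum_{i=1}^n\mu(C_i)\ln\mu(C_i)$, and define $$h_j(T,\xi)=\frac1{|P_j|}H\Big(\bigvee_{p\in P_j}T^p\xi\Big),\qquad h_P(T,\xi)=\limsup_{j} h_j(T,\xi),\qquad h_P(T)=\sup_\xi h_P(T,\xi),$$ where the supremum is over all finite measurable partitions $\xi$. The automorphism $T$ has completely positive $P$-entropy if $h_P(T,\xi)>0$ for every nontrivial finite measurable partition $\xi$ (nontrivial meaning $H(\xi)>0$). Gaussian automorphism. Let $T$ be an orthogonal operator on an infinite-dimensional separable real Hilbert space $H$. Let $(\Omega,\mu)$ be a standard probability space carrying a centered Gaussian family $\{\varphi_h\}_{h\in H}$ of real random variables, linear in $h$, with $\int\varphi_h\varphi_{h'}\,d\mu=\langle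 h,h'\rangle$, and generating the $\sigma$-algebra modulo null sets. The Gaussian automorphism $G(T)$ is the automorphism of $(\Omega,\mu)$, unique up to isomorphism, with $\varphi_h\circ G(T)^{-1}=\varphi_{Th}$ for all $h\in H$. A Gaussian automorphism is one of the form $G(T)$. Disjointness. A Markov operator $J:L_2(X,\mu)\to L_2(Y,\nu)$ between $L_2$-spaces of probability spaces is a bounded operator that maps nonnegative functions to nonnegative functions and satisfies $J\mathbf 1=\mathbf 1$, $J^*\mathbf 1=\mathbf 1$. Automorphisms $S$ of $(X,\mu)$ and $G$ of $(Y,\nu)$ are disjoint if the only Markov operator $J$ intertwining their Koopman operators ($JU_S=U_GJ$, where $U_Sf=f\circ S$ and $U_Gf=f\circ G$) is the trivial one, $Jf=\big(\int f\,d\mu\big)\mathbf 1$; equivalently, the product measure $\mu\times\nu$ is the only joining of $S$ and $G$. *)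

(* Defs.v *)
From HB Require Import structures.
From mathcomp Require Import all_boot all_order all_algebra.
From mathcomp Require Import finmap.
From mathcomp Require Import all_classical all_reals all_analysis.

Set Implicit Arguments.
Unset Strict Implicit.
Unset Printing Implicit Defensive.

Import Order.TTheory GRing.Theory Num.Theory.
Import numFieldNormedType.Exports.

Local Open Scope classical_set_scope.
Local Open Scope ring_scope.

(* Standard (Lebesgue-Rokhlin) probability space: off a null set, [f] is an
   isomorphism onto a Borel probability measure on the line.  Images of
   measurable sets are only required to be Borel up to null sets, so that both
   standard Borel spaces and their completions qualify; since [f] is injective
   on [T0], applying the last clause to [A] and to [T0 `\` A] approximates
   [f @` A] from inside and from outside. *)
Definition standard_probability (R : realType) (d : measure_display)
    (T : measurableType d) (mu : probability T R) : Prop :=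
  exists (f : {mfun T >-> R}) (T0 : set T),
    [/\ measurable T0, mu T0 = 1%E, {in T0 &, injective f} &
      forall A, measurable A -> A `<=` T0 ->
        exists B : set R,
          [/\ measurable B, B `<=` f @` A & mu (A `\` f @^-1` B) = 0%E]].

Record automorphism (R : realType) (d : measure_display)
    (T : measurableType d) (mu : probability T R) := Automorphism {
  aut_fun :> T -> T ;
  aut_inv : T -> T ;
  aut_funK : cancel aut_fun aut_inv ;
  aut_invK : cancel aut_inv aut_fun ;
  aut_measurable : measurable_fun setT aut_fun ;
  aut_inv_measurable : measurable_fun setT aut_inv ;
  aut_preserving : forall A, measurable A -> mu (aut_fun @^-1` A) = mu A
}.

Definition aut_pow (R : realType) (d : measure_display)
    (T : measurableType d) (mu : probability T R) (S : automorphism mu)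
    (p : int) : T -> T :=
  match p with
  | Posz n => iter n S
  | Negz n => iter n.+1 (aut_inv S)
  end.

(* Finite partitions are indexed families; empty cells are allowed and do not
   contribute to the entropy. *)
Definition measurable_partition (d : measure_display) (T : measurableType d)
    (I : finType) (xi : I -> set T) : Prop :=
  [/\ forall i, measurable (xi i), trivIset setT xi & \bigcup_i xi i = setT].

(* Cells with [mu (xi i) = 0] contribute [0 * ln 0 = 0]. *)
Definition entropy (R : realType) (d : measure_display)
    (T : measurableType d) (mu : probability T R)
    (I : finType) (xi : I -> set T) : R :=
  - \sum_(i : I) fine (mu (xi i)) * ln (fine (mu (xi i))).

(* The join, over p in P, of the partitions T^p xi; its cells are indexed by
   the functions a : P -> I. *)
Definition join_images (R : realType) (d : measure_display)
    (T : measurableType d) (mu : probability T R) (S : automorphism mu)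
    (P : {fset int}) (I : finType) (xi : I -> set T) :
    {ffun P -> I} -> set T :=
  fun a => [set x | forall p : P, (aut_pow S (val p) @` xi (a p)) x].
Arguments join_images {R d T mu} S P {I} xi.

Definition P_entropy_at (R : realType) (d : measure_display)
    (T : measurableType d) (mu : probability T R) (S : automorphism mu)
    (P : {fset int}) (I : finType) (xi : I -> set T) : R :=
  entropy mu (join_images S P xi) / (#|` P|)%:R.

Definition P_entropy_partition (R : realType) (d : measure_display)
    (T : measurableType d) (mu : probability T R)
    (P : nat -> {fset int}) (S : automorphism mu)
    (I : finType) (xi : I -> set T) : \bar R :=
  limn_esup (fun j => (P_entropy_at S (P j) xi)%:E).

Definition P_entropy (R : realType) (d : measure_display)
    (T : measurableType d) (mu : probability T R)
    (P : nat -> {fset int}) (S : automorphism mu) : \bar R :=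
  ereal_sup [set h | exists n (xi : 'I_n -> set T),
    measurable_partition xi /\ h = P_entropy_partition P S xi].

Definition completely_positive_P_entropy (R : realType) (d : measure_display)
    (T : measurableType d) (mu : probability T R)
    (P : nat -> {fset int}) (S : automorphism mu) : Prop :=
  forall n (xi : 'I_n -> set T), measurable_partition xi ->
    0 < entropy mu xi -> (0 < P_entropy_partition P S xi)%E.

Definition KS_entropy_partition (R : realType) (d : measure_display)
    (T : measurableType d) (mu : probability T R) (S : automorphism mu)
    (I : finType) (xi : I -> set T) : \bar R :=
  limn (fun n => (n%:R^-1 *
    entropy mu (join_images S [fset - k%:Z | k in iota 0 n]%fset xi))%:E).

Definition KS_entropy (R : realType) (d : measure_display)
    (T : measurableType d) (mu : probability T R) (S : automorphism mu) :
    \bar R :=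
  ereal_sup [set h | exists n (xi : 'I_n -> set T),
    measurable_partition xi /\ h = KS_entropy_partition S xi].

(* The set {j, 2j, ..., L(j) j}.  The sequence is meant for j >= 1; its term at
   j = 0 has no influence on the upper limits above. *)
Definition progressions (L : nat -> nat) (j : nat) : {fset int} :=
  [fset (k * j)%N%:Z | k in iota 1 (L j)]%fset.

(* Centered normal law, degenerate case included: [normal_prob 0 s] is the
   Gaussian law only for [s != 0]. *)
Definition centered_gaussian (R : realType) (d : measure_display)
    (T : measurableType d) (mu : probability T R) (X : {RV mu >-> R}) : Prop :=
  X = cst 0 %[ae mu] \/
  exists2 s : R, 0 < s &
    forall A : set R, measurable A -> distribution mu X A = normal_prob 0 s A.
Arguments centered_gaussian {R d T} mu X.

(* Joint Gaussianity of a family: all finite linear combinations are normal. *)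
Definition centered_gaussian_family (R : realType) (d : measure_display)
    (T : measurableType d) (mu : probability T R) (H : Type)
    (phi : H -> {RV mu >-> R}) : Prop :=
  forall n (c : 'I_n -> R) (h : 'I_n -> H),
    centered_gaussian mu (\sum_(i < n) c i *: (phi (h i) : {mfun T >-> R})).

Definition generates_mod_null (R : realType) (d : measure_display)
    (T : measurableType d) (mu : probability T R) (H : Type)
    (phi : H -> {RV mu >-> R}) : Prop :=
  forall A, measurable A ->
    exists2 B, <<s [set C | exists h (D : set R),
                      measurable D /\ C = phi h @^-1` D] >> B &
      mu (A `+` B) = 0%E.

Definition separable (T : topologicalType) : Prop :=
  exists2 D : set T, countable D & dense D.

Definition infinite_dimensional (R : realType) (V : lmodType R) : Prop :=
  forall n (v : 'I_n -> V), exists h : V,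
    forall c : 'I_n -> R, h <> \sum_(i < n) c i *: v i.

(* [G] is (a version of) the Gaussian automorphism G(U) of an orthogonal
   operator [U] on the infinite-dimensional separable real Hilbert space [H],
   i.e. a complete normed space whose norm comes from the inner product [dot].
   The identities between random variables hold almost everywhere. *)
Definition gaussian_automorphism (R : realType) (d : measure_display)
    (T : measurableType d) (mu : probability T R) (G : automorphism mu) :
    Prop :=
  standard_probability mu /\
  exists (H : completeNormedModType R) (dot : {dot H for idfun})
         (U : {linear H -> H}) (phi : H -> {RV mu >-> R}),
    [/\ (forall x : H, `|x| ^+ 2 = dot x x),
        separable H /\ infinite_dimensional H,
        (forall x y : H, dot (U x) (U y) = dot x y) /\
          (forall y : H, exists x : H, U x = y) &
    [/\ centered_gaussian_family phi,
        (forall (a : R) (h h' : H),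
          phi (a *: h + h') = (fun w => a * phi h w + phi h' w) %[ae mu]),
        (forall h h' : H,
          (\int[mu]_w (phi h w * phi h' w)%:E)%E = (dot h h')%:E),
        generates_mod_null phi &
        forall h : H, phi h \o aut_inv G = phi (U h) %[ae mu]]].

(* Operators between L_2-spaces are presented as maps on functions, compatible
   with almost everywhere equality; their values off [Lfun _ 2] are
   irrelevant. *)
Definition L2_operator (R : realType) (d d' : measure_display)
    (X : measurableType d) (Y : measurableType d')
    (mu : probability X R) (nu : probability Y R)
    (J : (X -> R) -> (Y -> R)) : Prop :=
  [/\ forall f, f \in Lfun mu 2%:E -> J f \in Lfun nu 2%:E,
      forall f g, f \in Lfun mu 2%:E -> g \in Lfun mu 2%:E ->
        f = g %[ae mu] -> J f = J g %[ae nu],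
      forall (a : R) f g, f \in Lfun mu 2%:E -> g \in Lfun mu 2%:E ->
        J (fun x => a * f x + g x) = (fun y => a * J f y + J g y) %[ae nu] &
      exists M : R, forall f, f \in Lfun mu 2%:E ->
        ('N[nu]_2%:E[EFin \o J f] <= M%:E * 'N[mu]_2%:E[EFin \o f])%E].

Definition L2_adjoint (R : realType) (d d' : measure_display)
    (X : measurableType d) (Y : measurableType d')
    (mu : probability X R) (nu : probability Y R)
    (J : (X -> R) -> (Y -> R)) (J' : (Y -> R) -> (X -> R)) : Prop :=
  forall f g, f \in Lfun mu 2%:E -> g \in Lfun nu 2%:E ->
    \int[nu]_y (J f y * g y) = \int[mu]_x (f x * J' g x).

Definition markov_operator (R : realType) (d d' : measure_display)
    (X : measurableType d) (Y : measurableType d')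
    (mu : probability X R) (nu : probability Y R)
    (J : (X -> R) -> (Y -> R)) : Prop :=
  [/\ L2_operator mu nu J,
      forall f, f \in Lfun mu 2%:E -> {ae mu, forall x, 0 <= f x} ->
        {ae nu, forall y, 0 <= J f y},
      J (cst 1) = cst 1 %[ae nu] &
      exists J' : (Y -> R) -> (X -> R),
        [/\ L2_operator nu mu J', L2_adjoint mu nu J J' &
            J' (cst 1) = cst 1 %[ae mu]]].

Definition disjoint_automorphisms (R : realType) (d d' : measure_display)
    (X : measurableType d) (Y : measurableType d')
    (mu : probability X R) (nu : probability Y R)
    (S : automorphism mu) (G : automorphism nu) : Prop :=
  forall J : (X -> R) -> (Y -> R), markov_operator mu nu J ->
    (forall f, f \in Lfun mu 2%:E -> J (f \o S) = J f \o G %[ae nu]) ->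
    forall f, f \in Lfun mu 2%:E -> J f = cst (\int[mu]_x f x) %[ae nu].

(* Main.v *)
Require Import Defs.
From HB Require Import structures.
From mathcomp Require Import all_boot all_order all_algebra finmap.
From mathcomp Require Import all_classical all_reals all_analysis.
From mathcomp Require Import measurable_realfun.
From mathcomp Require Import ring lra zify.

(** For part one, the lengths [L j] are chosen from [S] alone: for fixed [j] the
    progression of step [j] and length [L] lies in an interval of length [L * j],
    along which the entropy of a partition is [o(L)], so a large [L j] makes the
    [j]-th term small for the first [j] partitions of a dense sequence.  The
    Gaussian automorphism can be taken Bernoulli, the shift of i.i.d. normal
    variables coded by fair coins: for a partition determined by finitely many
    coins, the translates by distinct multiples of a large [j] are independent.

    Part two does not use Gaussianity.  If [J 1_A] is not constant, cut it at a
    nontrivial level [c].  By the law of large numbers, [N] conditionally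
    independent copies of the coupling given by [J] determine this level set up
    to a small error, so its [P]-entropy under [G] is at most [N] times the
    [P]-entropy of [A] under [S], which vanishes, plus an arbitrarily small
    term. *)

Set Implicit Arguments.
Unset Strict Implicit.
Unset Printing Implicit Defensive.

Import Order.TTheory GRing.Theory Num.Theory.
Import numFieldNormedType.Exports.

Local Open Scope classical_set_scope.
Local Open Scope ring_scope.

(** * Entropy on finite probability spaces *)


(** Disjointness is reduced to finite probability spaces. For one set [P_j] only finitely many names
    occur, so the Markov operator acts on them as a stochastic kernel, and the conditionally
    independent copies live on a finite product. They are independent only given [y], but
    unconditionally their joint entropy is still at most [N] times that of one copy, which is the
    [P_j]-name of [A] under [S]. The name of the level set under [G] is then recovered coordinate by
    coordinate: intertwining turns the conditional probability at time [p] into [J 1_A] composed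
    with [G^-p]. A Fano bound charges each coordinate a cost independent of [j], so that [N] can be
    fixed before [j] grows. The estimate is unreliable near the level itself, hence [c] must be a
    value taken with probability zero. On the Gaussian side the coins are indexed by pairs: a time,
    and the rank of a binary digit of the normal variable at that time. Partitions into cylinders
    see finitely many coins, and each row of coins is recoded into one normal variable. *)

Section finite_entropy.
Variable R : realType.
Implicit Types (Om A B K : finType).

Definition shannon A (p : A -> R) : R := - \sum_a p a * ln (p a).

Definition marg Om A (w : Om -> R) (f : Om -> A) (a : A) : R :=
  \sum_(o | f o == a) w o.

Definition ent Om A (w : Om -> R) (f : Om -> A) : R := shannon (marg w f).

Lemma sum_marg Om A (w : Om -> R) (f : Om -> A) (F : A -> R) :
  \sum_a marg w f a * F a = \sum_o w o * F (f o).
Proof.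
rewrite [RHS](partition_big f xpredT)//=; apply: eq_bigr => a _.
by rewrite mulr_suml; apply: eq_bigr => o /eqP ->.
Qed.

(** Summing over points instead of values lets the entropies of several functions be compared term
    by term. *)
Lemma entE Om A (w : Om -> R) (f : Om -> A) :
  ent w f = - \sum_o w o * ln (marg w f (f o)).
Proof. by rewrite /ent /shannon sum_marg. Qed.

Lemma marg_comp Om A B (w : Om -> R) (f : Om -> A) (g : A -> B) :
  marg (marg w f) g = marg w (g \o f).
Proof.
apply/funext => b; rewrite /marg [RHS](partition_big f (fun a => g a == b))//=.
apply: eq_bigr => a /eqP gab; apply: eq_bigl => o.
by case: eqP => [->|]; rewrite ?andbF// gab eqxx.
Qed.

Lemma sum_marg1 Om A (w : Om -> R) (f : Om -> A) :
  \sum_a marg w f a = \sum_o w o.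
Proof.
have := sum_marg w f (fun=> 1); rewrite (eq_bigr (marg w f)); last first.
  by move=> a _; rewrite mulr1.
by move=> ->; apply: eq_bigr => o _; rewrite mulr1.
Qed.

Section nonneg.
Variables (Om : finType) (w : Om -> R).
Hypothesis w0 : forall o, 0 <= w o.

Lemma marg_ge0 A (f : Om -> A) a : 0 <= marg w f a.
Proof. by apply: sumr_ge0. Qed.

Lemma marg_ge A (f : Om -> A) o : w o <= marg w f (f o).
Proof. by rewrite /marg (bigD1 o)//= lerDl sumr_ge0. Qed.

Lemma marg_gt0 A (f : Om -> A) o : 0 < w o -> 0 < marg w f (f o).
Proof. by move=> /lt_le_trans; apply; exact: marg_ge. Qed.

Lemma marg_gt0P A (f : Om -> A) a : 0 < marg w f a ->
  exists2 o, f o = a & 0 < w o.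
Proof.
move=> m0; apply/not_exists2P => H; move: m0; rewrite /marg big1 ?ltxx// => o.
move=> /eqP foa; apply/eqP; rewrite eq_le w0 andbT leNgt.
by have [//|/negP] := H o.
Qed.

(** This is [ln x <= x - 1] at [x = q a / marg w f a], averaged over [a]; a subprobability [q]
    suffices. Positivity of [q] on the support matters because [ln 0 = 0]. *)
Lemma gibbs_inequality A (f : Om -> A) (q : A -> R) :
  (forall a, 0 <= q a) -> \sum_a q a <= \sum_o w o ->
  (forall o, 0 < w o -> 0 < q (f o)) ->
  ent w f <= - \sum_o w o * ln (q (f o)).
Proof.
move=> q0 q1 qf; rewrite entE lerN2 -(sum_marg w f (fun a => ln (marg w f a))).
rewrite -(sum_marg w f (fun a => ln (q a))).
rewrite -subr_ge0 -sumrB; apply: (@le_trans _ _ (\sum_a (marg w f a - q a))).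
  by rewrite sumrB sum_marg1 subr_ge0.
apply: ler_sum => a _; rewrite -mulrBr.
have := marg_ge0 f a; rewrite le_eqVlt => /predU1P[<-|m0].
  by rewrite mul0r sub0r oppr_le0.
have qa0 : 0 < q a by have [x <- /qf] := marg_gt0P m0.
have /le_ln1Dx : -1 < q a / marg w f a - 1.
  by have := divr_gt0 qa0 m0; lra.
rewrite addrC subrK ln_div// => h.
rewrite -[leLHS]opprK -[leRHS]opprK lerN2 -mulrN opprB opprB.
apply: le_trans (ler_wpM2l (ltW m0) h) _.
by rewrite mulrBr mulr1 mulrC divfK ?gt_eqF.
Qed.

(** The fibre of [g \o f] through a point contains that of [f], so every logarithm can only grow. *)
Lemma ent_comp_le A B (f : Om -> A) (g : A -> B) : ent w (g \o f) <= ent w f.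
Proof.
rewrite !entE lerN2; apply: ler_sum => o _.
have := w0 o; rewrite le_eqVlt => /predU1P[<-|wo]; first by rewrite !mul0r.
rewrite ler_pM2l// ler_ln ?posrE ?marg_gt0//.
  rewrite /marg big_mkcond [leRHS]big_mkcond; apply: ler_sum => o' _ /=.
  case: eqP => [->|_]; first by rewrite eqxx.
  by case: ifP.
Qed.

Lemma ent_factor A B (f : Om -> A) (g : Om -> B) :
  (forall o o', f o = f o' -> g o = g o') -> ent w g <= ent w f.
Proof.
move=> fg; have [[x0]|Om0] := pselect (inhabited Om); last first.
  rewrite !entE !big1// => o; first by case: Om0.
  by case: Om0.
pose h a := if [pick x | f x == a] is Some x then g x else g x0.
suff -> : g = h \o f by exact: ent_comp_le.
apply/funext => o; rewrite /h /=; case: pickP => [x /eqP /fg ->//|/(_ o)].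
by rewrite eqxx.
Qed.

Hypothesis w1 : \sum_o w o = 1.

Lemma marg_le1 A (f : Om -> A) a : marg w f a <= 1.
Proof.
by rewrite -w1 -(sum_marg1 w f) (bigD1 a)//= lerDl sumr_ge0// => b _; exact: marg_ge0.
Qed.

(** Gibbs' inequality against the product of the two marginals. *)
Lemma ent_pair_le A B (f : Om -> A) (g : Om -> B) :
  ent w (fun o => (f o, g o)) <= ent w f + ent w g.
Proof.
apply: le_trans (@gibbs_inequality _ _ (fun x => marg w f x.1 * marg w g x.2) _ _ _) _.
- by move=> x; rewrite mulr_ge0 ?marg_ge0.
- rewrite -(pair_bigA _ (fun a b => marg w f a * marg w g b))/=.
  under eq_bigr do rewrite -mulr_sumr sum_marg1 w1 mulr1.
  by rewrite sum_marg1.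
- by move=> o wo; rewrite mulr_gt0 ?marg_gt0.
rewrite !entE -opprD -big_split/= lerN2; apply: ler_sum => o _.
have := w0 o; rewrite le_eqVlt => /predU1P[<-|wo]; first by rewrite !mul0r addr0.
by rewrite lnM ?posrE ?marg_gt0// mulrDr.
Qed.

(* The witness in Gibbs' inequality makes the [f t] independent given [g],
   with the given conditional law of [f t] given [g t]. *)
Lemma ent_join_cond (T K L : finType) (f : T -> Om -> K) (g : T -> Om -> L) :
  ent w (fun o => ([ffun t => f t o], [ffun t => g t o])) <=
  ent w (fun o => [ffun t => g t o]) +
  \sum_t (ent w (fun o => (f t o, g t o)) - ent w (g t)).
Proof.
pose G o := [ffun t => g t o]; pose fg t o := (f t o, g t o).
pose q (x : {ffun T -> K} * {ffun T -> L}) :=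
  marg w G x.2 * \prod_t (marg w (fg t) (x.1 t, x.2 t) / marg w (g t) (x.2 t)).
apply: le_trans (@gibbs_inequality _ _ q _ _ _) _.
- move=> x; rewrite mulr_ge0 ?marg_ge0// prodr_ge0// => t _.
  by rewrite divr_ge0 ?marg_ge0.
(* For fixed [b] the sum of products is a product of sums. Each factor is 1, or 0 when [g t] takes
   the value [b t] with mass zero, since then all quotients are 0; so [q] is in general only a
   subprobability. *)
- rewrite w1 -(pair_bigA _ (fun a b => q (a, b)))/= exchange_big/=.
  rewrite -w1 -(sum_marg1 w G); apply: ler_sum => b _.
  rewrite /q/= -mulr_sumr ler_piMr ?marg_ge0//.
  rewrite -(bigA_distr_bigA (fun t k => marg w (fg t) (k, b t) / marg w (g t) (b t))).
  apply: prodr_ile1 => t _; apply/andP; split.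
    by apply: sumr_ge0 => k _; rewrite divr_ge0 ?marg_ge0.
  rewrite -mulr_suml.
  have -> : \sum_i marg w (fg t) (i, b t) = marg w (g t) (b t).
    rewrite /marg [RHS](partition_big (f t) xpredT)//=; apply: eq_bigr => k _.
    by apply: eq_bigl => o; rewrite xpair_eqE andbC.
  by have [->|m0] := eqVneq (marg w (g t) (b t)) 0; rewrite ?mul0r ?divff.
- move=> o wo; rewrite mulr_gt0 ?(marg_gt0 G)// prodr_gt0// => t _.
  rewrite !ffunE divr_gt0//.
    exact: (marg_gt0 (fg t)).
  exact: marg_gt0.
rewrite !entE -!sumrN.
under [X in _ + X]eq_bigr do rewrite !entE opprK addrC -sumrB.
rewrite exchange_big -big_split/=; apply: ler_sum => o _.
have := w0 o; rewrite le_eqVlt => /predU1P[<-|wo].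
  by rewrite !mul0r big1 ?addr0 ?oppr0// => t _; rewrite !mul0r subrr.
rewrite /q/= lnM ?posrE ?(marg_gt0 G)//; last first.
  rewrite prodr_gt0// => t _; rewrite !ffunE divr_gt0//.
    exact: (marg_gt0 (fg t)).
  exact: marg_gt0.
rewrite mulrDr opprD lerD2l.
rewrite (_ : ln _ = \sum_t (ln (marg w (fg t) (f t o, g t o)) - ln (marg w (g t) (g t o)))).
  by rewrite mulr_sumr -sumrN; apply: ler_sum => t _; rewrite mulrBr opprB.
under eq_bigr do rewrite !ffunE.
(* Positivity is carried along with the value, because [ln] is additive only on positive factors. *)
pose P (x y : R) := 0 < x /\ ln x = y.
suff [] : P (\prod_t (marg w (fg t) (f t o, g t o) / marg w (g t) (g t o)))
    (\sum_t (ln (marg w (fg t) (f t o, g t o)) - ln (marg w (g t) (g t o)))) by [].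
apply: (big_ind2 P) => [|x1 x2 y1 y2 [? <-] [? <-]|t _].
- by split; rewrite ?ln1.
- by split; rewrite ?mulr_gt0 ?lnM.
- have f0 := marg_gt0 (fg t) wo; have g0 := marg_gt0 (g t) wo.
  by split; rewrite ?divr_gt0 ?ln_div.
Qed.

Lemma ent_const A (a : A) : ent w (fun=> a) = 0.
Proof.
rewrite entE (_ : marg w _ a = 1) ?ln1 ?big1 ?oppr0// => [x _|].
  by rewrite mulr0.
by rewrite /marg eqxx.
Qed.

(** The conditional bound with trivial conditioning functions. *)
Lemma ent_join_le (T K : finType) (f : T -> Om -> K) :
  ent w (fun o => [ffun t => f t o]) <= \sum_t ent w (f t).
Proof.
pose g (t : T) (o : Om) := tt.
apply: le_trans (le_trans (ent_join_cond f g) _).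
  by apply: ent_factor => o o' [].
rewrite [X in X + _](_ : _ = 0) ?add0r; last first.
  rewrite (_ : (fun o => _) = fun=> [ffun=> tt]) ?ent_const//.
apply: ler_sum => t _; rewrite ent_const subr0.
by apply: ent_factor => o o' ->.
Qed.

(** A crude but explicit bound for a conditional entropy under error probability [e]: the diagonal
    cells cost [e], and each of at most [#|K| ^ 2] off-diagonal cells costs at most
    [2 * Num.sqrt e]. *)
Definition fano_bound (K : finType) (e : R) : R :=
  e + 2 * (#|K| ^ 2)%:R * Num.sqrt e.

(** With [x = s ^+ 2], the inequality [ln s^-1 <= s^-1 - 1] gives [- s * ln s <= 1 - s]; it remains
    to multiply by [2 * s]. *)
Lemma eta_le_sqrt (x : R) : 0 <= x -> - (x * ln x) <= 2 * Num.sqrt x.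
Proof.
rewrite le_eqVlt => /predU1P[<-|x0]; first by rewrite mul0r sqrtr0 mulr0 oppr0.
set s := Num.sqrt x; have s0 : 0 < s by rewrite sqrtr_gt0.
have xE : x = s ^+ 2 by rewrite sqr_sqrtr// ltW.
have /le_ln1Dx : -1 < s^-1 - 1 by have := s0; rewrite -invr_gt0; lra.
rewrite addrC subrK lnV// => h.
have := ler_wpM2l (ltW s0) h; rewrite mulrBr divff ?gt_eqF// mulr1.
rewrite xE lnXn// mulr2n; move: s0; set l := ln s => s0 {}h.
have := ler_wpM2l (ltW s0) h; nra.
Qed.

(** Compares a diagonal cell of mass [x] with the marginal cell of mass [y] around it:
    [x * ln (y / x) <= y - x], and [(y - x) * ln y <= 0]. *)
Lemma eta_diff (x y : R) : 0 <= x -> x <= y -> y <= 1 ->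
  - (x * ln x) <= - (y * ln y) + (y - x).
Proof.
rewrite le_eqVlt => /predU1P[<-|x0].
  move=> xy y1; rewrite mul0r oppr0 addr0 addr_ge0// oppr_ge0.
  by rewrite mulr_ge0_le0 ?ln_le0.
move=> xy y1; have y0 : 0 < y by exact: lt_le_trans xy.
have /le_ln1Dx : -1 < y / x - 1 by have := divr_gt0 y0 x0; lra.
rewrite addrC subrK ln_div// => /(ler_wpM2l (ltW x0)).
rewrite [in leRHS]mulrBr mulr1 [x * (y / x)]mulrC divfK ?gt_eqF// => h.
have : (y - x) * ln y <= 0 by rewrite mulr_ge0_le0 ?subr_ge0 ?ln_le0.
move: h; set a := ln x; set b := ln y; rewrite mulrBr mulrBl; lra.
Qed.

(** The left side is the conditional entropy of [f] given [g]. Diagonal cells are compared with the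
    marginals of [g], the total defect being the error mass; off-diagonal cells have mass at most
    [e] each. *)
Lemma fano (K : finType) (f g : Om -> K) (e : R) :
  \sum_(o | f o != g o) w o <= e ->
  ent w (fun o => (f o, g o)) - ent w g <= fano_bound K e.
Proof.
move=> fge; pose q a b := marg w (fun o => (f o, g o)) (a, b).
have q0 a b : 0 <= q a b by exact: marg_ge0.
have gq b : marg w g b = \sum_a q a b.
  rewrite /marg [LHS](partition_big f xpredT)//=; apply: eq_bigr => k _.
  by apply: eq_bigl => o; rewrite xpair_eqE andbC.
have errE : \sum_(o | f o != g o) w o = \sum_b (marg w g b - q b b).
  rewrite (partition_big g xpredT)//=; apply: eq_bigr => b _.
  apply/eqP; rewrite eq_sym subr_eq; apply/eqP.
  rewrite /marg (bigID (fun o => f o == g o))/= addrC; congr (_ + _).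
    by apply: eq_bigl => o; rewrite andbC.
  apply: eq_bigl => o; rewrite /q xpair_eqE.
  by case: (g o =P b) => [->|]; rewrite /= ?andbT ?andbF.
have e0 : 0 <= \sum_(o | f o != g o) w o by exact: sumr_ge0.
have entfg : ent w (fun o => (f o, g o)) = \sum_b \sum_a - (q a b * ln (q a b)).
  rewrite /ent /shannon -sumrN.
  rewrite -(pair_bigA _ (fun a b => - (q a b * ln (q a b))))/=.
  exact: exchange_big.
rewrite entfg /ent /shannon opprK -big_split/=.
apply: (@le_trans _ _ (\sum_b ((marg w g b - q b b) +
    \sum_(a | a != b) 2 * Num.sqrt (\sum_(o | f o != g o) w o)))).
  apply: ler_sum => b _; rewrite (bigD1 b)//=.
  have qb : q b b <= marg w g b by rewrite gq (bigD1 b)//= lerDl sumr_ge0.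
  have := eta_diff (q0 b b) qb (marg_le1 _ _).
  suff : \sum_(i | i != b) - (q i b * ln (q i b)) <=
    \sum_(a | a != b) 2 * Num.sqrt (\sum_(o | f o != g o) w o) by lra.
  apply: ler_sum => a ab; apply: le_trans (eta_le_sqrt (q0 _ _)) _.
  rewrite ler_pM2l// ler_wsqrtr// /q /marg big_mkcond [leRHS]big_mkcond.
  apply: ler_sum => o _ /=; rewrite xpair_eqE.
  case: (f o =P a) => [->|_] /=; last by case: ifP.
  by case: (g o =P b) => [->|_]; rewrite ?ab//; case: ifP.
rewrite big_split/= -errE /fano_bound lerD//.
apply: (@le_trans _ _ (\sum_(b : K) \sum_(a : K) 2 * Num.sqrt e)).
  apply: ler_sum => b _; rewrite big_mkcond/=; apply: ler_sum => a _.
  case: ifP => _; first by rewrite ler_pM2l// ler_wsqrtr.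
  by rewrite mulr_ge0// sqrtr_ge0.
under eq_bigr do rewrite sumr_const.
by rewrite sumr_const -mulrnA mulnn -[leLHS]mulr_natr mulrAC.
Qed.

(** Errors are paid one coordinate at a time, so the cost is linear in [#|T|] and involves the
    alphabet [K], never the joint alphabet. *)
Lemma ent_join_close (T K : finType) (f g : T -> Om -> K) (e : R) :
  (forall t, \sum_(o | f t o != g t o) w o <= e) ->
  ent w (fun o => [ffun t => f t o]) <=
  ent w (fun o => [ffun t => g t o]) + #|T|%:R * fano_bound K e.
Proof.
move=> fge; apply: le_trans (le_trans (ent_join_cond f g) _).
  by apply: ent_factor => o o' [].
rewrite lerD2l (le_trans (ler_sum _ (fun t _ => fano (fge t))))//.
by rewrite sumr_const mulr_natl.
Qed.

Lemma ent_ge0 A (f : Om -> A) : 0 <= ent w f.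
Proof.
rewrite entE oppr_ge0 sumr_le0// => o _.
by rewrite mulr_ge0_le0// ln_le0// marg_le1.
Qed.

End nonneg.

Lemma shannon_prod (T K : finType) (p : K -> R) :
  (forall k, 0 <= p k) -> \sum_k p k = 1 ->
  shannon (fun a : {ffun T -> K} => \prod_t p (a t)) = #|T|%:R * shannon p.
Proof.
move=> p0 p1; rewrite /shannon mulrN; congr (- _).
pose u (a : {ffun T -> K}) := \prod_t p (a t).
transitivity (\sum_t \sum_(a : {ffun T -> K}) u a * ln (p (a t))).
  rewrite exchange_big; apply: eq_bigr => a _ /=; rewrite -mulr_sumr -/(u a).
  have [->|ua0] := eqVneq (u a) 0; first by rewrite !mul0r.
  have pa t : 0 < p (a t).
    rewrite lt_neqAle p0 andbT eq_sym; apply: contraNneq ua0 => pa0.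
    by rewrite /u (bigD1 t)//= pa0 mul0r.
  congr (_ * _); rewrite /u.
  pose P (x y : R) := 0 < x /\ ln x = y.
  suff [] : P (\prod_t p (a t)) (\sum_t ln (p (a t))) by [].
  apply: (big_ind2 P) => [|x1 x2 y1 y2 [? <-] [? <-]|t _].
  - by split; rewrite ?ln1.
  - by split; rewrite ?mulr_gt0 ?lnM.
  - by split.
(* The factor [ln (p (a t))] is absorbed into coordinate [t], after which the sum over [a]
   factorizes; all coordinates but [t] sum to 1. *)
under eq_bigr => t _.
  under eq_bigr => a _.
    rewrite (_ : u a * _ = \prod_s (p (a s) * (if s == t then ln (p (a s)) else 1))).
      over.
    rewrite big_split/=; congr (_ * _).
    by rewrite -big_mkcond/= big_pred1_eq.
  rewrite -(bigA_distr_bigA (fun s k => p k * (if s == t then ln (p k) else 1))).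
  rewrite (bigD1 t)//= eqxx [X in _ * X]big1 ?mulr1; last first.
    move=> s /negbTE st; rewrite st.
    by under eq_bigr do rewrite mulr1.
  over.
by rewrite sumr_const mulr_natl.
Qed.

End finite_entropy.

(** * Entropy of finite labels *)


(* A finite partition is handled through its labelling function. *)
Definition finite_label d (T : measurableType d) (K : finType) (l : T -> K) :=
  forall k, measurable (l @^-1` [set k]).

Section label_measurability.
Variables (d : measure_display) (T : measurableType d).
Implicit Types K L : finType.

Lemma finite_label_preimage K (l : T -> K) (A : set K) :
  finite_label l -> measurable (l @^-1` A).
Proof.
move=> ml; rewrite (_ : l @^-1` A = \bigcup_(k in A) l @^-1` [set k]); last first.
  by apply/seteqP; split => [x Ax|x [k Ak /= ->]//]; exists (l x).
by apply: fin_bigcup_measurable => // k _; exact: ml.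
Qed.

Lemma finite_label_comp K L (l : T -> K) (g : K -> L) :
  finite_label l -> finite_label (g \o l).
Proof. by move=> ml k; rewrite comp_preimage; exact: finite_label_preimage. Qed.

Lemma finite_label_ffun (I K : finType) (l : I -> T -> K) :
  (forall i, finite_label (l i)) -> finite_label (fun x => [ffun i => l i x]).
Proof.
move=> ml a.
rewrite (_ : _ @^-1` _ = \bigcap_(i in [set: I]) l i @^-1` [set a i]).
  by apply: fin_bigcap_measurable => // i _; exact: ml.
apply/seteqP; split => [x <- i _ /=|x xa /=]; first by rewrite ffunE.
by apply/ffunP => i; rewrite ffunE; exact: xa.
Qed.

Lemma finite_label_pair K L (l : T -> K) (g : T -> L) :
  finite_label l -> finite_label g -> finite_label (fun x => (l x, g x)).
Proof.
move=> ml mg [k k'].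
rewrite (_ : _ @^-1` _ = l @^-1` [set k] `&` g @^-1` [set k']).
  exact: measurableI.
by apply/seteqP; split => [x [<- <-]//|x [/= -> ->]].
Qed.

Lemma finite_label_measurable_comp K (l : T -> K) (f : T -> T) :
  measurable_fun setT f -> finite_label l -> finite_label (l \o f).
Proof.
move=> mf ml k; rewrite comp_preimage -[X in measurable X]setTI.
by apply: mf => //; exact: ml.
Qed.

Lemma finite_label_bool (A : set T) :
  measurable A -> finite_label (fun x => `[< A x >]).
Proof.
move=> mA [].
  rewrite (_ : _ @^-1` _ = A)//; apply/seteqP; split => x /=.
    by move/asboolP.
  by move=> Ax; apply/asboolP.
rewrite (_ : _ @^-1` _ = ~` A); first exact: measurableC.
apply/seteqP; split => x /=; first by move=> /negbT/asboolP.
by move=> Ax; apply/negbTE/asboolP.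
Qed.

End label_measurability.

Section label_entropy.
Variables (R : realType) (d : measure_display) (T : measurableType d).
Variable mu : probability T R.
Implicit Types K L : finType.

Definition law K (l : T -> K) (k : K) : R := fine (mu (l @^-1` [set k])).
Definition label_entropy K (l : T -> K) : R := shannon (law l).

Lemma fine_probability_le (A B : set T) : measurable A -> measurable B ->
  A `<=` B -> fine (mu A) <= fine (mu B).
Proof.
by move=> mA mB AB; rewrite fine_le ?fin_num_measure// le_measure ?inE.
Qed.

Lemma fine_probability_ge0 (A : set T) : 0 <= fine (mu A).
Proof. exact: fine_ge0. Qed.

Lemma fine_measureU (A B : set T) : measurable A -> measurable B ->
  A `&` B = set0 -> fine (mu (A `|` B)) = fine (mu A) + fine (mu B).
Proof.
by move=> mA mB AB0; rewrite measureU// fineD ?fin_num_measure.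
Qed.

Lemma fine_measureU_le (A B : set T) : measurable A -> measurable B ->
  fine (mu (A `|` B)) <= fine (mu A) + fine (mu B).
Proof.
move=> mA mB; have mAB : measurable (A `|` B) by exact: measurableU.
by rewrite -fineD ?fin_num_measure// fine_le ?fin_numD ?fin_num_measure// measureU2.
Qed.

Lemma law_ge0 K (l : T -> K) k : 0 <= law l k.
Proof. exact: fine_probability_ge0. Qed.

Lemma law_preimage K (l : T -> K) (P : pred K) : finite_label l ->
  fine (mu (l @^-1` [set k | P k])) = \sum_(k | P k) law l k.
Proof.
move=> ml; rewrite -big_filter.
have : uniq [seq k <- index_enum K | P k] by rewrite filter_uniq ?index_enum_uniq.
rewrite (_ : l @^-1` [set k | P k] =
  l @^-1` [set k | k \in [seq k <- index_enum K | P k]]); last first.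
  by apply/seteqP; split => x /=; rewrite mem_filter mem_index_enum andbT.
elim: [seq k <- index_enum K | P k] => [_|k s IH /= /andP[ks us]].
  rewrite big_nil (_ : _ @^-1` _ = set0) ?measure0//.
  by rewrite -subset0 => x.
rewrite big_cons -IH//.
rewrite (_ : _ @^-1` _ = l @^-1` [set k] `|` l @^-1` [set k | k \in s]).
  rewrite fine_measureU//; [exact: finite_label_preimage..|].
  by rewrite -subset0 => x [/= -> ]; rewrite (negbTE ks).
apply/seteqP; split => x /=; rewrite inE.
  by move=> /orP[/eqP|]; [left|right].
by move=> [->|->]; rewrite ?eqxx ?orbT.
Qed.

Lemma law_comp K L (l : T -> K) (g : K -> L) : finite_label l ->
  law (g \o l) = marg (law l) g.
Proof.
move=> ml; apply/funext => b; rewrite /marg -law_preimage//; congr (fine (mu _)).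
by apply/seteqP; split => x /= /eqP.
Qed.

Lemma sum_law K (l : T -> K) : finite_label l -> \sum_k law l k = 1.
Proof.
move=> ml; rewrite -(law_preimage predT ml)//.
rewrite (_ : _ @^-1` _ = setT); first by rewrite probability_setT.
by apply/seteqP.
Qed.

Lemma label_entropy_comp K L (l : T -> K) (g : K -> L) : finite_label l ->
  label_entropy (g \o l) = ent (law l) g.
Proof. by move=> ml; rewrite /label_entropy law_comp. Qed.

Lemma label_entropyE K (l : T -> K) : finite_label l ->
  label_entropy l = ent (law l) id.
Proof. exact: (@label_entropy_comp _ _ l id). Qed.

Lemma label_entropy_ge0 K (l : T -> K) : finite_label l -> 0 <= label_entropy l.
Proof.
by move=> ml; rewrite label_entropyE// ent_ge0 ?sum_law// => k; exact: law_ge0.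
Qed.

Lemma label_entropy_factor K L (f : T -> K) (g : T -> L) : finite_label f ->
  (forall x y, f x = f y -> g x = g y) -> label_entropy g <= label_entropy f.
Proof.
move=> mf fg.
pose h k := if pselect (exists x, f x = k) is left e then g (projT1 (cid e))
            else g point.
rewrite (_ : g = h \o f); last first.
  apply/funext => x; rewrite /h /=; case: pselect => [e|[]]; last by exists x.
  by case: cid => y /= /fg.
rewrite label_entropy_comp// label_entropyE//.
by apply: (@ent_comp_le _ _ (law f) _ _ _ id h) => k; exact: law_ge0.
Qed.

Lemma label_entropy_factor_eq K L (f : T -> K) (g : T -> L) :
  finite_label f -> finite_label g ->
  (forall x y, f x = f y <-> g x = g y) -> label_entropy f = label_entropy g.
Proof.
move=> mf mg fg; apply/eqP; rewrite eq_le.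
by rewrite !label_entropy_factor// => x y /fg.
Qed.

Lemma label_entropy_pair_le K L (f : T -> K) (g : T -> L) :
  finite_label f -> finite_label g ->
  label_entropy (fun x => (f x, g x)) <= label_entropy f + label_entropy g.
Proof.
move=> mf mg; have ml := finite_label_pair mf mg.
have w0 := law_ge0 (fun x => (f x, g x)); have w1 := sum_law ml.
have := ent_pair_le w0 w1 fst snd.
by rewrite -!label_entropy_comp.
Qed.

(** The joint law of the pairs [(f i, g i)] places both families on one finite probability space,
    where the finite statement applies to the two projections. *)
Lemma label_entropy_join_close (I K : finType) (f g : I -> T -> K) (e : R) :
  (forall i, finite_label (f i)) -> (forall i, finite_label (g i)) ->
  (forall i, fine (mu [set x | f i x != g i x]) <= e) ->
  label_entropy (fun x => [ffun i => f i x]) <=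
  label_entropy (fun x => [ffun i => g i x]) + #|I|%:R * fano_bound K e.
Proof.
move=> mf mg fge; pose l x := [ffun i => (f i x, g i x)].
have ml : finite_label l.
  by apply: finite_label_ffun => i; exact: finite_label_pair.
have w0 := law_ge0 l; have w1 := sum_law ml.
have := ent_join_close w0 w1 (f := fun i (a : {ffun I -> K * K}) => (a i).1)
  (g := fun i a => (a i).2) (e := e).
rewrite -!label_entropy_comp//.
rewrite (_ : _ \o _ = fun x => [ffun i => f i x]); last first.
  by apply/funext => x /=; apply/ffunP => i; rewrite !ffunE.
rewrite (_ : _ \o _ = fun x => [ffun i => g i x]); last first.
  by apply/funext => x /=; apply/ffunP => i; rewrite !ffunE.
apply => i; rewrite -law_preimage//; apply: le_trans (fge i).
rewrite le_eqVlt; apply/orP; left; apply/eqP; congr (fine (mu _)).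
by apply/seteqP; split => x /=; rewrite ffunE.
Qed.

Lemma partition_labelP (I : finType) (xi : I -> set T) :
  measurable_partition xi ->
  exists2 l : T -> I, finite_label l & xi = fun i => l @^-1` [set i].
Proof.
move=> [mxi txi cxi].
have /choice[l lxi] x : exists i, xi i x.
  have : (\bigcup_i xi i) x by rewrite cxi.
  by move=> [i _ ?]; exists i.
have xiE : xi = fun i => l @^-1` [set i].
  apply/funext => i; apply/seteqP; split => [x xix|x /= <-//].
  by apply: (txi (l x) i) => //; exists x.
by exists l => // i; rewrite -(congr1 (fun f => f i) xiE).
Qed.

Lemma label_partition (I : finType) (l : T -> I) : finite_label l ->
  measurable_partition (fun i => l @^-1` [set i]).
Proof.
move=> ml; split => //.
  by apply/trivIsetP => i j _ _ ij; rewrite -subset0 => x [/= -> /eqP]; exact/negP.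
by apply/seteqP; split => // x _; exists (l x).
Qed.

Lemma entropy_label (I : finType) (l : T -> I) :
  entropy mu (fun i => l @^-1` [set i]) = label_entropy l.
Proof. by []. Qed.

End label_entropy.

Section automorphism_labels.
Variables (R : realType) (d : measure_display) (T : measurableType d).
Variable mu : probability T R.
Variable S : automorphism mu.
Implicit Types K L : finType.

Lemma aut_inv_preserving A : measurable A -> mu (aut_inv S @^-1` A) = mu A.
Proof.
move=> mA; transitivity (mu (S @^-1` (aut_inv S @^-1` A))).
  rewrite aut_preserving// -[X in measurable X]setTI.
  exact: aut_inv_measurable.
by congr (mu _); apply/seteqP; split => x /=; rewrite aut_funK.
Qed.

Lemma measurable_iter (f : T -> T) n : measurable_fun setT f ->
  measurable_fun setT (iter n f).
Proof.
move=> mf; elim: n => [|n IH]; first exact: measurable_id.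
exact: (measurableT_comp mf IH).
Qed.

Lemma preserving_iter (f : T -> T) n A : measurable_fun setT f ->
  (forall A, measurable A -> mu (f @^-1` A) = mu A) ->
  measurable A -> mu (iter n f @^-1` A) = mu A.
Proof.
move=> mf pf; elim: n A => // n IH A mA.
rewrite (_ : iter n.+1 f @^-1` A = iter n f @^-1` (f @^-1` A))// IH ?pf//.
by rewrite -[X in measurable X]setTI; apply: mf.
Qed.

Lemma aut_pow_measurable p : measurable_fun setT (aut_pow S p).
Proof.
by case: p => n; apply: measurable_iter;
  [exact: aut_measurable|exact: aut_inv_measurable].
Qed.

Lemma aut_pow_preserving p A : measurable A -> mu (aut_pow S p @^-1` A) = mu A.
Proof.
case: p => n mA; apply: preserving_iter => //.
- exact: aut_measurable.
- exact: aut_preserving.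
- exact: aut_inv_measurable.
- exact: aut_inv_preserving.
Qed.

Lemma aut_powS p x : aut_pow S (p + 1) x = S (aut_pow S p x).
Proof.
case: p => [n|[|n]] //=; first by rewrite addn1.
  by rewrite aut_invK.
by rewrite aut_invK subn1.
Qed.

Lemma aut_powB1 p x : aut_pow S (p - 1) x = aut_inv S (aut_pow S p x).
Proof. by rewrite -{2}(subrK 1 p) aut_powS aut_funK. Qed.

Lemma aut_powD p q x : aut_pow S (p + q) x = aut_pow S p (aut_pow S q x).
Proof.
elim/int_rect: p => [|n IH|n IH]; first by rewrite add0r.
  by rewrite intS [1 + _]addrC addrAC aut_powS IH aut_powS.
by rewrite intS opprD [- 1 - _]addrC addrAC aut_powB1 IH aut_powB1.
Qed.

Lemma aut_powK p : cancel (aut_pow S p) (aut_pow S (- p)).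
Proof. by move=> x; rewrite -aut_powD addNr. Qed.

Lemma aut_powVK p : cancel (aut_pow S (- p)) (aut_pow S p).
Proof. by move=> x; rewrite -aut_powD addrN. Qed.

Lemma image_aut_pow p A : aut_pow S p @` A = aut_pow S (- p) @^-1` A.
Proof.
apply/seteqP; split => [_ [x Ax <-]|x Ax]; first by rewrite /= aut_powK.
by exists (aut_pow S (- p) x) => //; rewrite aut_powVK.
Qed.

Lemma finite_label_aut K (l : T -> K) p :
  finite_label l -> finite_label (l \o aut_pow S p).
Proof.
by move=> ml; apply: finite_label_measurable_comp => //; exact: aut_pow_measurable.
Qed.

Lemma law_aut K (l : T -> K) p : finite_label l ->
  law mu (l \o aut_pow S p) = law mu l.
Proof.
move=> ml; apply/funext => k; rewrite /law comp_preimage aut_pow_preserving//.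
Qed.

Lemma label_entropy_aut K (l : T -> K) p : finite_label l ->
  label_entropy mu (l \o aut_pow S p) = label_entropy mu l.
Proof. by move=> ml; rewrite /label_entropy law_aut. Qed.

(** The cell of [T^p xi] containing [x] is read at the point [T^-p x], hence the minus sign. *)
Definition join_label (P : {fset int}) K (l : T -> K) (x : T) : {ffun P -> K} :=
  [ffun p => l (aut_pow S (- val p) x)].

Lemma finite_label_join (P : {fset int}) K (l : T -> K) :
  finite_label l -> finite_label (join_label P l).
Proof.
move=> ml; apply: (@finite_label_ffun _ _ P K
  (fun p x => l (aut_pow S (- val p) x))) => p.
exact: finite_label_aut.
Qed.

Lemma entropy_join_images (P : {fset int}) K (l : T -> K) :
  entropy mu (join_images S P (fun i => l @^-1` [set i])) =
  label_entropy mu (join_label P l).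
Proof.
rewrite -entropy_label; congr (entropy mu _); apply/funext => a.
apply/seteqP; split => x /= xa.
  apply/ffunP => p; rewrite ffunE.
  by have := xa p; rewrite image_aut_pow.
by move=> p; rewrite image_aut_pow/= -xa ffunE.
Qed.

(** After division by the size of [P] the error is the same for every [P], so a partition may be
    replaced by a close one before the limit in [j]. *)
Lemma join_label_close (P : {fset int}) K (l l' : T -> K) e :
  finite_label l -> finite_label l' -> fine (mu [set x | l x != l' x]) <= e ->
  label_entropy mu (join_label P l) <=
  label_entropy mu (join_label P l') + (#|` P|)%:R * fano_bound K e.
Proof.
move=> ml ml' lle; rewrite cardfE.
apply: (@label_entropy_join_close _ _ _ _ P K
  (fun p x => l (aut_pow S (- val p) x))
  (fun p x => l' (aut_pow S (- val p) x))) => p; [exact: finite_label_aut..|].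
rewrite (_ : [set x | _] = aut_pow S (- val p) @^-1` [set x | l x != l' x])//.
rewrite aut_pow_preserving//.
exact: (finite_label_preimage [set x | x.1 != x.2] (finite_label_pair ml ml')).
Qed.

End automorphism_labels.

Section limn_esup.
Variable R : realType.
Implicit Types (u : (\bar R)^nat) (c : \bar R).
Local Open Scope ereal_scope.

Lemma limn_esup_le u c : (\forall n \near \oo, u n <= c) -> limn_esup u <= c.
Proof.
move=> uc; apply: (@le_trans _ _ (ereal_sup (u @` [set n | u n <= c]))).
  by apply: ereal_inf_lbound; exists [set n | u n <= c].
by apply: ge_ereal_sup => _ [n /= ? <-].
Qed.

Lemma limn_esup_ge u c : (\forall n \near \oo, c <= u n) -> c <= limn_esup u.
Proof.
move=> uc; apply: le_ereal_inf_tmp => _ [V VF <-].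
have : (\forall n \near \oo, V n /\ c <= u n) by near=> n; split; near: n.
move=> [N _ /(_ N)] /= [//|VN cu]; apply: (le_trans cu).
by apply: ereal_sup_ubound; exists N.
Unshelve. all: by end_near. Qed.

Lemma limn_esup_lt u c : limn_esup u < c -> \forall n \near \oo, u n < c.
Proof.
move=> /ereal_inf_lt[_ [V VF <-] Vc]; apply: filterS VF => n Vn.
by apply: le_lt_trans Vc; apply: ereal_sup_ubound; exists n.
Qed.

End limn_esup.

(** * Zero entropy along progressions *)


Definition set_algebra (T : Type) (G : set (set T)) :=
  [/\ G setT, (forall A, G A -> G (~` A)) &
      (forall A B, G A -> G B -> G (A `|` B))].

(** * Approximation of partitions by a generating algebra *)

Section approximation.
Variables (R : realType) (d : measure_display) (T : measurableType d).
Variable mu : probability T R.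

Lemma fine_measure_cover_le (I : finType) (F : I -> set T) (A : set T) :
  measurable A -> (forall i, measurable (F i)) ->
  (forall x, A x -> exists i, F i x) ->
  fine (mu A) <= \sum_i fine (mu (F i)).
Proof.
move=> mA mF AF; pose B := \big[setU/set0]_(i <- index_enum I) F i.
have mB : measurable B by exact: bigsetU_measurable.
apply: (@le_trans _ _ (fine (mu B))).
  apply: fine_probability_le => // x /AF[i Fix].
  by rewrite /B -bigcup_seq; exists i => //=; rewrite mem_index_enum.
rewrite /B; elim: (index_enum I) => [|i s IH].
  by rewrite !big_nil measure0.
rewrite !big_cons; apply: le_trans (fine_measureU_le _ _ _) _ => //.
  exact: bigsetU_measurable.
by rewrite lerD2l.
Qed.

Lemma measurable_setY (A B : set T) :
  measurable A -> measurable B -> measurable (A `+` B).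
Proof.
by move=> mA mB; rewrite setY_def; apply: measurableU; exact: measurableD.
Qed.

Lemma setY_triangle (A B C : set T) : A `+` C `<=` (A `+` B) `|` (B `+` C).
Proof.
rewrite !setY_def => x [[Ax nC]|[Cx nA]]; have [Bx|nB] := pselect (B x).
- by right; left.
- by left; left.
- by left; right.
- by right; right.
Qed.

Lemma measure_setY_triangle (A B C : set T) :
  measurable A -> measurable B -> measurable C ->
  fine (mu (A `+` C)) <= fine (mu (A `+` B)) + fine (mu (B `+` C)).
Proof.
move=> mA mB mC; apply: le_trans (fine_measureU_le mu _ _).
- apply: fine_probability_le; [exact: measurable_setY| |exact: setY_triangle].
  by apply: measurableU; exact: measurable_setY.
- exact: measurable_setY.
- exact: measurable_setY.
Qed.

(** The approximable sets form a sigma-algebra containing [G]: complements and finite unions pass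
    directly, countable unions by continuity from below. *)
Lemma algebra_approx (G : set (set T)) : set_algebra G -> G `<=` measurable ->
  forall A, <<s G >> A -> forall e : R, 0 < e ->
  exists2 B, G B & fine (mu (A `+` B)) < e.
Proof.
move=> [GT GC GU] Gm A GA e e0.
pose E := [set A | measurable A /\
  forall e : R, 0 < e -> exists2 B, G B & fine (mu (A `+` B)) < e].
suff : E A by move=> [_]; apply.
have EU A1 A2 : E A1 -> E A2 -> E (A1 `|` A2).
  move=> [m1 E1] [m2 E2]; split; first exact: measurableU.
  move=> r r0; have r20 : 0 < r / 2 by rewrite divr_gt0.
  have [B1 G1 B1r] := E1 _ r20; have [B2 G2 B2r] := E2 _ r20.
  exists (B1 `|` B2); first exact: GU.
  rewrite [ltRHS]splitr; apply: le_lt_trans (ltrD B1r B2r).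
  have mB1 := Gm _ G1; have mB2 := Gm _ G2.
  apply: le_trans (fine_measureU_le mu _ _); try exact: measurable_setY.
  apply: fine_probability_le.
  - by apply: measurable_setY; exact: measurableU.
  - by apply: measurableU; exact: measurable_setY.
  rewrite !setY_def => x [[[]Ax /not_orP[n1 n2]]|[[]Bx /not_orP[n1 n2]]].
  - by left; left.
  - by right; left.
  - by left; right.
  - by right; right.
have E0 : E set0.
  split=> // r r0; exists set0; last by rewrite setYK measure0.
  by rewrite -setCT; exact: GC.
move: A GA; apply: smallest_sub; last first.
  by move=> A GA; split; [exact: Gm|move=> r r0; exists A => //; rewrite setYK measure0].
split=> //.
  move=> A [mA EA]; rewrite setTD; split; first exact: measurableC.
  move=> r r0; have [B GB Br] := EA _ r0; exists (~` B); first exact: GC.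
  rewrite (_ : ~` A `+` ~` B = A `+` B)//.
  rewrite !setY_def !setDE !setCK setUC.
  by rewrite setIC [X in _ `|` X]setIC setUC.
move=> F EF; pose U n := \big[setU/set0]_(i < n) F i.
have EUn n : E (U n).
  by elim: n => [|n IH]; rewrite /U ?big_ord0// big_ord_recr/=; exact: EU.
have mF : measurable (\bigcup_k F k).
  by apply: bigcup_measurable => k _; case: (EF k).
have UE : \bigcup_n U n = \bigcup_k F k.
  rewrite -(bigcup_bigsetU_bigcup F); apply/seteqP; split => x [n _ Unx].
    by exists n => //; rewrite big_ord_recr/=; left.
  by exists n.+1.
split=> // r r0; have r20 : 0 < r / 2 by rewrite divr_gt0.
have : mu \o U @ \oo --> mu (\bigcup_n U n).
  apply: nondecreasing_cvg_mu => //; first by move=> i; case: (EUn i).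
    by rewrite UE.
  by move=> m n mn; apply/subsetPset; exact: subset_bigsetU.
rewrite UE -[X in _ --> X]fineK; last exact: fin_num_measure.
move=> /fine_cvgP[_ /cvgrPdist_lt /(_ _ r20)[N _ /(_ _ (leqnn N))]] /= UN.
have [mUN /(_ _ r20)[B GB Br]] := EUn N; exists B => //.
rewrite [ltRHS]splitr.
apply: le_lt_trans (measure_setY_triangle _ mUN _) _ => //; first exact: Gm.
apply: ltrD => //; apply: le_lt_trans UN.
have UNF : U N `<=` \bigcup_k F k.
  by rewrite -UE; exact: bigcup_sup.
rewrite [in leLHS]setY_def (_ : U N `\` _ = set0) ?setU0; last first.
  by apply/seteqP; split => // x [/UNF].
rewrite -[X in fine (mu X) - _](setDUK UNF) fine_measureU//.
- by rewrite addrC addKr ler_norm.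
- exact: measurableD.
- by rewrite setDE setICA setICr setI0.
Qed.

(** Each cell is approximated within [e / #|K|] by a set of [G]. Off the union of the symmetric
    differences exactly one of these sets contains the point, and [h] returns its index. *)
Lemma label_approx (G : set (set T)) : set_algebra G -> G `<=` measurable ->
  (forall A, measurable A -> exists2 B, <<s G >> B & mu (A `+` B) = 0%E) ->
  forall (K : finType) (l : T -> K) (e : R), finite_label l -> 0 < e ->
  exists (B : K -> set T) (h : {ffun K -> bool} -> K),
    (forall k, G (B k)) /\
    fine (mu [set x | l x != h [ffun k => `[< B k x >]]]) <= e.
Proof.
move=> aG Gm Gd K l e ml e0.
have K0 : 0 < #|K|%:R :> R by rewrite ltr0n; apply/card_gt0P; exists (l point).
have e'0 : 0 < e / #|K|%:R by rewrite divr_gt0.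
have mGs : <<s G >> `<=` measurable.
  by apply: smallest_sub => //; exact: sigma_algebra_measurable.
have /choice[B BP] k : exists B, G B /\
    fine (mu (l @^-1` [set k] `+` B)) <= e / #|K|%:R.
  have [C GC AC] := Gd _ (ml k).
  have [B GB CB] := algebra_approx aG Gm GC e'0; exists B; split => //.
  have mC := mGs _ GC; have mB := Gm _ GB.
  apply: le_trans (measure_setY_triangle (ml k) mC mB) _.
  by rewrite AC add0r ltW.
pose h (a : {ffun K -> bool}) := if [pick k | a k] is Some k then k else l point.
exists B, h; split; first by move=> k; case: (BP k).
have mB k : measurable (B k) by apply: Gm; case: (BP k).
apply: (@le_trans _ _ (\sum_k fine (mu (l @^-1` [set k] `+` B k)))).
  apply: fine_measure_cover_le.
  - pose l' x := (l x, h [ffun k => `[< B k x >]]).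
    apply: (@finite_label_preimage _ _ _ l' [set x | x.1 != x.2]).
    apply: finite_label_pair => //; apply: (finite_label_comp h).
    by apply: finite_label_ffun => k; exact: finite_label_bool.
  - by move=> k; exact: measurable_setY.
  move=> x /= lx; apply: contrapT => /forallNP nx; move: lx => /negP; apply.
  have BE k : `[< B k x >] = (k == l x).
    apply/asboolP/eqP => [Bx|->].
      apply: contrapT => nk; apply: (nx k); right; split => //=.
      by move=> lk; apply: nk.
    by apply: contrapT => nB; apply: (nx (l x)); left; split.
  rewrite /h; case: pickP => [k|/(_ (l x))]; rewrite ffunE BE ?eqxx//.
  by rewrite eq_sym.
apply: (@le_trans _ _ (\sum_(k : K) e / #|K|%:R)).
  by apply: ler_sum => k _; case: (BP k).
rewrite sumr_const -[leLHS]mulr_natr (_ : _ * _ = e)//.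
by apply: divfK; rewrite gt_eqF.
Qed.

End approximation.

Section fekete.
Variable R : realType.

(** The limit is the infimum: take [M] nearly optimal and divide [n] by [M]; the remainder costs at
    most the constant [C], negligible after division by [n]. *)
Lemma fekete (a : nat -> R) : (forall n, 0 <= a n) ->
  (forall m n, a (m + n)%N <= a m + a n) ->
  exists2 c : R, 0 <= c & a n / n%:R @[n --> \oo] --> c.
Proof.
move=> a0 asub; pose A := [set a n.+1 / n.+1%:R | n in setT].
have Alb : has_inf A.
  split; first by exists (a 1%N / 1%:R); exists 0%N.
  by exists 0 => _ [n _ <-]; rewrite divr_ge0.
exists (inf A).
  by apply: lb_le_inf; [case: Alb|move=> _ [n _ <-]; rewrite divr_ge0].
apply/cvgrPdist_le => /= e e0; have e20 : 0 < e / 2 by rewrite divr_gt0.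
have [_ [m _ <-] am] := inf_adherent e20 Alb.
set M := m.+1 in am; pose C := \sum_(r < M) a r.
have aC r : (r < M)%N -> a r <= C.
  by move=> rM; rewrite /C (bigD1 (Ordinal rM))//= lerDl sumr_ge0.
have aq q r : (r < M)%N -> a (q * M + r)%N <= q%:R * a M + C.
  move=> rM; elim: q => [|q IH]; first by rewrite mul0n add0n mul0r add0r aC.
  rewrite mulSn -addnA (le_trans (asub _ _))// -natr1 mulrDl mul1r.
  by rewrite [_ + a M]addrC -addrA lerD2l.
have [N HN] : exists N : nat, C / (e / 2) <= N%:R.
  by exists (Num.truncn (C / (e / 2))).+1; rewrite ltW// truncnS_gt.
near=> n; have n0 : (0 < n)%N by near: n; exists 1%N.
have nN : (N <= n)%N by near: n; exists N.
have n0R : 0 < n%:R :> R by rewrite ltr0n.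
have lo : inf A <= a n / n%:R.
  apply: ge_inf; first by case: Alb.
  by exists n.-1 => //; rewrite prednK.
rewrite ler_norml; apply/andP; split; last by rewrite lerBlDr ler_wpDl// ltW.
suff : a n / n%:R <= a M / M%:R + e / 2.
  by move: am; set u := a M / _; set v := a n / _; lra.
have Cn : C / n%:R <= e / 2.
  rewrite ler_pdivrMr// mulrC -ler_pdivrMr//; apply: le_trans HN _.
  by rewrite ler_nat.
apply: (@le_trans _ _ (a M / M%:R + C / n%:R)); last by rewrite lerD2l.
rewrite ler_pdivrMr// mulrDl divfK ?gt_eqF//.
rewrite {1}(divn_eq n M) (le_trans (aq _ _ _)) ?ltn_pmod// lerD2r.
rewrite mulrAC -mulrA [leRHS]mulrC ler_wpM2r//.
by rewrite ler_pdivlMr ?ltr0n// -natrM ler_nat leq_divM.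
Unshelve. all: by end_near. Qed.

End fekete.

Section zero_entropy.
Variables (R : realType) (d : measure_display) (T : measurableType d).
Variable mu : probability T R.
Variable S : automorphism mu.

Definition orbit_label (K : finType) (l : T -> K) n (x : T) : {ffun 'I_n -> K} :=
  [ffun i : 'I_n => l (aut_pow S i x)].

Lemma finite_label_orbit (K : finType) (l : T -> K) n :
  finite_label l -> finite_label (orbit_label l n).
Proof.
move=> ml; apply: (@finite_label_ffun _ _ 'I_n K (fun i x => l (aut_pow S i x))).
by move=> i; exact: finite_label_aut.
Qed.

Let a (K : finType) (l : T -> K) n := label_entropy mu (orbit_label l n).

(** A word of length [m + n] splits at time [m]; its second part is a word of length [n] read from a
    shifted point, with the same law. *)
Lemma orbit_label_subadditive (K : finType) (l : T -> K) : finite_label l ->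
  forall m n, a l (m + n)%N <= a l m + a l n.
Proof.
move=> ml m n; have mo k : finite_label (orbit_label l k).
  exact: finite_label_orbit.
rewrite /a -(label_entropy_aut S m (mo n)).
have mo' := finite_label_aut S (Posz m) (mo n).
apply: le_trans (label_entropy_pair_le mu (mo m) mo').
apply: label_entropy_factor; first exact: finite_label_pair.
move=> x y [/ffunP xy1 /ffunP xy2]; apply/ffunP => i; rewrite !ffunE.
have [im|mi] := ltnP i m.
  by have := xy1 (Ordinal im); rewrite !ffunE.
have lt_i : (i - m < n)%N by rewrite ltn_subLR.
have iE z : aut_pow S i z = aut_pow S (i - m)%N%:Z (aut_pow S m z).
  by rewrite -aut_powD -PoszD subnK.
by have := xy2 (Ordinal lt_i); rewrite !ffunE !iE.
Qed.

(** The negative exponents of the join cancel the sign in [join_label], leaving the forward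
    orbit. *)
Lemma KS_orbit_label (K : finType) (l : T -> K) n : finite_label l ->
  entropy mu (join_images S [fset - k%:Z | k in iota 0 n]%fset
    (fun i => l @^-1` [set i])) = a l n.
Proof.
move=> ml; rewrite entropy_join_images; apply: label_entropy_factor_eq.
- exact: finite_label_join.
- exact: finite_label_orbit.
move=> x y; split => /ffunP xy; apply/ffunP => i; rewrite !ffunE.
  have iP : - (i : nat)%:Z \in [fset - k%:Z | k in iota 0 n]%fset.
    by apply/imfsetP; exists (i : nat) => //=; rewrite mem_iota/= add0n.
  by have := xy [` iP]%fset; rewrite !ffunE /= opprK.
have /imfsetP[k /=] := valP i; rewrite mem_iota add0n => /= kn ->.
by rewrite opprK; have := xy (Ordinal kn); rewrite !ffunE.
Qed.

Hypothesis S0 : KS_entropy S = 0%E.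

(** The [limn] in the definition of entropy is meaningful once the sequence converges, which
    subadditivity provides; the limit is then bounded by the supremum, which is zero. *)
Lemma zero_entropy_orbit n (l : T -> 'I_n) : finite_label l ->
  a l m / m%:R @[m --> \oo] --> (0 : R).
Proof.
move=> ml; have [|c c0 ac] := fekete _ (orbit_label_subadditive ml).
  by move=> m; apply: label_entropy_ge0; exact: finite_label_orbit.
suff : c <= 0 by move=> cn; rewrite (_ : 0 = c)//; apply/eqP; rewrite eq_le c0 cn.
rewrite -lee_fin; apply: (@le_trans _ _ (KS_entropy S)); last by rewrite S0.
apply: ereal_sup_ubound.
exists n, (fun i => l @^-1` [set i]); split; first exact: label_partition.
rewrite /KS_entropy_partition; apply/esym/cvg_lim => //.
under eq_fun do rewrite KS_orbit_label// mulrC.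
by apply: cvg_EFin; [exact: nearW|exact: ac].
Qed.

Lemma zero_entropy_progression n (l : T -> 'I_n) (j N : nat) (e : R) :
  finite_label l -> (0 < j)%N -> 0 < e -> exists L, [/\ (N <= L)%N, (0 < L)%N &
    label_entropy mu
      (join_label S [fset (k * j)%N%:Z | k in iota 1 L]%fset l) <= L%:R * e].
Proof.
(* The word covering the progression has length [L * j + 1 <= 2 * L * j], hence the rate
   [e / (2 * j)]. *)
move=> ml j0 e0; have e'0 : 0 < e / (2 * j%:R) by rewrite divr_gt0// mulr_gt0 ?ltr0n.
have /cvgrPdist_le/(_ _ e'0)[M _ HM] := zero_entropy_orbit ml.
have [L [NL ML L0]] : exists L, [/\ (N <= L)%N, (M <= L)%N & (0 < L)%N].
  by exists (N + M).+1; split; lia.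
exists L; split => //.
pose q := (L * j).+1.
apply: (@le_trans _ _ (a l q)).
  (* The progression is read at the times [- k * j]; starting the word at time [- L * j] turns them
     into indices between 0 and [L * j]. *)
  rewrite /a -(label_entropy_aut S (- (L * j)%N%:Z) (finite_label_orbit (n := q) ml)).
  apply: label_entropy_factor.
    by apply: finite_label_aut; exact: finite_label_orbit.
  move=> x y /ffunP xy; apply/ffunP => p; rewrite !ffunE.
  have /imfsetP[k kiota ->] := valP p.
  have : k \in iota 1 L := kiota; rewrite mem_iota add1n => /andP[k1 kL].
  have kq : (L * j - k * j < q)%N by rewrite ltnS leq_subr.
  have kE z : aut_pow S (- (k * j)%N%:Z) z =
      aut_pow S (L * j - k * j)%N%:Z (aut_pow S (- (L * j)%N%:Z) z).
    have LE : (L * j = L * j - k * j + k * j)%N.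
      by rewrite subnK// leq_mul2r -ltnS kL orbT.
    by rewrite -aut_powD [in X in _ - X]LE PoszD opprD addrA subrr add0r.
  by have := xy (Ordinal kq); rewrite /= !ffunE !kE.
have Mq : (M <= q)%N by rewrite /q; nia.
have := HM q Mq; rewrite sub0r normrN ger0_norm ?divr_ge0//; last first.
  by apply: label_entropy_ge0; exact: finite_label_orbit.
rewrite ler_pdivrMr ?ltr0n// => /le_trans; apply.
rewrite [leLHS]mulrC.
rewrite mulrA ler_pdivrMr ?mulr_gt0 ?ltr0n// [leRHS]mulrAC ler_pM2r//.
by rewrite -!natrM ler_nat /q; nia.
Qed.

Hypothesis Sstd : standard_probability mu.

(** The labels record the comparisons of [f x] with the first [m] rationals. They refine one
    another, and rational rays generate the Borel sets, so these labels are dense among all finite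
    labels: this is the sequence over which [L] is diagonalized. *)
Lemma standard_label_approx : exists lab : forall m, T -> {ffun 'I_m -> bool},
  [/\ forall m, finite_label (lab m),
   forall m n x y, (m <= n)%N -> lab n x = lab n y -> lab m x = lab m y &
   forall (K : finType) (l : T -> K) (e : R), finite_label l -> 0 < e ->
   exists m (h : {ffun 'I_m -> bool} -> K),
     fine (mu [set x | l x != h (lab m x)]) <= e].
Proof.
have [f [T0 [mT0 muT0 fI fB]]] := Sstd.
(* An enumeration of the rationals; an index coding no rational is sent to 0, which only repeats a
   comparison. *)
pose q (i : nat) : R := if (choice.unpickle i : option rat) is Some r then ratr r else 0.
pose lab m x : {ffun 'I_m -> bool} := [ffun i : 'I_m => f x < q i].
have mlab m : finite_label (lab m).
  apply: (@finite_label_ffun _ _ 'I_m bool (fun i x => f x < q i)) => i.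
  rewrite (_ : (fun x => _) = fun x => `[< (f @^-1` `]-oo, q i[%classic) x >]).
    apply: finite_label_bool; rewrite -[X in measurable X]setTI.
    by apply: (measurable_funP f) => //; exact: measurable_itv.
  by apply/funext => x; apply/idP/asboolP; rewrite /= in_itv.
have labS m n x y : (m <= n)%N -> lab n x = lab n y -> lab m x = lab m y.
  move=> mn /ffunP xy; apply/ffunP => i.
  by have := xy (widen_ord mn i); rewrite !ffunE.
exists lab; split => // K l e ml e0.
pose G := [set A | exists m Q, A = lab m @^-1` Q].
have GA : set_algebra G.
  split.
  - by exists 0%N, setT.
  - by move=> _ [m [Q ->]]; exists m, (~` Q).
  - move=> _ _ [m1 [Q1 ->]] [m2 [Q2 ->]]; pose m := maxn m1 m2.
    exists m, (lab m @` (lab m1 @^-1` Q1 `|` lab m2 @^-1` Q2)).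
    apply/seteqP; split => [x ?|x [y yQ yx]]; first by exists x.
    case: yQ => Qy; [left|right]; rewrite /=.
      by rewrite -(labS m1 m y x)// leq_maxl.
    by rewrite -(labS m2 m y x)// leq_maxr.
have Gm : G `<=` measurable.
  by move=> _ [m [Q ->]]; exact: finite_label_preimage.
have Gf B : measurable B -> <<s G >> (f @^-1` B).
  move=> mB; have {mB} : <<s @measurable_realfun.RGenInftyO.G R >> B.
    have := congr1 (fun C => C B) (@measurable_realfun.RGenInftyO.measurableE R).
    by move=> E; exact: (@eq_ind Prop _ id mB _ E).
  move: B; apply: smallest_sub.
    have sG := smallest_sigma_algebra setT G; split.
    - by rewrite preimage_set0; case: sG.
    - by move=> A fA; case: sG => _ sGC _; exact: (sGC _ fA).
    - by move=> F FG; rewrite preimage_bigcup; case: sG => _ _; exact.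
  move=> _ [r ->].
  pose F i := if q i <= r then f @^-1` `]-oo, q i[%classic else set0.
  rewrite (_ : _ @^-1` _ = \bigcup_i F i).
    apply: sigma_algebra_bigcup => i; rewrite /F; case: ifP => _.
      apply: sub_sigma_algebra; exists i.+1, [set a : {ffun 'I_i.+1 -> bool} | a ord_max].
      by apply/seteqP; split => x /=; rewrite ffunE in_itv.
    exact: sigma_algebra0.
  apply/seteqP; split => [x /=|x [i _]].
    rewrite in_itv/= => /rat_in_itvoo[s]; rewrite in_itv/= => /andP[xs sr].
    exists (choice.pickle s) => //; rewrite /F /q choice.pickleK (ltW sr).
    by rewrite /= in_itv.
  rewrite /F; case: ifPn => //= qr; rewrite !in_itv/= => /lt_le_trans; exact.
have Gd A : measurable A -> exists2 B, <<s G >> B & mu (A `+` B) = 0%E.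
  move=> mA; have mAT : measurable (A `&` T0) by exact: measurableI.
  have [|B [mB BA AB]] := fB _ mAT; first exact: subIsetr.
  exists (f @^-1` B); first exact: Gf.
  have mfB : measurable (f @^-1` B).
    by rewrite -[X in measurable X]setTI; apply: (measurable_funP f).
  have mTC : measurable (~` T0) by exact: measurableC.
  have muTC : mu (~` T0) = 0%E by rewrite probability_setC// muT0 subee.
  have mN : measurable (~` T0 `|` ((A `&` T0) `\` f @^-1` B)).
    by apply: measurableU => //; exact: measurableD.
  apply/eqP; rewrite -measure_le0; apply: (@le_trans _ _ (mu (~` T0 `|` ((A `&` T0) `\` f @^-1` B)))).
    rewrite le_measure ?inE//; first exact: measurable_setY.
    rewrite setY_def => x [[Ax nB]|[/= Bx nA]]; have [T0x|] := pselect (T0 x).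
    - by right.
    - by left.
    - exfalso; apply: nA; have [y [Ay T0y] yx] := BA _ Bx.
      by rewrite -(fI y x)// inE.
    - by left.
  have <- : (mu (~` T0) + mu ((A `&` T0) `\` f @^-1` B) = 0)%E.
    by rewrite muTC AB adde0.
  by apply: measureU2 => //; exact: measurableD.
have [B [h [GB Bh]]] := label_approx GA Gm Gd ml e0.
(* Each approximating set depends on finitely many comparisons; [M] below serves all of them. *)
have /choice[m mB] k : exists m, forall x y, lab m x = lab m y -> B k x -> B k y.
  by have [m [Q ->]] := GB k; exists m => x y /= ->.
pose M := \max_k m k.
have mM k : (m k <= M)%N by exact: leq_bigmax.
pose b (x : T) : {ffun K -> bool} := [ffun k => `[< B k x >]].
have bM x y : lab M x = lab M y -> b x = b y.
  move=> xy; apply/ffunP => k; rewrite !ffunE.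
  have mxy := labS _ _ _ _ (mM k) xy.
  by apply: asbool_equiv_eq; split; apply: mB.
pose h' a := if pselect (exists x, lab M x = a) is left w then h (b (projT1 (cid w)))
             else h (b point).
exists M, h'; rewrite (_ : (fun x => _) = [set x | l x != h (b x)])//.
apply/seteqP; split => x /=; rewrite /h'; case: pselect => [w|[]];
  by [case: cid => y /= /bM ->|exists x].
Qed.

Lemma card_progressions (L : nat -> nat) j : (0 < j)%N ->
  #|` progressions L j|%fset = L j.
Proof.
move=> j0; rewrite /progressions card_in_imfset/=.
  by rewrite undup_id ?iota_uniq// size_iota.
move=> k k' _ _ /eqP; rewrite eqz_nat eqn_pmul2r// => /eqP//.
Qed.

(** With [r = s ^+ 2] and [s <= 1] the bound is at most [s * (1 + c)]. *)
Lemma fano_small (K : finType) (e : R) : 0 < e ->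
  exists2 r, 0 < r & fano_bound K r <= e.
Proof.
move=> e0; set c : R := 2 * (#|K| ^ 2)%:R; have c0 : 0 <= c by rewrite mulr_ge0.
have c1 : 0 < 1 + c by rewrite ltr_pwDl.
set s := Num.min 1 (e / (1 + c)).
have s0 : 0 < s by rewrite lt_min ltr01 divr_gt0.
have s1 : s <= 1 by rewrite ge_min lexx.
have se : s * (1 + c) <= e by rewrite -ler_pdivlMr// ge_min lexx orbT.
exists (s ^+ 2); first by rewrite exprn_gt0.
rewrite /fano_bound sqrtr_sqr gtr0_norm// -/c.
by apply: le_trans se; rewrite mulrDr mulr1 [s * c]mulrC lerD2r expr2 ler_piMr// ltW.
Qed.

Lemma P_entropy_at_label (P : {fset int}) (K : finType) (l : T -> K) :
  P_entropy_at S P (fun i => l @^-1` [set i]) =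
  label_entropy mu (join_label S P l) / (#|` P|)%:R.
Proof. by rewrite /P_entropy_at entropy_join_images. Qed.

Lemma P_entropy_at_ge0 (P : {fset int}) (K : finType) (l : T -> K) :
  finite_label l -> 0 <= P_entropy_at S P (fun i => l @^-1` [set i]).
Proof.
move=> ml; rewrite P_entropy_at_label divr_ge0// label_entropy_ge0//.
exact: finite_label_join.
Qed.

Lemma zero_entropy_progressions : exists L : nat -> nat,
  [/\ forall j, (0 < j)%N -> (0 < L j)%N, forall j, (j <= L j)%N &
      P_entropy (progressions L) S = 0%E].
Proof.
have [lab [mlab labS labA]] := standard_label_approx.
pose xi j := enum_rank \o lab j.
have mxi j : finite_label (xi j) by exact: finite_label_comp.
have /choice[L LP] j : exists L, (j <= L)%N /\ ((0 < j)%N -> (0 < L)%N /\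
    label_entropy mu (join_label S [fset (k * j)%N%:Z | k in iota 1 L]%fset (xi j))
      <= L%:R * j.+1%:R^-1).
  have [->|j0] := eqVneq j 0%N; first by exists 0%N; split.
  have [||L [jL L0 LH]] := @zero_entropy_progression _ _ j j j.+1%:R^-1 (mxi j).
  - by rewrite lt0n.
  - by rewrite invr_gt0 ltr0n.
  - by exists L; split.
have L0 j : (0 < j)%N -> (0 < L j)%N by case: (LP j) => _ /[apply] -[].
exists L; split => //; first by move=> j; case: (LP j).
apply/eqP; rewrite eq_le; apply/andP; split; last first.
  (* The supremum is at least the value at the one-cell partition, which is nonnegative. *)
  apply: (@le_trans _ _ (P_entropy_partition (progressions L) S
      (fun i => (fun=> ord0 : 'I_1) @^-1` [set i]))).
    apply: limn_esup_ge; apply: nearW => j; rewrite lee_fin P_entropy_at_ge0//.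
    by move=> k; rewrite preimage_cst; case: ifP.
  apply: ereal_sup_ubound; do 2 eexists; split; last reflexivity.
  apply: label_partition => k.
  by rewrite preimage_cst; case: ifP.
apply: ge_ereal_sup => _ [n [eta [/partition_labelP[l ml ->] ->]]].
apply/lee_addgt0Pr => e e0; rewrite add0e.
have e20 : 0 < e / 2 by rewrite divr_gt0.
have [r r0 re] := @fano_small 'I_n _ e20.
(* The approximation is fixed before [j], at a cost of [e / 2]. From [j = m] on, [lab j] refines
   [lab m], so the entropy of [h \o lab m] is bounded by the one that [L j] was chosen to
   control. *)
have [m [h lh]] := labA _ _ _ ml r0.
apply: limn_esup_le; near=> j; rewrite lee_fin P_entropy_at_label.
have j0 : (0 < j)%N by near: j; exists 1%N.
have mj : (m <= j)%N by near: j; exists m.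
have je : j.+1%:R^-1 <= e / 2.
  rewrite -[leRHS]invrK lef_pV2 ?posrE ?invr_gt0 ?ltr0n//.
  have : (Num.truncn (e / 2)^-1 <= j)%N by near: j; exists (Num.truncn (e / 2)^-1).
  move=> tj; apply: le_trans (ltW (truncnS_gt _)) _.
  by rewrite ler_nat ltnS.
have cE := card_progressions L j0.
rewrite cE ler_pdivrMr ?ltr0n ?L0//.
have mh : finite_label (h \o lab m) by exact: finite_label_comp.
apply: le_trans (@join_label_close _ _ _ mu S (progressions L j) _ _ _ _ ml mh lh) _.
rewrite cE [e]splitr mulrDl lerD//; last by rewrite mulrC ler_wpM2r.
have [_ /(_ j0)[_ LH]] := LP j; apply: le_trans (le_trans LH _).
  apply: label_entropy_factor; first exact: finite_label_join.
  move=> x y /ffunP xy; apply/ffunP => p; have := xy p.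
  by rewrite !ffunE /= => /enum_rank_inj /(labS _ _ _ _ mj) ->.
by rewrite mulrC ler_wpM2r.
Unshelve. all: by end_near. Qed.

End zero_entropy.

(** * Markov operators and conditionally independent couplings *)


Section bounded_functions.
Variables (R : realType) (d : measure_display) (T : measurableType d).
Variable mu : probability T R.
Implicit Types f g : T -> R.

(** A class stable under the operations used below and contained in every Lebesgue space of a
    probability measure, so that integrability is automatic. *)
Definition bounded_measurable f :=
  measurable_fun setT f /\ exists M, forall x, `|f x| <= M.

Lemma bounded_measurable_integrable f :
  bounded_measurable f -> mu.-integrable setT (EFin \o f).
Proof.
move=> [mf [M fM]]; apply: measurable_bounded_integrable => //.
  exact: le_lt_trans (probability_le1 mu measurableT) (ltry 1).
exists M; split => [|N MN x _]; first exact: num_real.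
  by rewrite /= (le_trans (fM x))// ltW.
Qed.

Lemma bounded_measurable_cst (c : R) : bounded_measurable (fun=> c).
Proof. by split; [exact: measurable_cst|exists `|c|]. Qed.

Lemma bounded_measurableD f g : bounded_measurable f -> bounded_measurable g ->
  bounded_measurable (fun x => f x + g x).
Proof.
move=> [mf [M fM]] [mg [N gN]]; split; first exact: measurable_funD.
by exists (M + N) => x; rewrite (le_trans (ler_normD _ _))// lerD.
Qed.

Lemma bounded_measurableM f g : bounded_measurable f -> bounded_measurable g ->
  bounded_measurable (fun x => f x * g x).
Proof.
move=> [mf [M fM]] [mg [N gN]]; split; first exact: measurable_funM.
by exists (M * N) => x; rewrite normrM ler_pM.
Qed.

Lemma bounded_measurable_sum (I : Type) (s : seq I) (P : pred I) (f : I -> T -> R) :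
  (forall i, bounded_measurable (f i)) ->
  bounded_measurable (fun x => \sum_(i <- s | P i) f i x).
Proof.
move=> bf; elim: s => [|i s IH].
  by under eq_fun do rewrite big_nil; exact: bounded_measurable_cst.
under eq_fun do rewrite big_cons; case: (P i) => //.
exact: bounded_measurableD.
Qed.

Lemma bounded_measurable_prod (I : Type) (s : seq I) (P : pred I) (f : I -> T -> R) :
  (forall i, bounded_measurable (f i)) ->
  bounded_measurable (fun x => \prod_(i <- s | P i) f i x).
Proof.
move=> bf; elim: s => [|i s IH].
  by under eq_fun do rewrite big_nil; exact: bounded_measurable_cst.
under eq_fun do rewrite big_cons; case: (P i) => //.
exact: bounded_measurableM.
Qed.

Lemma bounded_measurable_bool (P : T -> bool) :
  measurable [set x | P x] -> bounded_measurable (fun x => (P x)%:R).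
Proof.
move=> mP; split; last by exists 1 => x; case: (P x); rewrite ?normr1 ?normr0.
rewrite (_ : (fun x => _) = \1_[set x | P x]).
  exact: measurable_indic.
by apply/funext => x; rewrite indicE; congr ((nat_of_bool _)%:R);
  apply/idP/idP; rewrite in_setE.
Qed.

Lemma bounded_measurable_label (K : finType) (l : T -> K) (F : K -> R) :
  finite_label l -> bounded_measurable (fun x => F (l x)).
Proof.
move=> ml; rewrite (_ : (fun x => _) = fun x => \sum_k F k * (l x == k)%:R).
  apply: bounded_measurable_sum => k; apply: bounded_measurableM.
    exact: bounded_measurable_cst.
  apply: bounded_measurable_bool; rewrite (_ : [set x | _] = l @^-1` [set k]).
    exact: ml.
  by apply/seteqP; split => x /= /eqP.
apply/funext => x; rewrite (bigD1 (l x))//= eqxx mulr1 big1 ?addr0// => k /negbTE.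
by rewrite eq_sym => ->; rewrite mulr0.
Qed.

Lemma bounded_measurable_comp f (h : T -> T) : measurable_fun setT h ->
  bounded_measurable f -> bounded_measurable (f \o h).
Proof.
move=> mh [mf [M fM]]; split; first exact: measurableT_comp.
by exists M => x; exact: fM.
Qed.

Lemma Rintegral_sum (I : Type) (s : seq I) (P : pred I) (f : I -> T -> R) :
  (forall i, bounded_measurable (f i)) ->
  \int[mu]_x (\sum_(i <- s | P i) f i x) =
  \sum_(i <- s | P i) \int[mu]_x f i x.
Proof.
move=> bf; elim: s => [|i s IH].
  under eq_Rintegral do rewrite big_nil; rewrite big_nil Rintegral_cst//.
  by rewrite mul0r.
under eq_Rintegral do rewrite big_cons; rewrite big_cons; case: (P i) => //.
rewrite RintegralD// ?IH//; apply: bounded_measurable_integrable => //.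
exact: bounded_measurable_sum.
Qed.

Lemma Rintegral_bool (P : T -> bool) : measurable [set x | P x] ->
  \int[mu]_x (P x)%:R = fine (mu [set x | P x]).
Proof.
move=> mP; rewrite /Rintegral; congr fine.
rewrite -[X in _ = mu X]setIT -integral_indic//; apply: eq_integral => x _.
by rewrite indicE; congr ((nat_of_bool _)%:R%:E); apply/idP/idP; rewrite in_setE.
Qed.

Lemma Rintegral_cst1 (c : R) : \int[mu]_x c = c.
Proof. by rewrite Rintegral_cst// [X in fine X]probability_setT mulr1. Qed.

(** The function [max f g] dominates [f] everywhere and agrees with [g] almost everywhere. *)
Lemma ae_le_Rintegral f g : bounded_measurable f -> bounded_measurable g ->
  (\forall x \ae mu, f x <= g x) -> \int[mu]_x f x <= \int[mu]_x g x.
Proof.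
move=> bf bg fg; pose h x := Num.max (f x) (g x).
have bh : bounded_measurable h.
  case: bf bg => mf [M fM] [mg [N gN]]; split; first exact: measurable_maxr.
  exists (Num.max M N) => x; rewrite /h le_max.
  by case: (leP (f x) (g x)) => _; rewrite ?fM ?gN ?orbT.
apply: (@le_trans _ _ (\int[mu]_x h x)).
  apply: le_Rintegral => //; [exact: bounded_measurable_integrable..|].
  by move=> x _; rewrite /h le_max lexx.
rewrite le_eqVlt; apply/orP; left; apply/eqP; rewrite /Rintegral; congr fine.
apply: ae_eq_integral => //.
- by apply/measurable_EFinP; case: bh.
- by apply/measurable_EFinP; case: bg.
- by apply: filterS fg => x fg _; rewrite /= /h max_r.
Qed.

Lemma ae_eq_Rintegral f g : measurable_fun setT f -> measurable_fun setT g ->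
  f = g %[ae mu] -> \int[mu]_x f x = \int[mu]_x g x.
Proof.
move=> mf mg fg; rewrite /Rintegral; congr fine; apply: ae_eq_integral => //.
- exact/measurable_EFinP.
- exact/measurable_EFinP.
- by apply: filterS fg => x /[apply] ->.
Qed.

Lemma bounded_Lfun2 f : bounded_measurable f -> f \in Lfun mu 2%:E.
Proof.
move=> [mf [M fM]]; rewrite inE/=; apply/andP; split; rewrite inE//=.
rewrite /finite_norm unlock poweR_lty//.
have [m2 [N2 f2N]] : bounded_measurable (fun x => `|f x| `^ 2).
  split; first by apply: (measurableT_comp (measurable_powR _)) => //; exact: measurableT_comp.
  exists (M `^ 2) => x; rewrite ger0_norm ?powR_ge0//.
  by rewrite ge0_ler_powR// nnegrE// (le_trans _ (fM x)).
apply: integrable_lty => //.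
by apply: (@bounded_measurable_integrable (fun x => `|f x| `^ 2)); split => //; exists N2.
Qed.

Lemma Lfun2_measurable f : f \in Lfun mu 2%:E -> measurable_fun setT f.
Proof. by rewrite inE => /andP[]; rewrite inE. Qed.

Lemma Lfun2_integrable f : f \in Lfun mu 2%:E -> mu.-integrable setT (EFin \o f).
Proof.
move=> f2; apply/Lfun1_integrable; move: f f2.
by apply: Lfun_subset12; rewrite ?fin_num_measure.
Qed.

Lemma ae_preserving (h : T -> T) (P : T -> Prop) : measurable_fun setT h ->
  (forall A, measurable A -> mu (h @^-1` A) = mu A) ->
  (\forall x \ae mu, P x) -> \forall x \ae mu, P (h x).
Proof.
move=> mh ph [N [mN N0 PN]]; exists (h @^-1` N); split.
- by rewrite -[X in measurable X]setTI; exact: mh.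
- by rewrite ph.
- by move=> x /= nP; apply: PN.
Qed.

End bounded_functions.

Section chebyshev.
Variables (R : realType) (D : finType) (k : D -> R) (X : D -> R) (N : nat).
Hypotheses (k0 : forall d, 0 <= k d) (k1 : \sum_d k d = 1).
Hypothesis X01 : forall d, 0 <= X d <= 1.
Let q := \sum_d k d * X d.
Let u (b : {ffun 'I_N -> D}) := \prod_i k (b i).

Lemma iid_ge0 b : 0 <= u b. Proof. exact: prodr_ge0. Qed.

Lemma iid_sum1 : \sum_b u b = 1.
Proof.
by rewrite -(bigA_distr_bigA (fun=> k)) big1// => i _.
Qed.

Let Y d := X d - q.

(** The sum over [b] factorizes over the coordinates; for [i != j] the factor at [i] is the mean of
    the centered variable [Y]. *)
Lemma iid_cov i j : \sum_b u b * (Y (b i) * Y (b j)) =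
  if i == j then \sum_d k d * Y d ^+ 2 else 0.
Proof.
have kY : \sum_d k d * Y d = 0.
  rewrite /Y; under eq_bigr do rewrite mulrBr.
  by rewrite sumrB -mulr_suml k1 mul1r subrr.
pose F s d := k d * ((if s == i then Y d else 1) * (if s == j then Y d else 1)).
transitivity (\prod_s \sum_d F s d).
  rewrite bigA_distr_bigA; apply: eq_bigr => b _; rewrite !big_split/=.
  by rewrite -!big_mkcond !big_pred1_eq.
have [ij|ij] := eqVneq i j; first subst j.
  rewrite (bigD1 i)//= [X in _ * X]big1 ?mulr1.
    by apply: eq_bigr => d _; rewrite /F eqxx.
  move=> s /negbTE si; rewrite -[RHS]k1; apply: eq_bigr => d _.
  by rewrite /F si !mulr1.
rewrite (bigD1 i)//= (_ : \sum_d F i d = 0) ?mul0r// -[RHS]kY.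
by apply: eq_bigr => d _; rewrite /F eqxx (negbTE ij) mulr1.
Qed.

(** Centered values lie between -1 and 1, so the variance of the sum is at most [N]; Chebyshev's
    inequality divides it by [(N * r) ^ 2]. *)
Lemma iid_chebyshev (r : R) : 0 < r -> (0 < N)%N ->
  \sum_(b : {ffun 'I_N -> D} | r <= `|(\sum_i X (b i)) / N%:R - q|) u b <= (N%:R * r ^+ 2)^-1.
Proof.
move=> r0 N0; have N0R : 0 < N%:R :> R by rewrite ltr0n.
have q01 : 0 <= q <= 1.
  rewrite /q sumr_ge0/= => [|d _]; last by rewrite mulr_ge0//; case/andP: (X01 d).
  by rewrite -k1; apply: ler_sum => d _; rewrite ler_piMr//; case/andP: (X01 d).
have v1 : \sum_d k d * Y d ^+ 2 <= 1.
  rewrite -k1; apply: ler_sum => d _; rewrite ler_piMr//.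
  by have := X01 d; move: q01; rewrite /Y => /andP[? ?] /andP[? ?]; nra.
have EY : \sum_b u b * (\sum_i Y (b i)) ^+ 2 <= N%:R.
  have -> : \sum_b u b * (\sum_i Y (b i)) ^+ 2 =
      \sum_i \sum_j \sum_b u b * (Y (b i) * Y (b j)).
    under [RHS]eq_bigr do rewrite exchange_big; rewrite exchange_big/=.
    apply: eq_bigr => b _; rewrite expr2 big_distrlr/= mulr_sumr.
    by apply: eq_bigr => i _; rewrite mulr_sumr.
  under eq_bigr do under eq_bigr do rewrite iid_cov.
  apply: (@le_trans _ _ (\sum_(i < N) 1)); last by rewrite sumr_const card_ord.
  apply: ler_sum => i _; rewrite (bigD1 i)//= eqxx [X in _ + X]big1 ?addr0// => j.
  by rewrite eq_sym => /negbTE ->.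
rewrite -[leRHS]mul1r ler_pdivlMr ?mulr_gt0 ?exprn_gt0// -(ler_pM2r N0R) mul1r.
apply: le_trans EY; rewrite !mulr_suml big_mkcond.
apply: ler_sum => b _; case: ifP => [rb|_]; last by rewrite mulr_ge0 ?iid_ge0 ?sqr_ge0.
rewrite -!mulrA ler_wpM2l ?iid_ge0//.
have YE : \sum_i Y (b i) = N%:R * ((\sum_i X (b i)) / N%:R - q).
  rewrite /Y sumrB sumr_const card_ord mulrBr mulrCA divff ?gt_eqF// mulr1.
  by rewrite mulr_natl.
rewrite YE exprMn (_ : _ * (_ * _) = N%:R ^+ 2 * r ^+ 2); last by ring.
rewrite ler_pM2l ?exprn_gt0//.
by rewrite -[leRHS]real_normK ?num_real// lerXn2r ?nnegrE ?normr_ge0// ltW.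
Qed.

End chebyshev.

Section coupling.
Variables (R : realType) (d : measure_display) (Y : measurableType d).
Variable nu : probability Y R.
Variables (A D : finType) (al : Y -> A) (k : D -> Y -> R) (N : nat).
Hypotheses (mal : finite_label al) (mk : forall i, measurable_fun setT (k i)).
Hypotheses (k0 : forall i y, 0 <= k i y) (k1 : forall y, \sum_i k i y = 1).

Let Om : finType := (A * {ffun 'I_N -> D})%type.
Let u (b : {ffun 'I_N -> D}) y := \prod_i k (b i) y.
Let w (z : Om) : R := \int[nu]_y ((al y == z.1)%:R * u z.2 y).

Lemma kernel_le1 i y : k i y <= 1.
Proof. by rewrite -(k1 y) (bigD1 i)//= lerDl sumr_ge0. Qed.

Lemma bounded_measurable_kernel i : bounded_measurable (k i).
Proof. by split => //; exists 1 => y; rewrite ger0_norm ?kernel_le1. Qed.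

Lemma bounded_measurable_label_eq a : bounded_measurable (fun y => (al y == a)%:R : R).
Proof.
apply: bounded_measurable_bool; rewrite (_ : [set x | _] = al @^-1` [set a]).
  exact: mal.
by apply/seteqP; split => x /= /eqP.
Qed.

Let bu b : bounded_measurable (u b).
Proof. by apply: bounded_measurable_prod => i; exact: bounded_measurable_kernel. Qed.

Let bw (z : Om) : bounded_measurable (fun y => (al y == z.1)%:R * u z.2 y).
Proof. by apply: bounded_measurableM => //; exact: bounded_measurable_label_eq. Qed.

Let w0 z : 0 <= w z.
Proof.
apply: Rintegral_ge0 => y _; rewrite mulr_ge0//; exact: (@iid_ge0 R D (k^~ y)).
Qed.

Let sum_w (Q : pred Om) :
  \sum_(z | Q z) w z = \int[nu]_y \sum_(b | Q (al y, b)) u b y.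
Proof.
rewrite /w -(@Rintegral_sum _ _ _ nu Om (index_enum Om) Q
  (fun z y => (al y == z.1)%:R * u z.2 y)) //; apply: eq_Rintegral => y _.
pose F a b : R := if Q (a, b) then (al y == a)%:R * u b y else 0.
transitivity (\sum_(z : Om) F z.1 z.2).
  by rewrite big_mkcond; apply: eq_bigr => -[a b] _.
rewrite -(pair_bigA _ F)/= /F.
rewrite (bigD1 (al y))//= [X in _ + X]big1 ?addr0; last first.
  move=> a /negbTE aly; apply: big1 => b _; rewrite eq_sym aly mul0r.
  by case: ifP.
by rewrite -big_mkcond/=; apply: eq_bigr => b _; rewrite eqxx mul1r.
Qed.

Let w1 : \sum_z w z = 1.
Proof.
rewrite (sum_w predT) -[RHS](Rintegral_cst1 nu); apply: eq_Rintegral => y _.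
exact: (@iid_sum1 R D (k^~ y)).
Qed.

(* [al] and, given [y], [N] independent points with law [k ^~ y] are realized on
   the finite probability space [Om]. *)
Lemma coupling_entropy (T : finType) (f : T -> A -> bool) (e : R)
    (est : T -> {ffun 'I_N -> D} -> bool) :
  (forall t, \int[nu]_y (\sum_(b | f t (al y) != est t b) u b y) <= e) ->
  label_entropy nu (fun y => [ffun t => f t (al y)]) <=
  N%:R * shannon (fun i => \int[nu]_y k i y) + #|T|%:R * fano_bound bool e.
Proof.
move=> fe.
have marg1 : marg w fst = law nu al.
  apply/funext => a; rewrite /marg sum_w /= /law.
  rewrite (_ : _ @^-1` _ = [set y | al y == a]); last first.
    by apply/seteqP; split => x /= /eqP.
  rewrite -Rintegral_bool; last first.
    rewrite (_ : [set x | _] = al @^-1` [set a]); first exact: mal.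
    by apply/seteqP; split => x /= /eqP.
  apply: eq_Rintegral => y _; case: eqP => _; last by rewrite big_pred0.
  exact: (@iid_sum1 R D (k^~ y)).
(* Averaging over [y] gives every copy the same law. Since independence holds only given [y], the
   joint entropy of the copies is controlled below by subadditivity. *)
have marg2 i : marg w (fun z : Om => z.2 i) = (fun s => \int[nu]_y k s y).
  apply/funext => s; rewrite /marg sum_w /=; apply: eq_Rintegral => y _.
  transitivity (\prod_j \sum_t k t y * (if j == i then (t == s)%:R else 1)).
    rewrite bigA_distr_bigA big_mkcond; apply: eq_bigr => b _; rewrite /u big_split/=.
    rewrite -big_mkcond big_pred1_eq; case: eqP => _; first by rewrite mulr1.
    by rewrite mulr0.
  rewrite (bigD1 i)//= [X in _ * X]big1 ?mulr1.
    rewrite eqxx (bigD1 s)//= eqxx mulr1 big1 ?addr0// => t /negbTE ->.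
    by rewrite mulr0.
  move=> j /negbTE ->; rewrite -[RHS](k1 y); apply: eq_bigr => t _.
  by rewrite mulr1.
have -> : label_entropy nu (fun y => [ffun t => f t (al y)]) =
    ent w (fun z : Om => [ffun t => f t z.1]).
  rewrite (label_entropy_comp nu (fun a => [ffun t => f t a]) mal).
  by rewrite -marg1 /ent marg_comp.
have fe' t : \sum_(z : Om | f t z.1 != est t z.2) w z <= e.
  by rewrite (sum_w (fun z => f t z.1 != est t z.2)).
(* The true labels are exchanged for their estimates, at the Fano cost of one error per [t]. *)
apply: le_trans (ent_join_close w0 w1 (f := fun t z => f t z.1)
  (g := fun t z => est t z.2) fe') _.
rewrite lerD2r.
(* All estimates are functions of the [N] copies alone. *)
apply: (@le_trans _ _ (ent w (fun z : Om => [ffun i => z.2 i]))).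
  apply: ent_factor => // z z' /ffunP zz'; apply/ffunP => t; rewrite !ffunE.
  by congr est; apply/ffunP => i; have := zz' i; rewrite !ffunE.
apply: le_trans (ent_join_le w0 w1 (fun i (z : Om) => z.2 i)) _.
under eq_bigr do rewrite /ent marg2.
by rewrite sumr_const card_ord mulr_natl.
Qed.

End coupling.

Section markov_operators.
Variables (R : realType) (d d' : measure_display).
Variables (X : measurableType d) (Y : measurableType d').
Variables (mu : probability X R) (nu : probability Y R).
Variable J : (X -> R) -> (Y -> R).
Hypothesis mJ : markov_operator mu nu J.
Implicit Types f g : X -> R.

Lemma markov_Lfun f : f \in Lfun mu 2%:E -> J f \in Lfun nu 2%:E.
Proof. by case: mJ => -[]; auto. Qed.

Lemma markov_measurable f : f \in Lfun mu 2%:E -> measurable_fun setT (J f).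
Proof. by move=> /markov_Lfun/Lfun2_measurable. Qed.

Lemma markovD f g : f \in Lfun mu 2%:E -> g \in Lfun mu 2%:E ->
  J (fun x => f x + g x) = (fun y => J f y + J g y) %[ae nu].
Proof.
move=> f2 g2; case: mJ => -[_ _ + _] _ _ _ => /(_ 1 _ _ f2 g2).
rewrite (_ : (fun x => 1 * f x + g x) = (fun x => f x + g x)).
  by apply: filterS => y /[apply] ->; rewrite mul1r.
by apply/funext => x; rewrite mul1r.
Qed.

Lemma markov0 : J (fun=> 0) = (fun=> 0) %[ae nu].
Proof.
have c2 : (fun=> 0 : R) \in Lfun mu 2%:E by exact: Lfun_cst.
have := markovD c2 c2; rewrite (_ : (fun x => _) = (fun=> 0)).
  apply: filterS => y /[apply] /eqP.
  by rewrite -subr_eq subrr => /eqP.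
by apply/funext => x; rewrite addr0.
Qed.

Lemma markov_sum (I : Type) (s : seq I) (P : pred I) (f : I -> X -> R) :
  (forall i, bounded_measurable (f i)) ->
  J (fun x => \sum_(i <- s | P i) f i x) =
  (fun y => \sum_(i <- s | P i) J (f i) y) %[ae nu].
Proof.
move=> bf; elim: s => [|i s IH].
  rewrite (_ : (fun x => _) = fun=> 0).
    by apply: filterS markov0 => y /[apply] ->; rewrite big_nil.
  by apply/funext => x; rewrite big_nil.
rewrite (_ : (fun x => _) = fun x =>
    (if P i then f i x else 0) + \sum_(i <- s | P i) f i x); last first.
  by apply/funext => x; rewrite big_cons; case: ifP; rewrite ?add0r.
case Pi : (P i); last first.
  under [X in J X]eq_fun do rewrite add0r.
  by apply: filterS IH => y /[apply] ->; rewrite big_cons Pi.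
have bs := bounded_measurable_sum s P bf.
apply: filterS2 (markovD (bounded_Lfun2 mu (bf i)) (bounded_Lfun2 mu bs)) IH.
by move=> y h1 h2 hI; rewrite h1// h2// big_cons Pi.
Qed.

(** Pairing with the constant 1 moves [J] to the adjoint, which fixes constants. *)
Lemma markov_Rintegral f : f \in Lfun mu 2%:E ->
  \int[nu]_y J f y = \int[mu]_x f x.
Proof.
move=> f2; case: mJ => _ _ _ [J' [[L1 _ _ _] adj J'1]].
have one2 : cst 1 \in Lfun nu 2%:E by exact: Lfun_cst.
have := adj _ _ f2 one2; under eq_Rintegral do rewrite mulr1.
move=> ->; apply: ae_eq_Rintegral.
- by apply: measurable_funM; apply: (@Lfun2_measurable _ _ _ mu) => //; exact: L1.
- exact: (@Lfun2_measurable _ _ _ mu).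
- by apply: filterS J'1 => x /[apply] ->; rewrite mulr1.
Qed.

(* A version of the images of the cells of a partition which is a stochastic
   kernel everywhere, not just almost everywhere. *)
Lemma markov_kernel (K : finType) (l : X -> K) : finite_label l ->
  exists k : K -> Y -> R,
    [/\ forall i, measurable_fun setT (k i), forall i y, 0 <= k i y,
        forall y, \sum_i k i y = 1 &
        forall i, k i = J (fun x => (l x == i)%:R) %[ae nu]].
Proof.
move=> ml; pose c i : X -> R := fun x => (l x == i)%:R.
have bc i : bounded_measurable (c i).
  exact: (bounded_measurable_label (fun j => (j == i)%:R) ml).
have mJc i : measurable_fun setT (J (c i)).
  by apply: markov_measurable; exact: bounded_Lfun2.
(* The set of points where the images already form a probability vector; it has full measure because
   [J] is positive and fixes 1. *)
pose E := [set y | (forall i, 0 <= J (c i) y) /\ \sum_i J (c i) y = 1].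
have mE : measurable E.
  rewrite (_ : E = (\bigcap_(i in [set: K]) (J (c i) @^-1` `[0, +oo[%classic)) `&`
      ((fun y => \sum_i J (c i) y) @^-1` [set 1])).
    apply: measurableI.
      apply: fin_bigcap_measurable => // i _; rewrite -[X in measurable X]setTI.
      by apply: mJc => //; exact: measurable_itv.
    rewrite -[X in measurable X]setTI; apply: measurable_sum => //.
  apply/seteqP; split => y /=.
    by move=> [J0 J1]; split => // i _ /=; rewrite in_itv/= andbT.
  by move=> [J0 J1]; split => // i; have := J0 i I; rewrite /= in_itv/= andbT.
have aeE : \forall y \ae nu, E y.
  have J0 : \forall y \ae nu, forall i, 0 <= J (c i) y.
    apply: filter_forall => i; case: mJ => _ + _ _; apply.
      exact: bounded_Lfun2.
    by apply: aeW => x; rewrite /c ler0n.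
  have := markov_sum (index_enum K) xpredT bc.
  rewrite (_ : (fun x => \sum_i c i x) = cst 1); last first.
    apply/funext => x; rewrite (bigD1 (l x))//= /c eqxx big1 ?addr0// => i /negbTE.
    by rewrite eq_sym => ->.
  case: mJ => _ _ J1 _; move: J0 J1; apply: filterS3 => y J0 J1 J2.
  by split => //; rewrite -J2// J1.
(* Off [E] the kernel is set to the Dirac mass at the label of [point], an arbitrary probability
   vector. *)
pose k i y : R := \1_E y * J (c i) y + (1 - \1_E y) * (l point == i)%:R.
have kE i y : E y -> k i y = J (c i) y.
  by move=> Ey; rewrite /k indicE mem_set// mul1r subrr mul0r addr0.
have knE i y : ~ E y -> k i y = (l point == i)%:R.
  by move=> nE; rewrite /k indicE memNset// mul0r subr0 mul1r add0r.
exists k; split.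
- move=> i; apply: measurable_funD; apply: measurable_funM => //.
  by apply: measurable_funB => //.
- move=> i y; have [Ey|nE] := pselect (E y); last by rewrite knE.
  by rewrite kE//; case: Ey.
- move=> y; have [Ey|nE] := pselect (E y).
    by under eq_bigr do rewrite kE//; case: Ey.
  under eq_bigr do rewrite knE//.
  by rewrite (bigD1 (l point))//= eqxx big1 ?addr0// => i /negbTE;
    rewrite eq_sym => ->.
- by move=> i; apply: filterS aeE => y Ey _; rewrite kE.
Qed.

Variables (S : automorphism mu) (G : automorphism nu).
Hypothesis JSG : forall f, f \in Lfun mu 2%:E -> J (f \o S) = J f \o G %[ae nu].

(** Negative powers come from the hypothesis applied to [f \o aut_inv S] and composed with the
    inverse of [G]; almost sure identities survive composition with measure-preserving maps. *)
Lemma markov_intertwine_pow (p : int) f : bounded_measurable f ->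
  J (f \o aut_pow S p) = J f \o aut_pow G p %[ae nu].
Proof.
have step g : bounded_measurable g -> J (g \o aut_inv S) = J g \o aut_inv G %[ae nu].
  move=> bg; have bg' : bounded_measurable (g \o aut_inv S).
    by apply: bounded_measurable_comp => //; exact: aut_inv_measurable.
  have := JSG (bounded_Lfun2 mu bg').
  move=> /(ae_preserving (aut_inv_measurable G) (aut_inv_preserving G)).
  apply: filterS => y /(_ I) /=; rewrite aut_invK => <- _; congr J.
  by apply/funext => x /=; rewrite aut_funK.
move=> bf; elim/int_rect: p f bf => [|n IH|n IH] f bf.
- exact: aeW.
- have bf' : bounded_measurable (f \o S).
    by apply: bounded_measurable_comp => //; exact: aut_measurable.
  have := ae_preserving (aut_pow_measurable G n) (aut_pow_preserving G n)
    (JSG (bounded_Lfun2 mu bf)).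
  apply: filterS2 (IH _ bf') => y h1 h2 _; have := h2 I; rewrite /= => <-.
  exact: h1.
- have bf' : bounded_measurable (f \o aut_inv S).
    by apply: bounded_measurable_comp => //; exact: aut_inv_measurable.
  have := ae_preserving (aut_pow_measurable G (- n%:Z))
    (aut_pow_preserving G (- n%:Z)) (step _ bf).
  apply: filterS2 (IH _ bf') => y h1 h2 _.
  have e (d0 : measure_display) (Z : measurableType d0) (rho : probability Z R)
      (V : automorphism rho) z :
      aut_pow V (- n.+1%:Z) z = aut_inv V (aut_pow V (- n%:Z) z).
    by rewrite intS opprD addrC aut_powB1.
  have -> : (J f \o aut_pow G (- n.+1%:Z)) y = (J f \o aut_inv G) (aut_pow G (- n%:Z) y).
    by rewrite /comp e.
  rewrite -h2//; have := h1 I; rewrite [in X in _ = X -> _]/comp => <-.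
  by congr (J _ y); apply/funext => x; rewrite /comp e.
Qed.

End markov_operators.

(** * Disjointness *)


Section integral_constants.
Variables (R : realType) (d : measure_display) (T : measurableType d).
Variable mu : probability T R.

Lemma ae_eq_cst_integral (h : T -> R) (c : R) : mu.-integrable setT (EFin \o h) ->
  (forall E, measurable E ->
    \int[mu]_x (h x * (`[< E x >])%:R) = c * fine (mu E)) ->
  h = cst c %[ae mu].
Proof.
move=> ih hE.
suff : ae_eq mu setT (EFin \o h) (cst c%:E).
  by apply: filterS => x /[apply] /= -[].
apply: integral_ae_eq => // E _ mE.
have hEi : mu.-integrable E (EFin \o h) by exact: integrableS ih.
rewrite integral_cst//= -[LHS]fineK; last exact: integrable_fin_num.
rewrite -[X in _ = (_ * X)%E]fineK ?fin_num_measure// -EFinM -hE//; congr EFin.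
rewrite -/(Rintegral mu E h) Rintegral_mkcond; apply: eq_Rintegral => x _.
rewrite patchE; case: asboolP => Ex; first by rewrite mem_set// mulr1.
by rewrite memNset// mulr0.
Qed.

Lemma ae_eq0_integral (h : T -> R) : mu.-integrable setT (EFin \o h) ->
  (\forall x \ae mu, 0 <= h x) -> \int[mu]_x h x = 0 ->
  \forall x \ae mu, h x = 0.
Proof.
move=> ih h0 ih0; have mh : measurable_fun setT (EFin \o h) by case/integrableP: ih.
suff : ae_eq mu setT (EFin \o h) (cst 0%E).
  by apply: filterS => x /(_ I) /= -[].
apply/(ae_eq_integral_abs mu measurableT mh).
transitivity (\int[mu]_x (h x)%:E)%E; last first.
  by rewrite -[LHS]fineK -/(Rintegral mu setT h) ?ih0//; exact: integrable_fin_num.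
apply: ae_eq_integral => //; first exact: measurableT_comp.
by apply: filterS h0 => x h0 _; rewrite /= ger0_norm.
Qed.

(** The bands around [c] decrease to the level set, so continuity from above applies. *)
Lemma level_set_small (g : T -> R) (c : R) : measurable_fun setT g ->
  mu [set x | g x = c] = 0%E -> forall e : R, 0 < e ->
  exists2 r, 0 < r & fine (mu [set x | `|g x - c| < r]) <= e.
Proof.
move=> mg gc e e0; pose F n := [set x | `|g x - c| < n.+1%:R^-1].
have mF n : measurable (F n).
  rewrite (_ : F n = (fun x => `|g x - c|) @^-1` `]-oo, n.+1%:R^-1[%classic).
    rewrite -[X in measurable X]setTI; apply: measurableT_comp => //.
    by apply: measurable_funB.
  by apply/seteqP; split => x /=; rewrite in_itv.
have FE : \bigcap_n F n = [set x | g x = c].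
  apply/seteqP; split => [x Fx|x gxc n _]; last first.
    by have {}gxc : g x = c := gxc; rewrite /F/= gxc subrr normr0.
  apply/eqP; rewrite -subr_eq0 -normr_le0 leNgt; apply/negP => gx0.
  have [n] := ltr_add_invr gx0; rewrite add0r => ngx.
  by have := Fx n I; rewrite /F/= ltNge ltW.
have : mu \o F @ \oo --> mu (\bigcap_n F n).
  apply: nonincreasing_cvg_mu => //.
  - by rewrite ltey_eq fin_num_measure.
  - by rewrite FE -FE; exact: bigcapT_measurable.
  - move=> m n mn; apply/subsetPset => x; rewrite /F/= => /lt_le_trans; apply.
    by rewrite lef_pV2 ?posrE ?ltr0n// ler_nat ltnS.
rewrite FE gc => /fine_cvgP[_ /cvgrPdist_le /(_ _ e0)[N _ /(_ _ (leqnn N))]] /=.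
rewrite sub0r normrN ger0_norm ?fine_ge0// => FN.
by exists N.+1%:R^-1; rewrite ?invr_gt0 ?ltr0n.
Qed.

(** The law of [g] has countably many atoms, whereas an interval of positive length is
    uncountable. *)
Lemma nonatom_between (g : T -> R) (a b : R) : measurable_fun setT g -> a < b ->
  exists c, [/\ a < c, c < b & mu [set x | g x = c] = 0%E].
Proof.
move=> mg ab; pose X : {RV mu >-> R} := mfun_Sub (mem_set mg).
apply: contrapT => /forallNP nc.
have cI : countable `]a, b[%classic.
  apply: sub_countable (pmf_gt0_countable X); apply: subset_card_le => c.
  rewrite /= in_itv/= => /andP[ac cb]; rewrite lt_neqAle pmf_ge0 andbT eq_sym.
  apply/negP => /eqP pc; apply: (nc c); split => //.
  rewrite -[LHS]fineK; last first.
    apply: fin_num_measure; rewrite -[X in measurable X]setTI.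
    exact: (mg measurableT _ (measurable_set1 c)).
  by congr EFin.
have := countable_lebesgue_measure0 cI.
rewrite lebesgue_measure_itv/= lte_fin ab => /eqP.
by rewrite -EFinD eqe subr_eq0 gt_eqF.
Qed.

Lemma label_entropy_bool_gt0 (l : T -> bool) : finite_label l ->
  0 < law mu l true -> 0 < law mu l false -> 0 < label_entropy mu l.
Proof.
move=> ml lt lf; have := sum_law mu ml; rewrite big_bool /= => l1.
have h p q : 0 < p -> 0 < q -> p + q = 1 :> R -> p * ln p < 0.
  by move=> p0 q0 pq; rewrite pmulr_rlt0// ln_lt0// p0/= -pq ltrDl.
rewrite /label_entropy /shannon big_bool/= oppr_gt0 -[ltRHS]addr0 ltrD//.
  exact: h l1.
by apply: (h _ (law mu l true)) => //; rewrite addrC.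
Qed.

End integral_constants.

Section disjointness.
Variables (R : realType) (d d' : measure_display).
Variables (X : measurableType d) (Y : measurableType d').
Variables (mu : probability X R) (nu : probability Y R).
Variables (S : automorphism mu) (G : automorphism nu).
Variable J : (X -> R) -> (Y -> R).
Hypothesis mJ : markov_operator mu nu J.
Hypothesis JSG : forall f, f \in Lfun mu 2%:E -> J (f \o S) = J f \o G %[ae nu].

Section indicator.
Variables (l : X -> bool).
Hypothesis ml : finite_label l.
Let g := J (fun x => (l x)%:R).

Let bl : bounded_measurable (fun x => (l x)%:R : R).
Proof. exact: (bounded_measurable_label (fun b : bool => b%:R) ml). Qed.

Let mg : measurable_fun setT g.
Proof. by apply: (markov_measurable mJ); exact: bounded_Lfun2. Qed.

Lemma finite_label_superlevel c : finite_label (fun y => c < g y).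
Proof.
rewrite (_ : (fun y => c < g y) = fun y => `[< (g @^-1` `]c, +oo[%classic) y >]).
  apply: finite_label_bool; rewrite -[X in measurable X]setTI.
  by apply: mg => //; exact: measurable_itv.
by apply/funext => y; apply/idP/asboolP; rewrite /= in_itv/= andbT.
Qed.

Let mband c r : measurable [set y | `|g y - c| < r].
Proof.
rewrite (_ : [set y | _] = (fun x => `|g x - c|) @^-1` `]-oo, r[%classic).
  rewrite -[X in measurable X]setTI; apply: measurableT_comp => //.
  by apply: measurable_funB.
by apply/seteqP; split => x /=; rewrite in_itv.
Qed.

(* By the law of large numbers, the superlevel sets of [g] are determined up to
   small error by independent copies of [l], conditionally on [y]. *)
Lemma superlevel_entropy (P : {fset int}) (N : nat) (c r : R) :
  (0 < N)%N -> 0 < r ->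
  label_entropy nu (join_label G P (fun y => c < g y)) <=
  N%:R * label_entropy mu (join_label S P l) +
  (#|` P|)%:R *
    fano_bound bool ((N%:R * r ^+ 2)^-1 + fine (nu [set y | `|g y - c| < r])).
Proof.
move=> N0 r0; set eta := fun y => c < g y.
have meta : finite_label eta by exact: finite_label_superlevel.
have mSl := finite_label_join S (P := P) ml; have mGe := finite_label_join G (P := P) meta.
have [k [mk k0 k1 kJ]] := markov_kernel mJ mSl.
(* The decision rule: compare with [c] the frequency, among the [N] copies, of names whose
   coordinate [t] is [true]. *)
pose est (t : P) (b : {ffun 'I_N -> {ffun P -> bool}}) : bool :=
  c < (\sum_i ((b i t)%:R : R)) / N%:R.
have := @coupling_entropy _ _ _ nu _ _ _ k N mGe mk k0 k1 P
  (fun t (a : {ffun P -> bool}) => a t)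
  ((N%:R * r ^+ 2)^-1 + fine (nu [set y | `|g y - c| < r])) est.
rewrite (_ : (fun y => _) = join_label G P eta); last first.
  by apply/funext => y; apply/ffunP => t; rewrite ffunE.
rewrite (_ : shannon _ = label_entropy mu (join_label S P l)); last first.
  congr shannon; apply/funext => s.
  rewrite (@ae_eq_Rintegral _ _ _ nu _ (J (fun x => (join_label S P l x == s)%:R))) //.
  - have b : bounded_measurable (fun x => (join_label S P l x == s)%:R : R).
      exact: (bounded_measurable_label (fun j => (j == s)%:R) mSl).
    rewrite (markov_Rintegral mJ) ?bounded_Lfun2// Rintegral_bool.
      by congr (fine (mu _)); apply/seteqP; split => x /= /eqP.
    rewrite (_ : [set x | _] = join_label S P l @^-1` [set s]); first exact: mSl.
    by apply/seteqP; split => x /= /eqP.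
  - apply: (markov_measurable mJ); apply: bounded_Lfun2.
    exact: (bounded_measurable_label (fun j => (j == s)%:R) mSl).
rewrite -cardfE; apply => t.
(* The conditional probability that coordinate [t] is [true] is the image under [J] of a translate
   of the indicator, hence a translate of [g] by intertwining. *)
have qE : (fun y => \sum_s k s y * (s t)%:R) =
    g \o aut_pow G (- val t) %[ae nu].
  have bs (s : {ffun P -> bool}) :
      bounded_measurable (fun x => (join_label S P l x == s)%:R : R).
    exact: (bounded_measurable_label (fun j => (j == s)%:R) mSl).
  have kJ' : \forall y \ae nu, forall s, k s y = J (fun x => (join_label S P l x == s)%:R) y.
    by apply: filter_forall => s; apply: filterS (kJ s) => y; exact.
  have := markov_intertwine_pow JSG (- val t) bl.
  have := markov_sum mJ (index_enum _) (fun s : {ffun P -> bool} => s t) bs.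
  rewrite (_ : (fun x => \sum_(s | _) _) = (fun x => (l x)%:R) \o aut_pow S (- val t)).
    move: kJ'; apply: filterS3 => y h1 h2 h3 hI.
    rewrite -h3// h2// [RHS]big_mkcond; apply: eq_bigr => s _; rewrite h1.
    by case: (s t); rewrite ?mulr1 ?mulr0.
  apply/funext => x; rewrite /= [LHS]big_mkcond (bigD1 (join_label S P l x))//= eqxx.
  rewrite big1 ?addr0; first by rewrite ffunE; case: (l _).
  by move=> s /negbTE; rewrite eq_sym => ->; case: ifP.
have mGt : measurable_fun setT (aut_pow G (- val t)) by exact: aut_pow_measurable.
(* Bound for the conditional error: Chebyshev's estimate away from the band around [c], and the
   trivial bound 1 inside it. By invariance its integral does not depend on [t]. *)
pose F y : R := (N%:R * r ^+ 2)^-1 + (`|g (aut_pow G (- val t) y) - c| < r)%R%:R.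
apply: (@le_trans _ R (\int[nu]_y F y)).
  have bbad : bounded_measurable (fun y =>
     \sum_(b | join_label G P eta y t != est t b) \prod_i k (b i) y).
    have -> : (fun y => \sum_(b | join_label G P eta y t != est t b) \prod_i k (b i) y) =
        fun y => \sum_(b : {ffun 'I_N -> {ffun P -> bool}})
          (join_label G P eta y t != est t b)%:R * \prod_i k (b i) y.
      apply/funext => y; rewrite big_mkcond; apply: eq_bigr => b _.
      by case: ifP; rewrite ?mul1r ?mul0r.
    apply: bounded_measurable_sum => b; apply: bounded_measurableM.
      exact: (bounded_measurable_label (fun a : {ffun P -> bool} => (a t != est t b)%:R) mGe).
    by apply: bounded_measurable_prod => i; exact: bounded_measurable_kernel.
  apply: ae_le_Rintegral => //.
    apply: bounded_measurableD; first exact: bounded_measurable_cst.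
    apply: bounded_measurable_bool.
    rewrite (_ : [set x | _] = aut_pow G (- val t) @^-1` [set y | `|g y - c| < r])//.
    by rewrite -[X in measurable X]setTI; apply: mGt.
  apply: filterS qE => y /(_ I) qE; rewrite /F.
  have u0 (b : {ffun 'I_N -> {ffun P -> bool}}) : 0 <= \prod_i k (b i) y.
    exact: (@iid_ge0 R _ (k^~ y)).
  have [gr|gr] := ltP `|g (aut_pow G (- val t) y) - c| r.
    apply: (@le_trans _ _ 1); last by rewrite lerDr invr_ge0 mulr_ge0// sqr_ge0.
    rewrite -[leRHS](@iid_sum1 R _ (k^~ y) N (k1 y)) big_mkcond; apply: ler_sum => b _.
    by case: ifP.
  rewrite addr0.
  have X01 (s : {ffun P -> bool}) : 0 <= ((s t)%:R : R) <= 1.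
    by case: (s t); rewrite ?lexx ?ler01.
  (* A wrong decision puts the frequency and its mean on opposite sides of [c]; as the mean is at
     distance at least [r] from [c], the deviation is at least [r]. *)
  apply: le_trans (iid_chebyshev (k0^~ y) (k1 y) X01 r0 N0).
  rewrite big_mkcond [leRHS]big_mkcond; apply: ler_sum => b _.
  case: ifP => [bad|_]; last by case: ifP.
  rewrite ifT// qE; move: bad gr; rewrite ffunE /est /eta /=.
  set q := g _; set v := _ / _.
  have [cq|qc] := ltP c q; have [cv|vc] := ltP c v => //= _.
    rewrite ger0_norm; last by lra.
    by move=> ?; rewrite ler0_norm; lra.
  rewrite ler0_norm; last by lra.
  by move=> ?; rewrite ger0_norm; lra.
have mb : measurable [set y | `|g (aut_pow G (- val t) y) - c| < r].
  rewrite (_ : [set x | _] = aut_pow G (- val t) @^-1` [set y | `|g y - c| < r])//.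
  by rewrite -[X in measurable X]setTI; apply: mGt.
rewrite RintegralD//; first last.
- by apply: bounded_measurable_integrable; exact: bounded_measurable_bool.
- by apply: bounded_measurable_integrable; exact: bounded_measurable_cst.
rewrite Rintegral_cst1 Rintegral_bool// lerD2l.
rewrite (_ : [set x | _] = aut_pow G (- val t) @^-1` [set y | `|g y - c| < r])//.
by rewrite aut_pow_preserving.
Qed.

Variable P : nat -> {fset int}.
Hypothesis P0 : \forall j \near \oo, (0 < #|` P j|%fset)%N.
Hypothesis S0 : P_entropy P S = 0%E.
Hypothesis cpe : completely_positive_P_entropy P G.

Lemma markov_trivial_indicator :
  g = cst (fine (mu (l @^-1` [set true]))) %[ae nu].
Proof.
set m := fine _.
have ig : nu.-integrable setT (EFin \o g).
  by apply: Lfun2_integrable; apply: (markov_Lfun mJ); exact: bounded_Lfun2.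
have Ig : \int[nu]_y g y = m.
  rewrite (markov_Rintegral mJ) ?bounded_Lfun2// Rintegral_bool//; last exact: (ml true).
have icst : nu.-integrable setT (EFin \o (fun=> m)).
  by apply: bounded_measurable_integrable; exact: bounded_measurable_cst.
have mlt : measurable [set y | g y < m].
  rewrite (_ : [set y | _] = g @^-1` `]-oo, m[%classic).
    by rewrite -[X in measurable X]setTI; apply: mg => //; exact: measurable_itv.
  by apply/seteqP; split => x /=; rewrite in_itv.
have mgt c : measurable [set y | c < g y].
  exact: (finite_label_superlevel c true).
(* A function lying almost surely on one side of its mean [m] equals it. In the remaining case [g]
   has mass on both sides of [m]. *)
have [lt0|/eqP lt0] := eqVneq (nu [set y | g y < m]) 0%E.
  have h0 : \forall y \ae nu, 0 <= g y - m.
    exists [set y | g y < m]; split => // y /= /negP.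
    by rewrite subr_ge0 -ltNge.
  have := @ae_eq0_integral _ _ _ nu (fun y => g y - m) (integrableB measurableT ig icst) h0.
  rewrite RintegralB// Ig Rintegral_cst1 subrr => /(_ erefl).
  by apply: filterS => y /eqP; rewrite subr_eq0 => /eqP.
have [gt0|/eqP gt0] := eqVneq (nu [set y | m < g y]) 0%E.
  have h0 : \forall y \ae nu, 0 <= m - g y.
    exists [set y | m < g y]; split => // y /= /negP.
    by rewrite subr_ge0 -ltNge.
  have := @ae_eq0_integral _ _ _ nu (fun y => m - g y) (integrableB measurableT icst ig) h0.
  rewrite RintegralB// Ig Rintegral_cst1 subrr => /(_ erefl).
  by apply: filterS => y /eqP; rewrite subr_eq0 => /eqP.
exfalso.
(* The level has to lie above the mean, be exceeded with positive probability and carry no atom; the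
   margin [n.+1%:R^-1] leaves an interval in which to choose it. *)
have [n gtn] : exists n, nu [set y | m + n.+1%:R^-1 < g y] <> 0%E.
  apply: contrapT => /forallNP nn; apply: gt0.
  have : nu.-negligible (\bigcup_n [set y | m + n.+1%:R^-1 < g y]).
    apply: negligible_bigcup => n; apply/negligibleP => //.
    exact: contrapT (nn n).
  rewrite (_ : \bigcup_n _ = [set y | m < g y]).
    by move=> /negligibleP; apply.
  apply/seteqP; split => y /=.
    by move=> [n _] /=; apply: lt_trans; rewrite ltrDl invr_gt0 ltr0n.
  by move=> /ltr_add_invr[n]; exists n.
have [c [mc cn gc]] : exists c, [/\ m < c, c < m + n.+1%:R^-1 &
    nu [set y | g y = c] = 0%E].
  by apply: nonatom_between => //; rewrite ltrDl invr_gt0 ltr0n.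
set eta := fun y => c < g y.
have meta : finite_label eta by exact: finite_label_superlevel.
have pos (A B : set Y) : measurable A -> measurable B -> A `<=` B ->
    nu A <> 0%E -> 0 < fine (nu B).
  move=> mA mB AB A0; apply: lt_le_trans (fine_probability_le nu mA mB AB).
  by rewrite fine_gt0// lt0e measure_ge0 andbT ltey_eq fin_num_measure// andbT; exact/eqP.
have eta_gt0 : 0 < label_entropy nu eta.
  apply: label_entropy_bool_gt0 => //.
    apply: (pos _ _ (mgt (m + n.+1%:R^-1)) (meta true)) => //.
    by move=> y /=; apply: lt_trans.
  apply: (pos _ _ mlt (meta false)) => //.
  move=> y /= gm; apply/negbTE; rewrite -leNgt; apply: ltW; exact: lt_trans mc.
(* Entropy and complete positivity are stated for partitions indexed by ordinals, so boolean labels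
   are recoded in ['I_2]. *)
pose b2 (b : bool) : 'I_2 := if b then ord_max else ord0.
have b2I : injective b2.
  by case; case.
have mb2 (d0 : measure_display) (T : measurableType d0) (h : T -> bool) :
    finite_label h -> finite_label (b2 \o h).
  exact: finite_label_comp.
have joinb2 (d0 : measure_display) (T : measurableType d0) (rho : probability T R)
    (V : automorphism rho) (Q : {fset int}) (h : T -> bool) : finite_label h ->
    label_entropy rho (join_label V Q (b2 \o h)) = label_entropy rho (join_label V Q h).
  move=> mh; apply: label_entropy_factor_eq.
  - by apply: finite_label_join; exact: mb2.
  - exact: finite_label_join.
  move=> x y; split => /ffunP xy; apply/ffunP => p; have := xy p; rewrite !ffunE/=.
    exact: b2I.
  by move=> ->.
have := cpe (label_partition (mb2 _ _ _ meta)); rewrite entropy_label.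
rewrite (@label_entropy_factor_eq _ _ _ nu _ _ _ eta (mb2 _ _ _ meta) meta); last first.
  by move=> x y; split => [/b2I|/= ->].
move=> /(_ eta_gt0); apply/negP; rewrite -leNgt.
apply/lee_addgt0Pr => e e0; rewrite add0e.
have e20 : 0 < e / 2 by rewrite divr_gt0.
(* Order of the constants: [rho] makes the Fano cost at most [e / 2], [r] makes the band lighter
   than [rho / 2], [N] makes Chebyshev's term at most [rho / 2]. Only then is [j] taken large, so
   that the entropy of [l] under [S] falls below [e / 2 / N]. *)
have [rho rho0 rhoe] := @fano_small _ bool _ e20.
have rho20 : 0 < rho / 2 by rewrite divr_gt0.
have [r r0 rrho] := level_set_small mg gc rho20.
have rr0 : 0 < rho / 2 * r ^+ 2 by rewrite mulr_gt0 ?exprn_gt0.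
pose N := (Num.truncn (rho / 2 * r ^+ 2)^-1).+1.
have N0 : (0 < N)%N by [].
have NR : 0 < N%:R :> R by rewrite ltr0n.
have Nrho : (N%:R * r ^+ 2)^-1 <= rho / 2.
  rewrite invf_ple ?posrE ?mulr_gt0 ?exprn_gt0//.
  rewrite -ler_pdivrMr ?exprn_gt0// -invfM; exact: ltW (truncnS_gt _).
have : (P_entropy_partition P S (fun i => (b2 \o l) @^-1` [set i]) < (e / 2 / N%:R)%:E)%E.
  apply: (@le_lt_trans _ _ (P_entropy P S)).
    apply: ereal_sup_ubound; do 2 eexists; split; last reflexivity.
    exact/label_partition/mb2.
  by rewrite S0 lte_fin divr_gt0.
move=> /limn_esup_lt near_S; apply: limn_esup_le; near=> j.
have Pj : (0 < #|` P j|%fset)%N by near: j.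
have : ((P_entropy_at S (P j) (fun i => (b2 \o l) @^-1` [set i]))%:E < (e / 2 / N%:R)%:E)%E.
  by near: j.
rewrite lte_fin lee_fin !P_entropy_at_label !joinb2// => Sj.
rewrite ler_pdivrMr ?ltr0n//; apply: le_trans (superlevel_entropy _ _ N0 r0) _.
rewrite [e]splitr mulrDl lerD//.
  rewrite mulrC -ler_pdivlMr// [leRHS]mulrAC -ler_pdivrMr ?ltr0n//; exact: ltW.
rewrite mulrC ler_wpM2r//; apply: le_trans rhoe.
have le_rho : (N%:R * r ^+ 2)^-1 + fine (nu [set y | `|g y - c| < r]) <= rho.
  by rewrite [rho]splitr lerD.
by rewrite /fano_bound lerD// ler_wpM2l ?mulr_ge0// ler_wsqrtr.
Unshelve. all: by end_near. Qed.

End indicator.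

Variable P : nat -> {fset int}.
Hypothesis P0 : \forall j \near \oo, (0 < #|` P j|%fset)%N.
Hypothesis S0 : P_entropy P S = 0%E.
Hypothesis cpe : completely_positive_P_entropy P G.

(** Duality replaces density of simple functions. Testing [J' g] on indicators, whose images under
    [J] are constant, shows that [J' g] is constant for every [g]; testing [J f] on indicators of
    [Y] then concludes. *)
Lemma markov_trivial f : f \in Lfun mu 2%:E -> J f = cst (\int[mu]_x f x) %[ae nu].
Proof.
move=> f2; case: (mJ) => _ _ _ [J' [[J'2 _ _ _] adj _]].
have mind (d0 : measure_display) (T : measurableType d0) (rho : probability T R) E :
    measurable E -> (fun x : T => (`[< E x >])%:R : R) \in Lfun rho 2%:E.
  move=> mE; apply: bounded_Lfun2.
  exact: (bounded_measurable_label (fun b : bool => b%:R) (finite_label_bool mE)).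
have J'cst g : g \in Lfun nu 2%:E -> J' g = cst (\int[nu]_y g y) %[ae mu].
  move=> g2; apply: ae_eq_cst_integral => [|E mE].
    by apply: Lfun2_integrable; exact: J'2.
  under eq_Rintegral do rewrite mulrC.
  rewrite -adj//; last exact: mind.
  have ml := finite_label_bool mE.
  transitivity (\int[nu]_y (fine (mu E) * g y)).
    apply: ae_eq_Rintegral.
    - apply: measurable_funM; last exact: Lfun2_measurable g2.
      by apply: (markov_measurable mJ); exact: mind.
    - by apply: measurable_funM => //; exact: Lfun2_measurable g2.
    - apply: filterS (markov_trivial_indicator ml P0 S0 cpe) => y /[apply] ->.
      congr (fine (mu _) * _); apply/seteqP; split => x /=; first by move/asboolP.
      by move=> Ex; apply/asboolP.
  by rewrite RintegralZl ?Lfun2_integrable// mulrC.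
apply: ae_eq_cst_integral => [|E mE].
  by apply: Lfun2_integrable; exact: (markov_Lfun mJ).
rewrite (adj _ _ f2 (mind _ _ _ _ mE)).
have IE : \int[nu]_y (`[< E y >])%:R = fine (nu E).
  rewrite Rintegral_bool; last exact: (finite_label_bool mE true).
  by congr (fine (nu _)); apply/seteqP; split => x /= /asboolP.
transitivity (\int[mu]_x (f x * fine (nu E))).
  apply: ae_eq_Rintegral.
  - apply: measurable_funM; first exact: Lfun2_measurable f2.
    by apply: (@Lfun2_measurable _ _ _ mu); apply: J'2; exact: mind.
  - by apply: measurable_funM => //; exact: Lfun2_measurable f2.
  - by apply: filterS (J'cst _ (mind _ _ _ _ mE)) => x /[apply] ->; rewrite /cst IE.
by rewrite RintegralZr// Lfun2_integrable.
Qed.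

End disjointness.

(** * Fair coins *)


Section expansions.
Variables (R : realType) (b : R).
Hypothesis b2 : 2 <= b.
Implicit Types (c : nat -> bool) (x : R).

(* Expansions in base [b] using only the extreme digits [0] and [b - 1]. *)
Definition digit_step x : R := b * x - (b - 1) * (2^-1 <= x)%R%:R.
Definition digit (k : nat) x : bool := (2^-1 <= iter k digit_step x)%R.
Definition partial_expansion c (n : nat) : R :=
  \sum_(k < n) (b - 1) * (c k)%:R / b ^+ k.+1.
Definition expansion c : R := limn (partial_expansion c).

Let b0 : 0 < b. Proof. by apply: lt_le_trans b2. Qed.
Let b1 : 0 <= b - 1. Proof. by rewrite subr_ge0 (le_trans _ b2) ?ler1n. Qed.

Lemma partial_expansionS c n : partial_expansion c n.+1 =
  ((b - 1) * (c 0%N)%:R + partial_expansion (c \o succn) n) / b.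
Proof.
rewrite /partial_expansion big_ord_recl/= expr1 [RHS]mulrDl; congr (_ + _).
rewrite mulr_suml; apply: eq_bigr => k _.
by rewrite [in LHS]exprSr invfM !mulrA.
Qed.

Lemma partial_expansion_bounds c n :
  0 <= partial_expansion c n <= 1 - (b ^+ n)^-1.
Proof.
elim: n c => [|n IH] c; first by rewrite /partial_expansion big_ord0 expr0 invr1 subrr lexx.
have := IH (c \o succn); rewrite partial_expansionS.
set s := partial_expansion _ _ => /andP[s0 s1]; apply/andP; split.
  by rewrite divr_ge0 ?(ltW b0)// addr_ge0// mulr_ge0.
have bE : b ^- n.+1 * b = b ^- n.
  by rewrite exprS invfM mulrAC mulVf ?gt_eqF// mul1r.
rewrite ler_pdivrMr// [leRHS]mulrBl mul1r bE.
have h : b + s <= b + (1 - b ^- n) by rewrite lerD2l.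
case: (c 0%N) => /=; first by rewrite mulr1; lra.
by rewrite mulr0 add0r; move: b1 h; lra.
Qed.

Lemma partial_expansion_nondecreasing c : nondecreasing_seq (partial_expansion c).
Proof.
apply/nondecreasing_seqP => n; rewrite /partial_expansion big_ord_recr/= lerDl.
by rewrite divr_ge0 ?mulr_ge0// exprn_ge0// ltW.
Qed.

Lemma cvg_expansion c : partial_expansion c n @[n --> \oo] --> expansion c.
Proof.
apply: nondecreasing_is_cvgn; first exact: partial_expansion_nondecreasing.
exists 1 => _ [n _ <-]; have /andP[_ /le_trans] := partial_expansion_bounds c n.
by apply; rewrite gerBl invr_ge0 exprn_ge0// ltW.
Qed.

Lemma expansion_bounds c : 0 <= expansion c <= 1.
Proof.
apply/andP; split.
  apply: limr_ge; first by apply/cvg_ex; exists (expansion c); exact: cvg_expansion.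
  by apply: nearW => n; case/andP: (partial_expansion_bounds c n).
apply: limr_le; first by apply/cvg_ex; exists (expansion c); exact: cvg_expansion.
apply: nearW => n; have /andP[_ /le_trans] := partial_expansion_bounds c n.
by apply; rewrite gerBl invr_ge0 exprn_ge0// ltW.
Qed.

Lemma expansionE c :
  expansion c = ((b - 1) * (c 0%N)%:R + expansion (c \o succn)) / b.
Proof.
have h1 : partial_expansion c n.+1 @[n --> \oo] --> expansion c.
  by have := @cvg_expansion c; rewrite -(cvg_shiftS (partial_expansion c)).
have h2 : partial_expansion c n.+1 @[n --> \oo] -->
    ((b - 1) * (c 0%N)%:R + expansion (c \o succn)) / b.
  under eq_fun do rewrite partial_expansionS.
  by apply: cvgMr_tmp; apply: cvgD; [exact: cvg_cst|exact: cvg_expansion].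
exact: (cvg_unique _ h1 h2).
Qed.

(** The leading digit is read off the position relative to 1/2: the expansion is at most
    [1 / b < 1 / 2] if it is 0, and at least [(b - 1) / b] if not. [digit_step] then shifts the
    sequence. Base 3 is used later, for an injective coding of sequences. *)
Lemma expansion_inj_digit c k : 2 < b -> digit k (expansion c) = c k.
Proof.
move=> b3; elim: k c => [|k IH] c.
  rewrite /digit/= expansionE ler_pdivlMr//.
  have := expansion_bounds (c \o succn); case: (c 0%N) => /andP[e0 e1].
    by rewrite mulr1; apply/idP; lra.
  by rewrite mulr0 add0r; apply/negbTE; rewrite -ltNge; lra.
have d0 : digit 0 (expansion c) = c 0%N.
  rewrite /digit/= expansionE ler_pdivlMr//.
  have := expansion_bounds (c \o succn); case: (c 0%N) => /andP[e0 e1].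
    by rewrite mulr1; apply/idP; lra.
  by rewrite mulr0 add0r; apply/negbTE; rewrite -ltNge; lra.
rewrite /digit iterSr (_ : digit_step _ = expansion (c \o succn)); first exact: IH.
rewrite /digit_step; move: d0; rewrite /digit/= => ->.
by rewrite expansionE mulrC divfK ?gt_eqF// addrC addKr.
Qed.

Lemma expansion_remainder x n : x =
  partial_expansion (digit^~ x) n + iter n digit_step x / b ^+ n.
Proof.
elim: n => [|n IH]; first by rewrite /partial_expansion big_ord0 add0r expr0 divr1.
rewrite {1}IH /partial_expansion big_ord_recr/= -addrA; congr (_ + _).
rewrite /digit/= /digit_step -mulrDl; set y := iter n _ _.
rewrite [X in _ = X / _](_ : _ = b * y); last by ring.
by rewrite exprS invfM mulrACA divff ?gt_eqF// mul1r.
Qed.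

Lemma measurable_digit_step : measurable_fun setT digit_step.
Proof.
apply: measurable_funB; apply: measurable_funM => //.
rewrite (_ : (fun x => _) = \1_(`[2^-1, +oo[%classic : set R)).
  by apply: measurable_indic; exact: measurable_itv.
apply/funext => x; rewrite indicE; congr ((nat_of_bool _)%:R).
by apply/idP/idP; rewrite inE/= in_itv/= andbT.
Qed.

Lemma measurable_digit k : measurable [set x | digit k x].
Proof.
rewrite (_ : [set x | _] = iter k digit_step @^-1` `[2^-1, +oo[%classic).
  rewrite -[X in measurable X]setTI.
  by apply: measurable_iter => //; exact: measurable_digit_step.
by apply/seteqP; split => x /=; rewrite in_itv/= andbT.
Qed.

Lemma measurable_expansion d (T : measurableType d) (c : T -> nat -> bool) :
  (forall k, measurable [set t | c t k]) ->
  measurable_fun setT (fun t => expansion (c t)).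
Proof.
move=> mc; apply: (measurable_fun_cvg (h := fun n t => partial_expansion (c t) n)).
  move=> n; apply: measurable_sum => k.
  apply: measurable_funM => //; apply: measurable_funM => //.
  rewrite (_ : (fun t => _) = \1_[set t | c t k]); first exact: measurable_indic.
  by apply/funext => t; rewrite indicE; congr ((nat_of_bool _)%:R);
    apply/idP/idP; rewrite inE.
by move=> t _; exact: cvg_expansion.
Qed.

End expansions.

(** * Binary digits of a uniform variable *)

Section binary_digits.
Variable R : realType.
Implicit Types x : R.

Let step := @digit_step R 2.
Let bit := @digit R 2.

Lemma binary_stepP x : 0 <= x < 1 -> 0 <= step x < 1.
Proof.
by rewrite /step /digit_step => /andP[x0 x1]; case: (leP 2^-1 x) => /= hx; lra.
Qed.

(** The remainder stays in [[0, 1[] and is divided by [2 ^+ n]. *)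
Lemma expansion_binary_digits x : 0 <= x < 1 -> expansion 2 (bit^~ x) = x.
Proof.
move=> x01; have b2 : 2 <= 2 :> R by [].
have xn n : 0 <= iter n step x < 1.
  by elim: n => // n IH; rewrite iterS; exact: binary_stepP.
have h1 := @cvg_expansion _ _ b2 (bit^~ x).
suff h2 : partial_expansion 2 (bit^~ x) n @[n --> \oo] --> x.
  exact: (cvg_unique _ h1 h2).
apply/cvgrPdist_le => e e0.
have /cvgrPdist_le/(_ _ e0) := @cvg_expr R (2^-1) ltac:(by rewrite ger0_norm//; lra).
apply: filterS => n; rewrite sub0r normrN => hn.
rewrite {1}(expansion_remainder b2 x n) addrC addKr.
apply: le_trans hn; rewrite exprVn normrM ler_piMl//.
by have /andP[? ?] := xn n; rewrite ger0_norm// ltW.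
Qed.

(** Left endpoint of the dyadic interval of rank [n] whose points have the first digits [e]. *)
Fixpoint dyadic_lower (e : nat -> bool) (n : nat) : R :=
  if n is n'.+1 then ((e 0%N)%:R + dyadic_lower (e \o succn) n') / 2 else 0.

Lemma dyadic_lower_bounds e n : 0 <= dyadic_lower e n <= 1 - (2 ^+ n)^-1.
Proof.
elim: n e => [|n IH] e /=; first by rewrite expr0 invr1 subrr lexx.
have := IH (e \o succn); rewrite exprS invfM.
by case: (e 0%N) => /= /andP[? ?]; apply/andP; split; lra.
Qed.

(** By induction: [digit_step] maps each half of the unit interval affinely onto the whole, and
    shifts the digits. *)
Lemma binary_cylinderE e n :
  [set x | 0 <= x < 1 /\ forall k, (k < n)%N -> bit k x = e k] =
  `[dyadic_lower e n, dyadic_lower e n + (2 ^+ n)^-1[%classic.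
Proof.
elim: n e => [|n IH] e.
  by apply/seteqP; split => x /=; rewrite in_itv/= expr0 invr1 add0r; [case|].
have := dyadic_lower_bounds (e \o succn) n; set v := dyadic_lower _ n.
move=> /andP[v0 v1]; apply/seteqP; split => x /=.
  move=> [x01 xe]; have e0 := xe 0%N isT.
  have : [set x | 0 <= x < 1 /\ forall k, (k < n)%N -> bit k x = (e \o succn) k] (step x).
    split; first exact: binary_stepP.
    by move=> k kn; rewrite /= -xe// /bit /digit iterSr.
  rewrite IH /= -/v !in_itv/= exprS invfM /step /digit_step.
  move: e0; rewrite /bit /digit/= => ->.
  by case: (e 0%N) => /= /andP[? ?]; apply/andP; split; lra.
rewrite in_itv/= -/v exprS invfM => /andP[x1 x2].
have n0 : 0 < (2 ^+ n)^-1 :> R by rewrite invr_gt0 exprn_gt0.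
have e0 : bit 0 x = e 0%N.
  move: x1 x2; rewrite /bit /digit/=; case: (e 0%N) => /= ? ?; first by apply/idP; lra.
  by apply/negbTE; rewrite -ltNge; lra.
have : `[v, v + (2 ^+ n)^-1[%classic (step x).
  rewrite /= in_itv/= /step /digit_step; move: e0; rewrite /bit /digit/= => ->.
  by move: x1 x2; case: (e 0%N) => /= ? ?; apply/andP; split; lra.
rewrite -IH => -[sx xe]; split.
  by move: x1 x2; case: (e 0%N) => /= ? ?; apply/andP; split; lra.
by case=> // k kn; have := xe k kn; rewrite /= => <-; rewrite /bit /digit iterSr.
Qed.

Definition unif01 := [the probability _ _ of uniform_prob (@ltr01 R)].

Lemma unif01_itv (x y : R) : 0 <= x -> x <= y -> y <= 1 ->
  unif01 `[x, y[%classic = (y - x)%:E.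
Proof.
move=> x0 xy y1; rewrite /unif01/= /uniform_prob.
transitivity (\int[lebesgue_measure]_(t in `[x, y[) (cst 1%E t))%E.
  apply: eq_integral => t; rewrite inE/= in_itv/= => /andP[xt ty].
  rewrite /uniform_pdf subr0 invr1 ifT//.
  by rewrite (le_trans x0 xt)/= ltW// (lt_le_trans ty).
rewrite integral_cst//= ?mul1e.
rewrite lebesgue_measure_itv/= lte_fin; move: xy; rewrite le_eqVlt => /predU1P[->|->//].
by rewrite ltxx subrr.
Qed.

Lemma unif01_cylinder e n :
  unif01 [set x | forall k, (k < n)%N -> bit k x = e k] = ((2 ^+ n)^-1)%:E.
Proof.
have /andP[v0 v1] := dyadic_lower_bounds e n.
have m01 : measurable (`[0, 1[%classic : set R) by exact: measurable_itv.
have mC : measurable [set x | forall k, (k < n)%N -> bit k x = e k].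
  rewrite (_ : [set x | _] = \bigcap_(k in `I_n) [set x | bit k x = e k]).
    apply: bigcap_measurableType => k _; case: (e k); first exact: measurable_digit.
    rewrite (_ : [set x | _] = ~` [set x | bit k x]).
      by apply: measurableC; exact: measurable_digit.
    by apply/seteqP; split => x /=; [move=> ->|move=> /negP/negbTE].
  by apply/seteqP; split => x /=.
(* Points outside the unit interval also have digits, but they form a null set. *)
have U1 : unif01 (~` `[0, 1[%classic) = 0%E.
  rewrite probability_setC// unif01_itv// subr0.
  by rewrite -EFinB subrr.
transitivity (unif01 ([set x | forall k, (k < n)%N -> bit k x = e k] `&` `[0, 1[%classic)).
  rewrite (_ : unif01 [set x | _] = unif01 (([set x | forall k, (k < n)%N -> bit k x = e k] `&` `[0, 1[%classic)
      `|` ([set x | forall k, (k < n)%N -> bit k x = e k] `&` ~` `[0, 1[%classic))); last first.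
    by rewrite -setIUr setUv setIT.
  rewrite measureU0//.
  - exact: measurableI.
  - by apply: measurableI => //; exact: measurableC.
  - by apply: subset_measure0 U1 => //; [apply: measurableI => //; exact: measurableC|exact: measurableC].
rewrite (_ : _ `&` _ = `[dyadic_lower e n, dyadic_lower e n + (2 ^+ n)^-1[%classic).
  rewrite unif01_itv ?lerDl ?invr_ge0 ?exprn_ge0//; last by rewrite -lerBrDr.
  by rewrite addrC addKr.
rewrite -binary_cylinderE; apply/seteqP; split => x /=; rewrite in_itv/=; tauto.
Qed.

End binary_digits.

(** * The product sigma-algebra on coin sequences *)

Section bit_space.
Variable I : countType.

Definition coordinate_sets : set (set (I -> bool)) :=
  [set A | exists i, A = [set y : I -> bool | y i]].

Definition bits := g_sigma_algebraType coordinate_sets.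

Definition determined (s : seq I) (E : set (I -> bool)) :=
  forall y y', {in s, y =1 y'} -> E y -> E y'.

Definition cylinder (D : set I) : set (set (I -> bool)) :=
  [set E | exists s, (forall i, i \in s -> D i) /\ determined s E].

Lemma finite_label_coordinates (F : finType) (f : F -> I) :
  finite_label (fun y : bits => [ffun t => y (f t)]).
Proof.
apply: (@finite_label_ffun _ bits F bool (fun t y => y (f t))) => t.
rewrite (_ : (fun y => _) = fun y : bits => `[< [set y : bits | y (f t)] y >]).
  by apply: finite_label_bool; apply: sub_sigma_algebra; exists (f t).
by apply/funext => y; apply/idP/asboolP.
Qed.

Lemma determined_preimage s (E : set (I -> bool)) : determined s E ->
  E = (fun y => [ffun t : seq_sub s => y (val t)]) @^-1`
      [set a | exists2 y, E y & a = [ffun t : seq_sub s => y (val t)]].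
Proof.
move=> sE; apply/seteqP; split => [y Ey|y [y' Ey' /ffunP yy']]; first by exists y.
apply: sE Ey' => i si; have := yy' (SeqSub si).
by rewrite !ffunE/=.
Qed.

Lemma measurable_determined s E : determined s E -> @measurable _ bits E.
Proof.
by move=> /determined_preimage ->; apply: finite_label_preimage;
  exact: finite_label_coordinates.
Qed.

Lemma measurable_cylinder D : cylinder D `<=` @measurable _ bits.
Proof. by move=> E [s [_ /measurable_determined]]. Qed.

Lemma determined_subset s s' E : {subset s <= s'} -> determined s E -> determined s' E.
Proof. by move=> ss sE y y' yy'; apply: sE => i /ss; exact: yy'. Qed.

Lemma determinedC s E : determined s E -> determined s (~` E).
Proof. by move=> sE y y' yy' nEy Ey'; apply: nEy; apply: sE Ey' => i si; rewrite yy'. Qed.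

Lemma determinedU s E E' : determined s E -> determined s E' ->
  determined s (E `|` E').
Proof.
by move=> sE sE' y y' yy' [/(sE _ _ yy')|/(sE' _ _ yy')]; [left|right].
Qed.

Lemma determinedI s E E' : determined s E -> determined s E' ->
  determined s (E `&` E').
Proof.
by move=> sE sE' y y' yy' [/(sE _ _ yy') ? /(sE' _ _ yy')].
Qed.

Lemma cylinder_algebra D : set_algebra (cylinder D).
Proof.
split; first by exists [::].
  by move=> E [s [sD /determinedC sE]]; exists s.
move=> E E' [s [sD sE]] [s' [s'D sE']]; exists (s ++ s'); split.
  by move=> i; rewrite mem_cat => /orP[]; auto.
by apply: determinedU; [apply: determined_subset sE|apply: determined_subset sE'];
  move=> i si; rewrite mem_cat si ?orbT.
Qed.

Lemma cylinder_setI D : setI_closed (cylinder D).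
Proof.
move=> E E' [s [sD sE]] [s' [s'D sE']]; exists (s ++ s'); split.
  by move=> i; rewrite mem_cat => /orP[]; auto.
by apply: determinedI; [apply: determined_subset sE|apply: determined_subset sE'];
  move=> i si; rewrite mem_cat si ?orbT.
Qed.

Lemma bits_measurableE : @measurable _ bits = <<s cylinder setT >>.
Proof.
apply/seteqP; split; last first.
  apply: smallest_sub; first exact: sigma_algebra_measurable.
  exact: measurable_cylinder.
apply: smallest_sub; first exact: smallest_sigma_algebra.
move=> _ [i ->]; apply: sub_sigma_algebra; exists [:: i]; split => //.
by move=> y y' yy' /=; rewrite yy' ?mem_head.
Qed.

Lemma measurable_to_bits d (T : measurableType d) (f : T -> bits) :
  (forall i, measurable [set x | f x i]) -> measurable_fun setT f.
Proof.
move=> mf; apply: (@measurability _ _ _ bits setT f coordinate_sets) => //.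
by move=> _ [_ [i ->] <-]; rewrite setTI; exact: mf.
Qed.

Lemma measurable_coordinate (i : I) : measurable [set y : bits | y i].
Proof. by apply: sub_sigma_algebra; exists i. Qed.

End bit_space.

Lemma measurable_reindex (I J : countType) (f : J -> I) :
  measurable_fun setT ((fun y => y \o f) : bits I -> bits J).
Proof. by apply: measurable_to_bits => j; exact: measurable_coordinate. Qed.

Lemma determined_reindex (I J : countType) (f : J -> I) (s : seq J) (E : set (J -> bool)) :
  determined s E -> determined (map f s) ((fun y : I -> bool => y \o f) @^-1` E).
Proof.
move=> sE y y' yy'; apply: sE => j js /=; apply: yy'.
by apply/mapP; exists j.
Qed.

Lemma measure_unique_pi (R : realType) d (T : measurableType d) (G : set (set T))
    (m1 m2 : {measure set T -> \bar R}) :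
  G `<=` measurable -> setI_closed G -> G setT -> (m1 setT < +oo)%E ->
  (forall A, G A -> m1 A = m2 A) -> forall A, <<s G >> A -> m1 A = m2 A.
Proof.
move=> Gm GI GT m1T m12; apply: (@g_sigma_algebra_measure_unique _ R T G Gm (fun=> setT) _ _ m1 m2) => //.
by apply/seteqP; split => // x _; exists 0%N.
Qed.

Section independence.
Variables (R : realType) (d : measure_display) (T : measurableType d).
Variable P : probability T R.

(** For fixed [C], [A |-> P (A & C)] and [A |-> P A * P C] are finite measures; they agree on a
    sigma-algebra as soon as they agree on a generating pi-system. This is applied once in each
    variable. *)
Lemma independent_sigma (G1 G2 : set (set T)) :
  G1 `<=` measurable -> G2 `<=` measurable ->
  setI_closed G1 -> setI_closed G2 -> G1 setT -> G2 setT ->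
  (forall A B, G1 A -> G2 B -> P (A `&` B) = (P A * P B)%E) ->
  forall A B, <<s G1 >> A -> <<s G2 >> B -> P (A `&` B) = (P A * P B)%E.
Proof.
move=> G1m G2m G1I G2I G1T G2T G12.
have sub (G : set (set T)) : G `<=` measurable -> <<s G >> `<=` measurable.
  by move=> Gm; apply: smallest_sub => //; exact: sigma_algebra_measurable.
have key (G : set (set T)) C : G `<=` measurable -> setI_closed G -> G setT ->
    measurable C -> (forall A, G A -> P (A `&` C) = (P A * P C)%E) ->
    forall A, <<s G >> A -> P (A `&` C) = (P A * P C)%E.
  move=> Gm GI GT mC GC A GA.
  pose r : {nonneg R} := NngNum (fine_ge0 (measure_ge0 P C)).
  have rE : (r%:num)%:E = P C by rewrite /= fineK ?fin_num_measure.
  have mAC B : mscale r P B = (P B * P C)%E by rewrite /mscale/= rE muleC.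
  rewrite -mAC; have := @measure_unique_pi R _ T G (mrestr P mC) (mscale r P) Gm GI GT.
  apply => //; last by move=> B GB; exact: etrans (GC _ GB) (esym (mAC B)).
  by apply: le_lt_trans (probability_le1 P (measurableI _ _ measurableT mC)) (ltry 1).
move=> A B GA GB; rewrite setIC muleC; apply: (key G2) => //; first exact: sub GA.
move=> C GC; rewrite setIC muleC; apply: (key G1) => //; first exact: G2m.
by move=> D GD; exact: G12.
Qed.

End independence.

Section coin_measure.
Variables (R : realType) (I : countType).

(** All coins are binary digits of a single uniform point, coin [i] being the digit of rank
    [pickle i]. *)
Definition coin_map (x : g_sigma_algebraType R.-ocitv.-measurable) : bits I :=
  fun i => digit 2 (choice.pickle i) (x : R).

Lemma measurable_coin_map : measurable_fun setT coin_map.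
Proof. by apply: measurable_to_bits => i; exact: measurable_digit. Qed.

Definition coin : probability (bits I) R :=
  [the probability _ _ of distribution (unif01 R) (mfun_Sub (mem_set measurable_coin_map))].

Arguments coin : simpl never.

Lemma coinE E : coin E = unif01 R (coin_map @^-1` E).
Proof. by []. Qed.

Lemma finite_label_digits n :
  finite_label (fun x : g_sigma_algebraType R.-ocitv.-measurable =>
    [ffun k : 'I_n => digit 2 k (x : R)]).
Proof.
apply: (@finite_label_ffun _ _ 'I_n bool (fun k x => digit 2 k (x : R))) => k.
rewrite (_ : (fun x => _) = fun x => `[< [set x : R | digit 2 k x] x >]).
  by apply: finite_label_bool; exact: measurable_digit.
by apply/funext => x; apply/idP/asboolP.
Qed.

Lemma law_digits n a :
  law (unif01 R) (fun x => [ffun k : 'I_n => digit 2 k (x : R)]) a = (2 ^+ n)^-1.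
Proof.
pose e k := if insub k is Some i then a i else false.
rewrite /law (_ : _ @^-1` _ = [set x | forall k, (k < n)%N -> digit 2 k x = e k]).
  by rewrite unif01_cylinder.
apply/seteqP; split => x /=.
  by move=> xa k kn; rewrite /e insubT -xa ffunE.
move=> xe; apply/ffunP => k; rewrite ffunE xe//.
by rewrite /e (_ : insub (k : nat) = Some k)//; exact: valK.
Qed.

(** Distinct coins occupy distinct digits. Summing over the first [n] digits, an occupied position
    contributes 1/2 and a free one contributes 1. *)
Lemma coin_law (F : finType) (f : F -> I) a : injective f ->
  law coin (fun y => [ffun t => y (f t)]) a = (2 ^+ #|F|)^-1.
Proof.
move=> fI; pose n := (\max_t choice.pickle (f t)).+1.
have fn t : (choice.pickle (f t) < n)%N by rewrite ltnS; exact: (leq_bigmax t).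
pose pos t := Ordinal (fn t).
have posI : injective pos.
  by move=> t t' /(congr1 val)/= pp; apply: fI; exact: (pcan_inj choice.pickleK pp).
pose g (e : {ffun 'I_n -> bool}) : {ffun F -> bool} := [ffun t => e (pos t)].
transitivity (law (unif01 R) (g \o (fun x => [ffun k : 'I_n => digit 2 k (x : R)])) a).
  rewrite /law coinE; congr (fine (unif01 R _)); apply/seteqP.
  by split => x /= <-; apply/ffunP => t; rewrite !ffunE.
rewrite law_comp; last exact: finite_label_digits.
rewrite /marg; under eq_bigr do rewrite law_digits.
(* The weight of value [v] at position [k]: 1/2 when compatible with [a], else 0; a free position
   accepts both values. *)
pose hh (k : 'I_n) (v : bool) : R := 2^-1 * [forall t, (pos t == k) ==> (v == a t)]%:R.
transitivity (\sum_(e : {ffun 'I_n -> bool}) \prod_k hh k (e k)).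
  rewrite big_mkcond; apply: eq_bigr => e _.
  rewrite big_split/= prodr_const card_ord exprVn.
  case: eqP => [<-|ga].
    rewrite big1 ?mulr1// => k _; case: forallP => // -[] t.
    by apply/implyP => /eqP <-; rewrite ffunE.
  have [t ta] : exists t, e (pos t) != a t.
    apply: contrapT => /forallNP na; apply: ga; apply/ffunP => t; rewrite ffunE.
    by apply/eqP/negPn/negP; exact: na.
  rewrite (bigD1 (pos t))//= (_ : [forall _, _] = false) ?mul0r ?mulr0//.
  by apply/negbTE/forallPn; exists t; rewrite eqxx.
rewrite -(bigA_distr_bigA hh).
transitivity (\prod_(k : 'I_n) (if k \in codom pos then 2^-1 else 1 : R)).
  apply: eq_bigr => k _; rewrite big_bool /hh/=; case: ifPn => [/codomP[t ->]|kpos].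
    have E v : [forall t0, (pos t0 == pos t) ==> (v == a t0)] = (v == a t).
      apply/forallP/eqP => [/(_ t)|-> t0]; first by rewrite eqxx => /eqP.
      by apply/implyP => /eqP/posI ->.
    by rewrite !E; case: (a t) => /=; rewrite ?mulr1 ?mulr0 ?addr0 ?add0r.
  have E v : [forall t0, (pos t0 == k) ==> (v == a t0)] = true.
    apply/forallP => t; apply/implyP => /eqP tk.
    by move: kpos; rewrite -tk codom_f.
  by rewrite (E true) (E false) /= mulr1 [RHS]splitr mul1r.
rewrite -big_mkcond/= prodr_const exprVn; congr (2 ^+ _)^-1.
exact: (card_codom posI).
Qed.

End coin_measure.

Section coin_independence.
Variable R : realType.

(** Both sides are probability measures in [E], and each pattern of finitely many coins has the same
    mass under both because [f] is injective. This covers the shift as well as the extraction of one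
    row of coins. *)
Lemma coin_reindex (I J : countType) (f : J -> I) (E : set (bits J)) :
  injective f -> measurable E ->
  coin R I ((fun y : I -> bool => y \o f) @^-1` E) = coin R J E.
Proof.
move=> fI; rewrite bits_measurableE.
pose m1 : probability (bits J) R :=
  [the probability _ _ of distribution (coin R I) (mfun_Sub (mem_set (measurable_reindex f)))].
apply: (@measure_unique_pi R _ (bits J) _ m1 (coin R J)).
- exact: measurable_cylinder.
- exact: cylinder_setI.
- by exists [::].
- exact: le_lt_trans (probability_le1 m1 measurableT) (ltry 1).
move=> A [s [_ sA]]; have mA := measurable_determined sA.
rewrite -[LHS]fineK ?fin_num_measure// -[RHS]fineK ?fin_num_measure//; congr EFin.
rewrite (determined_preimage sA).
have := law_preimage (coin R J) (l := fun y : bits J => [ffun t : seq_sub s => y (val t)])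
  (fun a => `[< exists2 y, A y & a = [ffun t : seq_sub s => y (val t)] >])
  (finite_label_coordinates _).
have := law_preimage (coin R I) (l := fun y : bits I => [ffun t : seq_sub s => y (f (val t))])
  (fun a => `[< exists2 y, A y & a = [ffun t : seq_sub s => y (val t)] >])
  (@finite_label_coordinates _ _ (f \o val)).
rewrite (_ : _ @^-1` [set k | _] = (fun y : bits I => [ffun t : seq_sub s => y (f (val t))]) @^-1`
   [set a | exists2 y, A y & a = [ffun t : seq_sub s => y (val t)]]); last first.
  by apply/seteqP; split => y /= /asboolP.
move=> h1.
rewrite (_ : _ @^-1` [set k | _] = (fun y : bits J => [ffun t : seq_sub s => y (val t)]) @^-1`
   [set a | exists2 y, A y & a = [ffun t : seq_sub s => y (val t)]]); last first.
  by apply/seteqP; split => y /= /asboolP.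
move=> ->; rewrite [LHS]h1; apply: eq_bigr => a _.
rewrite (coin_law R _ val_inj) (@coin_law R I _ (f \o val))//.
by apply: inj_comp => //; exact: val_inj.
Qed.

(** A pair of patterns on disjoint sets of coins is one pattern on their disjoint sum, whose mass is
    the product. *)
Lemma coin_independent2 (I : countType) (s1 s2 : seq I) (E1 E2 : set (I -> bool)) :
  (forall i, i \in s1 -> i \in s2 -> False) ->
  determined s1 E1 -> determined s2 E2 ->
  coin R I (E1 `&` E2) = (coin R I E1 * coin R I E2)%E.
Proof.
move=> s12 sE1 sE2.
have mE1 := measurable_determined sE1; have mE2 := measurable_determined sE2.
rewrite -[LHS]fineK; last by apply: fin_num_measure; exact: measurableI.
rewrite -[coin R I E1]fineK ?fin_num_measure// -[coin R I E2]fineK ?fin_num_measure//.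
rewrite -EFinM; congr EFin.
pose F1 : finType := seq_sub s1; pose F2 : finType := seq_sub s2.
pose l1 (y : bits I) : {ffun F1 -> bool} := [ffun t => y (val t)].
pose l2 (y : bits I) : {ffun F2 -> bool} := [ffun t => y (val t)].
have ml1 : finite_label l1 by exact: finite_label_coordinates.
have ml2 : finite_label l2 by exact: finite_label_coordinates.
pose Q1 a := `[< exists2 y, E1 y & a = l1 y >].
pose Q2 a := `[< exists2 y, E2 y & a = l2 y >].
have E1E : E1 = l1 @^-1` [set a | Q1 a].
  rewrite {1}(determined_preimage sE1); apply/seteqP; split => y /=.
    by move=> ?; apply/asboolP.
  by move/asboolP.
have E2E : E2 = l2 @^-1` [set a | Q2 a].
  rewrite {1}(determined_preimage sE2); apply/seteqP; split => y /=.
    by move=> ?; apply/asboolP.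
  by move/asboolP.
rewrite {2}E1E {2}E2E !law_preimage//.
pose l y := (l1 y, l2 y); have ml : finite_label l by exact: finite_label_pair.
rewrite (_ : E1 `&` E2 = l @^-1` [set z | Q1 z.1 && Q2 z.2]); last first.
  by rewrite {1}E1E {1}E2E; apply/seteqP; split => y /=; [move=> [-> ->]|move=> /andP].
rewrite (law_preimage _ (fun z => Q1 z.1 && Q2 z.2))//.
transitivity (\sum_(z | Q1 z.1 && Q2 z.2) law (coin R I) l (z.1, z.2)).
  by apply: eq_bigr => -[].
rewrite -(pair_big Q1 Q2 (fun a b => law (coin R I) l (a, b)))/=.
rewrite mulr_suml; apply: eq_bigr => a _; rewrite mulr_sumr; apply: eq_bigr => b _.
pose f (t : F1 + F2) : I := match t with inl t => val t | inr t => val t end.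
have fI : injective f.
  move=> [t|t] [t'|t'] /=.
  - by move=> /val_inj ->.
  - by move=> tt'; exfalso; apply: (s12 (ssval t)); [exact: (valP t)|rewrite tt'; exact: (valP t')].
  - by move=> tt'; exfalso; apply: (s12 (ssval t')); [exact: (valP t')|rewrite -tt'; exact: (valP t)].
  - by move=> /val_inj ->.
pose ab : {ffun F1 + F2 -> bool} :=
  [ffun t => match t with inl t => a t | inr t => b t end].
have := coin_law R ab fI; rewrite card_sum exprD invfM.
rewrite (_ : law (coin R I) l1 a = (2 ^+ #|F1|)^-1); last first.
  by apply: coin_law; exact: val_inj.
rewrite (_ : law (coin R I) l2 b = (2 ^+ #|F2|)^-1); last first.
  by apply: coin_law; exact: val_inj.
move=> <-; rewrite /law; congr (fine (coin R I _)); apply/seteqP; split => y /=.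
  move=> yab; have ya : l1 y = a := congr1 fst yab; have yb : l2 y = b := congr1 snd yab.
  by apply/ffunP => -[t|t]; rewrite !ffunE/= -?ya -?yb ffunE.
move=> /ffunP yab; congr pair; apply/ffunP => t.
  by have := yab (inl t); rewrite !ffunE.
by have := yab (inr t); rewrite !ffunE.
Qed.

Lemma coin_independent (I : countType) (D1 D2 : set I) (E1 E2 : set (bits I)) :
  (forall i, D1 i -> D2 i -> False) ->
  <<s cylinder D1 >> E1 -> <<s cylinder D2 >> E2 ->
  coin R I (E1 `&` E2) = (coin R I E1 * coin R I E2)%E.
Proof.
move=> D12; apply: (@independent_sigma R _ (bits I)).
- exact: measurable_cylinder.
- exact: measurable_cylinder.
- exact: cylinder_setI.
- exact: cylinder_setI.
- by exists [::].
- by exists [::].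
move=> A B [s1 [sD1 sA]] [s2 [sD2 sB]]; apply: (coin_independent2 _ sA sB).
by move=> i /sD1 ? /sD2 ?; exact: (D12 i).
Qed.

(** Recognizes events that depend on possibly infinitely many coins, all indexed in [D], as required
    for independence. *)
Lemma reindex_sigma (I J : countType) (f : J -> I) (D : set I) (E : set (bits J)) :
  (forall j, D (f j)) -> measurable E ->
  <<s cylinder D >> ((fun y : I -> bool => y \o f) @^-1` E).
Proof.
move=> fD; have sC := smallest_sigma_algebra setT (cylinder D).
move: E; apply: smallest_sub.
  split.
  - by rewrite preimage_set0; case: sC.
  - by move=> A fA; case: sC => _ sC _; exact: (sC _ fA).
  - by move=> A fA; rewrite preimage_bigcup; case: sC => _ _; exact.
move=> _ [j ->]; apply: sub_sigma_algebra; exists [:: f j]; split.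
  by move=> i; rewrite inE => /eqP ->.
by move=> y y' yy' /=; rewrite yy' ?mem_head.
Qed.

Lemma coin_independent_family (I : countType) (T : eqType) (r : seq T) (s : T -> seq I)
    (E : T -> set (bits I)) :
  uniq r -> (forall t t', t != t' -> forall i, i \in s t -> i \in s t' -> False) ->
  (forall t, determined (s t) (E t)) ->
  fine (coin R I [set y | forall t, t \in r -> E t y]) = \prod_(t <- r) fine (coin R I (E t)).
Proof.
move=> ur sD sE.
have dE r' : determined (flatten (map s r')) [set y | forall t, t \in r' -> E t y].
  move=> y y' yy' Ey t tr; apply: (sE t y) (Ey t tr) => i si; apply: yy'.
  by apply/flattenP; exists (s t) => //; exact: map_f.
elim: r ur => [_|t r IH tur].
  rewrite big_nil (_ : [set y | _] = setT); last by apply/seteqP; split.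
  by have -> : coin R I setT = 1%E by exact: probability_setT.
have [tr ur] := andP tur.
have -> : [set y | forall t', t' \in t :: r -> E t' y] =
    E t `&` [set y | forall t, t \in r -> E t y].
  apply/seteqP; split => y Ey.
    by split=> [|t' t'r]; apply: Ey; rewrite inE ?eqxx ?t'r ?orbT.
  by move=> t'; rewrite inE => /predU1P[->|]; case: Ey => // _; exact.
rewrite big_cons -(IH ur) (@coin_independent2 _ _ _ _ _ _ (sE t) (dE r)).
  rewrite [LHS]fineM//; apply: fin_num_measure.
    exact: measurable_determined (sE t).
  exact: measurable_determined (dE r).
move=> i it /flattenP[_ /mapP[t' t'r ->] it']; apply: (sD t t') it it'.
by apply: contraNneq tr => ->.
Qed.

End coin_independence.

(** * The Bernoulli shift *)


(** Base 3 expansion is a measurable map [f] with a measurable left inverse [g]. Hence the image of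
    a measurable set is Borel: it consists of the [x] with [g x] in the set and [f (g x) = x]. *)
Lemma standard_coin (R : realType) (I : countType) : standard_probability (coin R I).
Proof.
have b3 : 2 <= 3 :> R by rewrite ler_nat.
pose c (y : bits I) k := if choice.unpickle k is Some i then y i else false.
pose f (y : bits I) : R := expansion 3 (c y).
have mf : measurable_fun setT f.
  apply: measurable_expansion => // k; rewrite /c; case: (choice.unpickle k) => [i|].
    exact: measurable_coordinate.
  by rewrite (_ : [set _ | _] = set0)//; apply/seteqP; split.
pose g (x : R) : bits I := fun i => digit 3 (choice.pickle i) x.
have mg : measurable_fun setT g by apply: measurable_to_bits => i; exact: measurable_digit.
have gK y : g (f y) = y.
  apply/funext => i; rewrite /g /f expansion_inj_digit// ?ltr_nat//.
  by rewrite /c choice.pickleK.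
exists (mfun_Sub (mem_set mf)), setT; split => //.
- exact: probability_setT.
- by move=> y y' _ _ /(congr1 g); rewrite !gK.
move=> A mA _; exists (g @^-1` A `&` [set x | f (g x) - x = 0]); split.
- apply: measurableI; first by rewrite -[X in measurable X]setTI; exact: mg.
  rewrite (_ : [set x | _] = (fun x => f (g x) - x) @^-1` [set 0])//.
  rewrite -[X in measurable X]setTI.
  have : measurable_fun setT (fun x => f (g x) - x).
    by apply: measurable_funB => //; exact: (measurableT_comp mf mg).
  by apply => //; exact: measurable_set1.
- move=> x [gA /eqP]; rewrite subr_eq0 => /eqP fgx; by exists (g x).
rewrite (_ : _ `\` _ = set0) ?measure0//.
apply/seteqP; split => // y [Ay]; apply; split => /=; first by rewrite gK.
by rewrite gK subrr.
Qed.

(** Time is two-sided while sequences are indexed by [nat]: even numbers code nonnegative times, odd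
    numbers negative ones. *)
Definition int_of_nat (n : nat) : int := if odd n then Negz n./2 else Posz n./2.
Definition nat_of_int (z : int) : nat :=
  match z with Posz m => m.*2 | Negz m => m.*2.+1 end.

Lemma int_of_natK : cancel int_of_nat nat_of_int.
Proof.
by move=> n; rewrite /int_of_nat; have := odd_double_half n; case: (odd n).
Qed.

Lemma nat_of_intK : cancel nat_of_int int_of_nat.
Proof.
case=> m; rewrite /int_of_nat/=; first by rewrite odd_double doubleK.
by rewrite odd_double/= uphalf_double.
Qed.

Definition translate (p : int) (n : nat) := nat_of_int (int_of_nat n + p).

Lemma translateD p q n : translate p (translate q n) = translate (p + q) n.
Proof. by rewrite /translate nat_of_intK -addrA [q + p]addrC. Qed.

Lemma translate0 n : translate 0 n = n.
Proof. by rewrite /translate addr0 int_of_natK. Qed.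

Lemma translateK p : cancel (translate p) (translate (- p)).
Proof. by move=> n; rewrite translateD addNr translate0. Qed.

Lemma translateVK p : cancel (translate (- p)) (translate p).
Proof. by move=> n; rewrite translateD addrN translate0. Qed.

(** Only the first index, the time, is moved; the second ranks the digits of the normal variable at
    that time. *)
Definition bit_shift (p : int) (y : bits (nat * nat)%type) : bits (nat * nat)%type :=
  y \o (fun i => (translate p i.1, i.2)).

Lemma bit_shiftD p q y : bit_shift p (bit_shift q y) = bit_shift (p + q) y.
Proof.
by apply/funext => i; rewrite /bit_shift /comp/= translateD addrC.
Qed.

Lemma bit_shift0 y : bit_shift 0 y = y.
Proof. by apply/funext => -[n k]; rewrite /bit_shift/= translate0. Qed.

Lemma bit_shiftK p : cancel (bit_shift p) (bit_shift (- p)).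
Proof. by move=> y; rewrite bit_shiftD addNr bit_shift0. Qed.

Lemma bit_shiftVK p : cancel (bit_shift (- p)) (bit_shift p).
Proof. by move=> y; rewrite bit_shiftD addrN bit_shift0. Qed.

Lemma measurable_bit_shift p : measurable_fun setT (bit_shift p).
Proof. exact: (measurable_reindex (fun i : nat * nat => (translate p i.1, i.2))). Qed.

Section coin_shift.
Variable R : realType.

Lemma bit_shift_preserving p (A : set (bits (nat * nat)%type)) : measurable A ->
  coin R _ (bit_shift p @^-1` A) = coin R _ A.
Proof.
apply: coin_reindex => -[n k] [n' k'] /= [/(congr1 (translate (- p)))].
by rewrite !translateK => -> ->.
Qed.

Definition coin_shift : automorphism (coin R (nat * nat)%type) :=
  Automorphism (bit_shiftK 1) (bit_shiftVK 1) (measurable_bit_shift 1) (measurable_bit_shift (- 1))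
    (@bit_shift_preserving 1).

Lemma aut_pow_coin_shift p y : aut_pow coin_shift p y = bit_shift p y.
Proof.
elim/int_rect: p => [|n IH|n IH]; first by rewrite bit_shift0.
  by rewrite intS addrC aut_powS IH [LHS]bit_shiftD addrC.
by rewrite intS opprD addrC aut_powB1 IH [LHS]bit_shiftD addrC.
Qed.

(** The last hypothesis says that the translates of [s] by distinct elements of [P] are disjoint.
    The law of the join is then a product law, whose entropy is additive. *)
Lemma coin_shift_join (K : finType) (l : bits (nat * nat)%type -> K) (s : seq (nat * nat))
    (P : {fset int}) :
  finite_label l -> (forall y y', {in s, y =1 y'} -> l y = l y') ->
  (forall p p', p \in P -> p' \in P -> p != p' ->
    forall i i', i \in s -> i' \in s -> int_of_nat i.1 - p != int_of_nat i'.1 - p') ->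
  label_entropy (coin R _) (join_label coin_shift P l) =
  (#|` P|)%:R * label_entropy (coin R _) l.
Proof.
move=> ml sl sP; rewrite cardfE.
rewrite -(@shannon_prod R P K (law (coin R _) l)); last 2 first.
- by move=> k; exact: law_ge0.
- exact: sum_law.
congr shannon; apply/funext => a.
pose E (p : P) : set (bits (nat * nat)%type) := [set y | l (bit_shift (- val p) y) = a p].
pose t (p : P) (i : nat * nat) := (translate (- val p) i.1, i.2).
have dE p : determined (map (t p) s) (E p).
  apply: (@determined_reindex _ _ (t p) s [set y | l y = a p]) => y y' yy' /= <-.
  by apply: sl => i si; rewrite yy'.
transitivity (fine (coin R _ [set y | forall p, p \in index_enum P -> E p y])).
  rewrite /law; congr (fine (coin R _ _)); apply/seteqP; split => y /=.
    move=> ya p _; have /ffunP/(_ p) : join_label coin_shift P l y = a := ya.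
    by rewrite ffunE aut_pow_coin_shift.
  move=> Ey; apply/ffunP => p; rewrite /join_label ffunE aut_pow_coin_shift.
  by apply: Ey; exact: mem_index_enum.
rewrite (@coin_independent_family _ _ _ _ (fun p => map (t p) s))//.
- apply: eq_bigr => p _; rewrite -(law_aut coin_shift (- val p) ml) /law.
  congr (fine (coin R _ _)); apply/seteqP.
  by split => y /=; rewrite /E/= aut_pow_coin_shift.
- exact: index_enum_uniq.
move=> p p' pp' i /mapP[u us ->] /mapP[u' us'] /(congr1 fst)/= tt'.
have := sP (val p) (val p') (valP p) (valP p') pp' _ _ us us'.
by move: tt' => /(congr1 int_of_nat); rewrite /translate !nat_of_intK => ->; rewrite eqxx.
Qed.

Lemma label_entropy_close d (T : measurableType d) (mu : probability T R)
    (K : finType) (l l' : T -> K) e :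
  finite_label l -> finite_label l' -> fine (mu [set x | l x != l' x]) <= e ->
  label_entropy mu l <= label_entropy mu l' + fano_bound K e.
Proof.
move=> ml ml' le; have := @label_entropy_join_close R d T mu unit K (fun=> l) (fun=> l') e
  (fun=> ml) (fun=> ml') (fun=> le).
rewrite card_unit mul1r.
have H f : finite_label f ->
    label_entropy mu (fun x => [ffun i : unit => f x]) = label_entropy mu f.
  move=> mf; apply: label_entropy_factor_eq => //; first exact: finite_label_ffun.
  move=> x y; split; first by move=> /ffunP/(_ tt); rewrite !ffunE.
  by move=> fxy; apply/ffunP => i; rewrite !ffunE.
by rewrite !H.
Qed.

(** The label is approximated by a cylinder label [l'] with Fano cost at most [h / 3]. This cost is
    paid twice, in comparing the entropies of [l] and [l'] and then those of their joins, which
    leaves [h / 3]. *)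
Lemma coin_shift_cpe (L : nat -> nat) : (forall j, (0 < j)%N -> (0 < L j)%N) ->
  completely_positive_P_entropy (progressions L) coin_shift.
Proof.
move=> L0 n xi /partition_labelP[l ml ->]; rewrite entropy_label => h0.
set h := label_entropy _ _ in h0; have h30 : 0 < h / 3 by rewrite divr_gt0.
have [r r0 fr] := fano_small 'I_n h30.
have bitsE (A : set (bits (nat * nat)%type)) : measurable A ->
    exists2 B : set (bits (nat * nat)%type), <<s cylinder [set: nat * nat] >> B &
    coin R _ (A `+` B) = 0%E.
  by rewrite bits_measurableE => mA; exists A => //; rewrite setYK measure0.
have [B [g [GB lB]]] :=
  @label_approx R _ _ (coin R (nat * nat)%type) _ (cylinder_algebra setT)
    (@measurable_cylinder _ _) bitsE _ l r ml r0.
have /choice[sB sBP] k : exists s, determined s (B k).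
  by have [s [_ ?]] := GB k; exists s.
pose s := flatten (map sB (enum 'I_n)).
pose l' y := g [ffun k => `[< B k y >]].
have ml' : finite_label l'.
  apply: (@finite_label_comp _ _ _ _ (fun y => [ffun k => `[< B k y >]]) g).
  apply: (@finite_label_ffun _ _ 'I_n bool (fun k y => `[< B k y >])) => k.
  by apply: finite_label_bool; exact: measurable_determined (sBP k).
have sl' y y' : {in s, y =1 y'} -> l' y = l' y'.
  move=> yy'; congr g; apply/ffunP => k; rewrite !ffunE; apply/asboolP/asboolP.
    apply: sBP => i si; apply: yy'; apply/flattenP; exists (sB k) => //.
    by rewrite map_f// mem_enum.
  apply: sBP => i si; rewrite yy'//; apply/flattenP; exists (sB k) => //.
  by rewrite map_f// mem_enum.
(* All times in [s] lie within [N] of 0, so translates by distinct multiples of [j] are disjoint as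
   soon as [j] exceeds [2 * N]. *)
pose N := \max_(i <- s) `|int_of_nat i.1|%N.
have sN i : i \in s -> (`|int_of_nat i.1| <= N)%N.
  by move=> si; rewrite /N (big_rem i si)/= leq_maxl.
have joinE j : (N.*2 < j)%N -> label_entropy (coin R _)
    (join_label coin_shift (progressions L j) l') = (L j)%:R * label_entropy (coin R _) l'.
  move=> jN; have j0 : (0 < j)%N by exact: leq_ltn_trans jN.
  rewrite (coin_shift_join ml' sl') ?card_progressions// => p p'.
  move=> /imfsetP[/= k _ ->] /imfsetP[/= k' _ ->] kk' i i' si si'.
  have /sN Ni := si; have /sN Ni' := si'.
  apply: contra kk' => /eqP e; apply/eqP.
  suff -> : k = k' by [].
  have [lt|lt|//] := ltngtP k k'; exfalso.
    have : ((k.+1 * j) <= k' * j)%N by rewrite leq_mul2r lt orbT.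
    rewrite mulSn; move: Ni Ni' e jN.
    by move: (k * j)%N (k' * j)%N (int_of_nat i.1) (int_of_nat i'.1) => a b u v; lia.
  have : ((k'.+1 * j) <= k * j)%N by rewrite leq_mul2r lt orbT.
  rewrite mulSn; move: Ni Ni' e jN.
  by move: (k * j)%N (k' * j)%N (int_of_nat i.1) (int_of_nat i'.1) => a b u v; lia.
apply: (@lt_le_trans _ _ (h / 3)%:E); first by rewrite lte_fin.
apply: limn_esup_ge; near=> j.
have jN : (N.*2 < j)%N by near: j; exact: nbhs_infty_gt.
have j0 : (0 < j)%N by exact: leq_ltn_trans jN.
have Lj0 : 0 < (L j)%:R :> R by rewrite ltr0n L0.
rewrite lee_fin P_entropy_at_label card_progressions// ler_pdivlMr//.
have lB' : fine (coin R (nat * nat)%type [set x | l' x != l x]) <= r.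
  by apply: le_trans lB; rewrite le_eqVlt; apply/orP; left; apply/eqP;
    congr (fine (coin R _ _)); apply/seteqP; split => x /=; rewrite eq_sym.
have h1 := label_entropy_close ml ml' lB.
have := @join_label_close _ _ _ (coin R _) coin_shift (progressions L j) _ _ _ r ml' ml lB'.
rewrite joinE// card_progressions// -lerBlDr -mulrBr; apply: le_trans.
rewrite mulrC (ler_wpM2l (ltW Lj0))//; move: h1; rewrite -/h.
set F := fano_bound _ r; have : F <= h / 3 := fr.
by move: (F) (label_entropy _ l') => F' e'; lra.
Unshelve. all: by end_near. Qed.

End coin_shift.

(** * Normal laws *)


Section density.
Variables (R : realType) (d : measure_display) (T : measurableType d).
Variables (mu nu : {measure set T -> \bar R}) (p : T -> R).
Hypothesis p0 : forall x, 0 <= p x.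
Hypothesis mp : measurable_fun setT p.
Hypothesis nuE : forall A, measurable A -> nu A = (\int[mu]_(x in A) (p x)%:E)%E.
Local Open Scope ereal_scope.

Import HBNNSimple.

Let mpE : measurable_fun setT (EFin \o p). Proof. exact/measurable_EFinP. Qed.

Let density_nnsfun (h : {nnsfun T >-> R}) :
  \int[nu]_x (h x)%:E = \int[mu]_x ((h x)%:E * (p x)%:E).
Proof.
under [LHS]eq_integral do rewrite fimfunE -fsumEFin//.
rewrite [LHS]ge0_integral_fsum//; last 2 first.
  - by move=> r; exact/measurable_EFinP/measurableT_comp.
  - by move=> n x _; rewrite EFinM nnfun_muleindic_ge0.
under [RHS]eq_integral.
  move=> x xD; rewrite fimfunE -fsumEFin// muleC ge0_mule_fsumr; last first.
    by move=> r; rewrite EFinM nnfun_muleindic_ge0.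
  over.
have mh r : measurable_fun setT (fun x => (p x)%:E * (r * \1_(h @^-1` [set r]) x)%:E).
  by apply: emeasurable_funM => //; exact/measurable_EFinP/measurableT_comp.
rewrite [RHS]ge0_integral_fsum//; last first.
  move=> n x _; apply: mule_ge0; first by rewrite lee_fin.
  by rewrite EFinM nnfun_muleindic_ge0.
apply: eq_fsbigr => r _; rewrite integralZl_indic_nnsfun// integral_indic// setIT.
rewrite nuE//; have [r0|r0] := ltP r 0%R.
  rewrite preimage_nnfun0// integral_set0 mule0; apply/esym.
  by apply: integral0_eq => x _; rewrite indic0/= mulr0 mule0.
rewrite integral_mkcond -ge0_integralZl//; last 2 first.
- by apply/measurable_restrict => //; rewrite setTI; exact: measurable_funTS.
- by move=> x _; rewrite patchE; case: ifP => // _; rewrite lee_fin.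
apply: eq_integral => x _; rewrite patchE indicE.
by case: ifP => _; rewrite ?mulr1 ?mulr0 ?mule0// muleC.
Qed.

(** Simple functions reduce to [nuE] on their level sets; monotone convergence does the rest. *)
Lemma ge0_integral_density (f : T -> \bar R) :
  measurable_fun setT f -> (forall x, 0 <= f x) ->
  \int[nu]_x f x = \int[mu]_x (f x * (p x)%:E).
Proof.
move=> mf f0; pose h := nnsfun_approx measurableT mf.
have hf x : EFin \o h^~ x @ \oo --> f x by exact: cvg_nnsfun_approx.
transitivity (limn (fun n => \int[nu]_x (h n x)%:E)).
  rewrite -monotone_convergence//=.
  - by apply: eq_integral => x _; apply/esym/cvg_lim => //; exact: hf.
  - by move=> n; exact/measurable_EFinP/measurable_funTS.
  - by move=> n x _; rewrite lee_fin.
  - by move=> x _ m n mn; rewrite lee_fin; exact/lefP/nd_nnsfun_approx.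
transitivity (limn (fun n => \int[mu]_x ((h n x)%:E * (p x)%:E))).
  by apply: congr_lim; apply/funext => n; exact: density_nnsfun.
rewrite -monotone_convergence//=.
- apply: eq_integral => x _; apply/cvg_lim => //.
  by apply: cvgeZr => //; exact: hf.
- move=> n; apply: emeasurable_funM => //.
  exact/measurable_EFinP/measurable_funTS.
- by move=> n x _; rewrite mule_ge0// lee_fin.
- move=> x _ m n mn; apply: lee_wpmul2r; first by rewrite lee_fin.
  by rewrite lee_fin; exact/lefP/nd_nnsfun_approx.
Qed.

End density.

Section lebesgue_affine.
Variable R : realType.
Notation lambda := (@lebesgue_measure R).
Implicit Types (t c : R).

Lemma measurable_affine t c :
  measurable_fun setT ((fun y => t + c * y) : R -> R).
Proof. by apply: measurable_funD => //; exact: measurable_funM. Qed.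

Lemma pushforward_measureP d d' (T : measurableType d) (T' : measurableType d')
    (mu : {measure set T -> \bar R}) (f : T -> T') : measurable_fun setT f ->
  exists nu : {measure set T' -> \bar R}, (nu : set T' -> \bar R) = pushforward mu f.
Proof. by move=> mf; unshelve eexists [the measure _ _ of pushforward mu f]. Qed.

(** The right side is a measure, so it is enough to check half-open intervals; a negative [c]
    exchanges their open and closed ends. *)
Lemma lebesgue_measure_affine t c (A : set R) : c != 0 -> measurable A ->
  lambda A = (`|c|%:E * lambda ((fun y => t + c * y)%R @^-1` A))%E.
Proof.
move=> c0 mA; have c0' : 0 < `|c| by rewrite normr_gt0.
pose r : {nonneg R} := NngNum (normr_ge0 c).
pose f : measurableTypeR R -> measurableTypeR R := fun y => t + c * y.
have mf : measurable_fun setT f by exact: measurable_affine.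
have [nu nuE] := pushforward_measureP lambda mf.
suff H : forall A, measurable A -> lambda A = mscale r nu A.
  by rewrite (H _ mA) /= /mscale nuE.
apply: lebesgue_measure_unique => _ [[a b] _ <-]; rewrite /= /mscale nuE /pushforward/=.
have [cp|cn] := ltP 0 c.
  rewrite (_ : f @^-1` _ = `](a - t) / c, (b - t) / c]%classic); last first.
    apply/seteqP; split => x /=; rewrite !in_itv/= /f;
      by rewrite ltr_pdivrMr// ler_pdivlMr// ltrBlDl lerBrDl [x * c]mulrC.
  rewrite !lebesgue_measure_itv/= !lte_fin ltr_pM2r ?invr_gt0// ltrD2r.
  case: ifPn => _; last by rewrite mule0.
  rewrite -!EFinD -EFinM; congr EFin.
  by rewrite gtr0_norm// -mulrBl mulrC divfK ?gt_eqF//; ring.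
have {cn} cn : c < 0 by rewrite lt_neqAle c0.
rewrite (_ : f @^-1` _ = `[(b - t) / c, (a - t) / c[%classic); last first.
  apply/seteqP; split => x /=; rewrite !in_itv/= /f;
    by rewrite ltr_ndivlMr// ler_ndivrMr// ltrBlDl lerBrDl [x * c]mulrC andbC.
rewrite !lebesgue_measure_itv/= !lte_fin ltr_nM2r ?invr_lt0// ltrD2r.
case: ifPn => _; last by rewrite mule0.
rewrite -!EFinD -EFinM; congr EFin.
by rewrite ltr0_norm// -mulrBl mulrC mulrN divfK ?lt_eqF//; ring.
Qed.

Lemma ge0_integral_affine t c (f : R -> \bar R) : c != 0 ->
  measurable_fun setT f -> (forall x, 0 <= f x)%E ->
  (\int[lambda]_x f x = `|c|%:E * \int[lambda]_y f (t + c * y)%R)%E.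
Proof.
move=> c0 mf f0; pose r : {nonneg R} := NngNum (normr_ge0 c).
pose g : measurableTypeR R -> measurableTypeR R := fun y => t + c * y.
have mg : measurable_fun setT g by exact: measurable_affine.
have [nu nuE] := pushforward_measureP lambda mg.
transitivity (\int[mscale r nu]_x f x)%E.
  apply: eq_measure_integral => A mA _; rewrite [LHS](lebesgue_measure_affine t c0)//.
  by rewrite /= /mscale nuE.
rewrite ge0_integral_mscale// nuE; congr (_ * _)%E.
by rewrite ge0_integral_pushforward// => y _; exact: f0.
Qed.

End lebesgue_affine.

Section normal.
Variable R : realType.
Notation lambda := (@lebesgue_measure R).
Implicit Types (t c m s x : R).

Lemma normal_pdf_neq0 m s x : s != 0 -> normal_pdf m s x = normal_peak s * normal_fun m s x.
Proof. by move=> s0; rewrite normal_pdfE. Qed.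

Lemma normal_pdf_affine t c m s x : c != 0 -> s != 0 ->
  `|c| * normal_pdf (t + c * m) (c * s) (t + c * x) = normal_pdf m s x.
Proof.
move=> c0 s0; rewrite !normal_pdf_neq0 ?mulf_neq0// mulrA; congr (_ * _).
  rewrite /normal_peak exprMn -mulrA -mulrnAr sqrtrM ?sqr_ge0// sqrtr_sqr.
  by rewrite invfM mulrA divff ?mul1r// normr_eq0.
rewrite /normal_fun; congr expR; field; rewrite c0 s0//.
Qed.

Lemma normal_prob_affine t c m s (A : set R) : c != 0 -> s != 0 -> measurable A ->
  normal_prob (t + c * m) (c * s) A = normal_prob m s ((fun y => t + c * y) @^-1` A).
Proof.
move=> c0 s0 mA; rewrite /normal_prob integral_mkcond [RHS]integral_mkcond.
have mA' : measurable ((fun y => t + c * y) @^-1` A).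
  by rewrite -[X in measurable X]setTI; exact: measurable_affine.
pose f x := ((fun x => (normal_pdf (t + c * m) (c * s) x)%:E) \_ A) x.
have mf : measurable_fun setT f.
  apply/(measurable_restrictT (fun x => (normal_pdf (t + c * m) (c * s) x)%:E)) => //.
  apply/measurable_EFinP/measurable_funTS; exact: measurable_normal_pdf.
have f0 x : (0 <= f x)%E.
  by rewrite /f patchE; case: ifP => // _; rewrite lee_fin normal_pdf_ge0.
rewrite (@ge0_integral_affine _ t c f)// -ge0_integralZl//; last first.
  exact: (measurableT_comp mf (measurable_affine t c)).
apply: eq_integral => x _; rewrite /f !patchE.
rewrite (_ : (x \in _) = (t + c * x \in A)); last by apply/idP/idP; rewrite !inE.
by case: ifP => _; rewrite ?mule0// -EFinM normal_pdf_affine.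
Qed.

(** A negative slope produces a negative scale parameter; only its square enters the density. *)
Lemma normal_pdfN m s : normal_pdf m (- s) = normal_pdf m s.
Proof. by apply/funext => x; rewrite /normal_pdf /normal_peak /normal_fun oppr_eq0 sqrrN. Qed.

(** Bayes' formula for normal laws: the joint density of [x] and of a sum [z] is the density of [z]
    times the conditional density of [x] given [z]. The latter integrates to 1 in [x]. *)
Lemma normal_pdf_complete_square (a b x z : R) : a != 0 -> b != 0 ->
  normal_pdf 0 a x * normal_pdf x b z =
  normal_pdf 0 (Num.sqrt (a ^+ 2 + b ^+ 2)) z *
  normal_pdf (z * a ^+ 2 / (a ^+ 2 + b ^+ 2)) (a * b / Num.sqrt (a ^+ 2 + b ^+ 2)) x.
Proof.
move=> a0 b0; have c0 : 0 < a ^+ 2 + b ^+ 2.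
  by rewrite ltr_pwDl// ?sqr_ge0// lt0r sqr_ge0 andbT sqrf_eq0.
set c := Num.sqrt _; have cp : 0 < c by rewrite sqrtr_gt0.
have cE : c ^+ 2 = a ^+ 2 + b ^+ 2 by rewrite sqr_sqrtr// ltW.
rewrite !normal_pdf_neq0 ?mulf_neq0 ?invr_eq0 ?(gt_eqF cp)//.
rewrite mulrACA [RHS]mulrACA; congr (_ * _).
  have p0 y : 0 <= y ^+ 2 * pi *+ 2 :> R by rewrite mulrn_wge0// mulr_ge0 ?sqr_ge0 ?pi_ge0.
  rewrite /normal_peak -!invfM -(sqrtrM _ (p0 a)) -(sqrtrM _ (p0 c)).
  by congr (Num.sqrt _)^-1; field; rewrite gt_eqF.
rewrite /normal_fun -!expRD; congr expR.
rewrite [(a * b / c) ^+ 2]exprMn exprVn cE; field.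
by rewrite a0 b0 gt_eqF.
Qed.

End normal.

Section independent_sum.
Variables (R : realType) (d : measure_display) (T : measurableType d).
Variable P : probability T R.
Notation lambda := (@lebesgue_measure R).

Lemma measurable_normal_pdf2 (b : R) : b != 0 ->
  measurable_fun setT (fun z : R * R => normal_pdf z.1 b z.2).
Proof.
move=> b0; under eq_fun do rewrite normal_pdf_neq0//.
apply: measurable_funM => //; apply: measurableT_comp => //.
by apply: measurable_funM => //; apply: measurableT_comp => //;
  apply: measurable_funX; apply: measurable_funB.
Qed.

(** Independence makes the joint law a product measure, whose sections are normal laws centered at
    [x]. Tonelli's theorem puts the integral over [x] inside, where completing the square removes
    it. *)
Lemma gaussian_independent_sum (X Y : T -> R) (a b : R) : a != 0 -> b != 0 ->
  measurable_fun setT X -> measurable_fun setT Y ->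
  (forall A, measurable A -> P (X @^-1` A) = normal_prob 0 a A) ->
  (forall A, measurable A -> P (Y @^-1` A) = normal_prob 0 b A) ->
  (forall A B, measurable A -> measurable B ->
    P (X @^-1` A `&` Y @^-1` B) = (P (X @^-1` A) * P (Y @^-1` B))%E) ->
  forall A, measurable A ->
    P ((fun w => X w + Y w) @^-1` A) = normal_prob 0 (Num.sqrt (a ^+ 2 + b ^+ 2)) A.
Proof.
move=> a0 b0 mX mY PX PY XY A mA; set c := Num.sqrt _.
have c0 : 0 < c.
  by rewrite sqrtr_gt0 ltr_pwDl// ?sqr_ge0// lt0r sqr_ge0 andbT sqrf_eq0.
have mXY : measurable_fun setT (fun w => (X w, Y w)) by exact: measurable_fun_pair.
have [nu nuE] := @pushforward_measureP R _ _ T (measurableTypeR R * measurableTypeR R)%type P _ mXY.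
pose S := [set z : R * R | A (z.1 + z.2)].
have mS : measurable S.
  rewrite (_ : S = (fun z => z.1 + z.2) @^-1` A)// -[X in measurable X]setTI.
  have : measurable_fun setT (fun z : R * R => z.1 + z.2) by exact: measurable_funD.
  exact.
transitivity (nu S); first by rewrite nuE.
have nuU := @product_measure_unique _ _ _ _ R
  [the probability _ _ of normal_prob 0 a] [the probability _ _ of normal_prob 0 b] nu.
rewrite -nuU//; last first.
  by move=> B C mB mC; rewrite nuE /pushforward/= -(PX _ mB) -(PY _ mC) -XY.
rewrite /product_measure1/=.
have xsE x : normal_prob 0 b (xsection S x) = normal_prob x b A.
  have := @normal_prob_affine R x 1 0 b A.
  rewrite mulr0 addr0 mul1r => ->//.
  congr (normal_prob _ _ _); apply/seteqP; split => y.
    by move/xsectionP; rewrite /S/= mul1r.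
  by move=> Ay; apply/xsectionP; move: Ay; rewrite /S/= mul1r.
pose f (z : R * R) : \bar R := (\1_A z.2 * (normal_pdf 0 a z.1 * normal_pdf z.1 b z.2))%:E.
have f0 z : (0 <= f z)%E by rewrite lee_fin !mulr_ge0 ?normal_pdf_ge0.
have mf : measurable_fun setT f.
  apply/measurable_EFinP; apply: measurable_funM.
    by apply: measurableT_comp => //; exact: measurable_indic.
  apply: measurable_funM; last exact: measurable_normal_pdf2.
  by apply: measurableT_comp => //; exact: measurable_normal_pdf.
have inE x : (\int[lambda]_z f (x, z) = normal_prob x b A * (normal_pdf 0 a x)%:E)%E.
  rewrite /normal_prob muleC -ge0_integralZl//; last 3 first.
  - apply/measurable_EFinP/measurable_funTS; exact: measurable_normal_pdf.
  - by move=> z _; rewrite lee_fin normal_pdf_ge0.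
  - by rewrite lee_fin normal_pdf_ge0.
  rewrite [RHS]integral_mkcond; apply: eq_integral => z _; rewrite patchE /f/= indicE.
  by case: ifP => _; rewrite ?mul1r ?mul0r ?mule0 ?EFinM.
rewrite (@ge0_integral_density _ _ _ lambda [the measure _ _ of normal_prob 0 a]
    (normal_pdf 0 a)); last 5 first.
- by move=> x; exact: normal_pdf_ge0.
- exact: measurable_normal_pdf.
- by [].
- exact: (measurable_fun_xsection [the probability _ _ of normal_prob 0 b] mS).
- by move=> x /=; exact: measure_ge0.
under eq_integral do rewrite /= xsE -inE.
transitivity (\int[lambda]_z \int[lambda]_x f (x, z))%E.
  exact: (@fubini_tonelli _ _ _ _ R lambda lambda f mf f0).
rewrite /normal_prob [RHS]integral_mkcond.
apply: eq_integral => z _; rewrite patchE /f/= indicE.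
case: ifP => _; last by apply: integral0_eq => x _; rewrite mul0r.
under eq_integral do rewrite mul1r normal_pdf_complete_square// EFinM.
rewrite ge0_integralZl//; last 3 first.
- apply/measurable_EFinP; exact: measurable_normal_pdf.
- by move=> x _; rewrite lee_fin normal_pdf_ge0.
- by rewrite lee_fin normal_pdf_ge0.
by rewrite integral_normal_pdf mule1.
Qed.

End independent_sum.

(** * The normal distribution function *)

Section real_laws.
Variable R : realType.

Lemma real_measure_unique (m1 m2 : {measure set (measurableTypeR R) -> \bar R}) :
  (m1 setT < +oo)%E -> m1 setT = m2 setT ->
  (forall x, m1 `]-oo, x[%classic = m2 `]-oo, x[%classic) ->
  forall A, measurable A -> m1 A = m2 A.
Proof.
move=> m1T m12T m12 A mA.
have E : @measurable _ (measurableTypeR R) = <<s @RGenInftyO.G R >>.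
  exact: RGenInftyO.measurableE.
have {}mA : <<s @RGenInftyO.G R >> A by rewrite -E.
pose G := [set B : set R | B = setT \/ exists x, B = `]-oo, x[%classic].
have GA : <<s G >> A.
  move: (A) mA; apply: smallest_sub; first exact: smallest_sigma_algebra.
  by move=> _ [x ->]; apply: sub_sigma_algebra; right; exists x.
apply: (@measure_unique_pi R _ (measurableTypeR R) G m1 m2 _ _ _ _ _ _ GA) => //.
- by move=> B [->|[x ->]]; [exact: measurableT|exact: measurable_itv].
- move=> B C [->|[x ->]]; first by rewrite setTI.
  move=> [->|[y ->]]; first by rewrite setIT; right; exists x.
  right; exists (Num.min x y); apply/seteqP; split => z /=; rewrite !in_itv/= lt_min.
    by move=> [-> ->].
  by move=> /andP[].
- by left.
- by move=> B [->|[x ->]].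
Qed.

(** Defined with the open ray, in accordance with the generators of the Borel sets used for
    uniqueness of laws. *)
Definition gauss_cdf (x : R) : R := fine (normal_prob 0 1 `]-oo, x[%classic).

Let mray (x : R) : measurable (`]-oo, x[%classic : set R).
Proof. exact: measurable_itv. Qed.

Lemma gauss_cdfE x : normal_prob 0 1 `]-oo, x[%classic = (gauss_cdf x)%:E.
Proof. by rewrite /gauss_cdf fineK// fin_num_measure. Qed.

Lemma gauss_cdfB x y : x <= y ->
  (gauss_cdf y - gauss_cdf x)%:E = normal_prob 0 1 `[x, y[%classic.
Proof.
move=> xy; have -> : `[x, y[%classic = `]-oo, y[%classic `\` `]-oo, x[%classic :> set R.
  apply/seteqP; split => z /=; rewrite !in_itv/=.
    by move=> /andP[xz ->]; split => //; apply/negP; rewrite -leNgt.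
  by move=> [-> /negP]; rewrite -leNgt => ->.
have := @measureD _ _ R [the probability _ _ of @normal_prob R 0 1] _ _ (mray y) (mray x).
rewrite /= => ->; last by rewrite gauss_cdfE ltry.
have -> : `]-oo, y[%classic `&` `]-oo, x[%classic = `]-oo, x[%classic :> set R.
  by apply/setIidr => z /=; rewrite !in_itv/= => /lt_le_trans; exact.
by rewrite !gauss_cdfE.
Qed.

Lemma gauss_cdf_lipschitz x y : x <= y ->
  gauss_cdf y - gauss_cdf x <= normal_peak 1 * (y - x).
Proof.
move=> xy; rewrite -lee_fin gauss_cdfB// /normal_prob.
have := @ge0_le_integral _ _ R lebesgue_measure `[x, y[%classic (measurable_itv _)
  (fun z => (normal_pdf 0 1 z)%:E) (cst (normal_peak 1)%:E).
rewrite integral_cst//= lebesgue_measure_itv/= lte_fin => h.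
have -> : (normal_peak 1 * (y - x))%:E =
    ((normal_peak 1)%:E * (if (x < y)%R then y%:E - x%:E else 0))%E.
  move: xy; rewrite le_eqVlt => /predU1P[->|->].
    by rewrite ltxx subrr mulr0 mule0.
  by rewrite EFinM EFinB.
apply: h.
- by move=> z _; rewrite lee_fin normal_pdf_ge0.
- by apply/measurable_EFinP/measurable_funTS; exact: measurable_normal_pdf.
- by [].
- by move=> z _; rewrite lee_fin; apply: normal_pdf_ub; exact: oner_neq0.
Qed.

Lemma gauss_cdf_lt x y : x < y -> gauss_cdf x < gauss_cdf y.
Proof.
move=> xy; rewrite -subr_gt0 -lte_fin gauss_cdfB ?ltW// /normal_prob.
(* [M] bounds the absolute value on the interval, so [k] is a positive lower bound for the density
   there. *)
set M := Num.max `|x| `|y|; set k := normal_peak 1 * expR (- M ^+ 2 / (1 ^+ 2 *+ 2)) : R.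
have k0 : 0 < k by rewrite mulr_gt0 ?expR_gt0// normal_peak_gt0 ?oner_neq0.
have := @ge0_le_integral _ _ R lebesgue_measure `[x, y[%classic (measurable_itv _)
  (cst k%:E) (fun z => (normal_pdf 0 1 z)%:E).
rewrite integral_cst//= lebesgue_measure_itv/= lte_fin xy -EFinB -EFinM => h.
apply: (@lt_le_trans _ _ (k * (y - x))%:E).
  by rewrite lte_fin mulr_gt0// subr_gt0.
apply: h => //.
- by move=> z _; rewrite lee_fin ltW.
- by apply/measurable_EFinP/measurable_funTS; exact: measurable_normal_pdf.
move=> z; rewrite /= in_itv/= lee_fin => /andP[xz zy].
rewrite normal_pdf_neq0 ?oner_neq0// /k ler_wpM2l ?normal_peak_ge0//.
have zM : `|z| <= M.
  rewrite le_max !ler_normr; have [z0|z0] := leP 0 z.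
    by apply/orP; right; rewrite ger0_norm// (le_trans (ltW zy)) ?lexx.
  by apply/orP; left; rewrite ltr0_norm// lerN2 xz orbT.
rewrite /normal_fun ler_expR ler_pM2r// lerN2 subr0 -[leLHS]real_normK ?num_real//.
by rewrite lerXn2r// nnegrE (le_trans _ zM).
Qed.

Lemma continuous_gauss_cdf : continuous gauss_cdf.
Proof.
move=> x; apply/cvgrPdist_le => e e0.
have p0 : 0 < normal_peak 1 :> R by rewrite normal_peak_gt0 ?oner_neq0.
near=> y.
have yx : `|x - y| <= e / normal_peak 1.
  by near: y; apply: cvgr_dist_le => //; rewrite divr_gt0.
apply: (@le_trans _ _ (normal_peak 1 * `|x - y|)); last by rewrite mulrC -ler_pdivlMr.
have H a b : a <= b -> `|gauss_cdf b - gauss_cdf a| <= normal_peak 1 * `|b - a|.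
  move=> ab; rewrite ger0_norm ?ger0_norm ?subr_ge0//; first exact: gauss_cdf_lipschitz.
  by move: ab; rewrite le_eqVlt => /predU1P[->//|/gauss_cdf_lt/ltW].
have [xy|/ltW xy] := leP x y; last exact: H.
by rewrite distrC (distrC x); exact: H.
Unshelve. all: by end_near. Qed.

Lemma gauss_cdf_cvg1 : gauss_cdf n%:R @[n --> \oo] --> (1 : R).
Proof.
have := @nondecreasing_cvg_mu _ _ R [the measure _ _ of @normal_prob R 0 1]
  (fun n => `]-oo, n%:R[%classic) (fun n => mray _).
have -> : \bigcup_n `]-oo, n%:R[%classic = setT :> set R.
  apply/seteqP; split => // x _; exists (Num.trunc `|x|).+1 => //=.
  by rewrite in_itv/= (le_lt_trans (ler_norm x))// truncnS_gt.
move=> /(_ measurableT) h; have /fine_cvg : (fun n => (gauss_cdf n%:R)%:E) @ \oo --> 1%:E.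
  under eq_fun do rewrite -gauss_cdfE.
  rewrite -(@probability_setT _ _ _ [the probability _ _ of @normal_prob R 0 1]).
  apply: h => m n mn; apply/subsetPset => x /=; rewrite !in_itv/= => /lt_le_trans; apply.
  by rewrite ler_nat.
exact.
Qed.

Lemma gauss_cdf_cvg0 : gauss_cdf (- n%:R) @[n --> \oo] --> (0 : R).
Proof.
have := @nonincreasing_cvg_mu _ _ R [the measure _ _ of @normal_prob R 0 1]
  (fun n => `]-oo, (- n%:R)[%classic).
have -> : \bigcap_n `]-oo, (- n%:R)[%classic = set0 :> set R.
  apply/seteqP; split => // x /(_ (Num.trunc `|x|).+1 I)/=.
  rewrite in_itv/= ltrNr => h; have := lt_trans (truncnS_gt `|x|) h.
  by rewrite ltNge -normrN ler_norm.
move=> h; have /fine_cvg : (fun n => (gauss_cdf (- n%:R))%:E) @ \oo --> 0%:E.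
  under eq_fun do rewrite -gauss_cdfE.
  have -> : (0%:E : \bar R) = normal_prob 0 1 set0 by rewrite measure0.
  apply: h => //.
  - exact: le_lt_trans (probability_le1 [the probability _ _ of @normal_prob R 0 1] (mray _)) (ltry 1).
  - move=> m n mn; apply/subsetPset => x /=; rewrite !in_itv/= => /lt_le_trans; apply.
    by rewrite lerN2 ler_nat.
exact.
Qed.

Lemma gauss_cdf_surj u : 0 < u < 1 -> exists x, gauss_cdf x = u.
Proof.
move=> /andP[u0 u1].
have [n [n1 n2]] : exists n, gauss_cdf (- n%:R) < u /\ u < gauss_cdf n%:R.
  near \oo => n; exists n; split.
    by near: n; exact: (cvgr_lt 0 gauss_cdf_cvg0).
  by near: n; exact: (cvgr_gt 1 gauss_cdf_cvg1).
have nn : - n%:R <= n%:R :> R by rewrite (@le_trans _ _ 0)// oppr_le0.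
have cn : {within `[- n%:R, n%:R], continuous gauss_cdf}.
  by apply: continuous_subspaceT => x; exact: continuous_gauss_cdf.
have [|x _ <-] := IVT nn cn (v := u); last by exists x.
by rewrite ge_min le_max (ltW n1) (ltW n2) orbT.
Unshelve. all: by end_near. Qed.

Lemma gauss_cdf_bounds x : 0 < gauss_cdf x < 1.
Proof.
have ge0 z : 0 <= gauss_cdf z by exact: fine_ge0.
have le1 z : gauss_cdf z <= 1.
  by rewrite -lee_fin -gauss_cdfE; exact: probability_le1.
apply/andP; split.
  by apply: (le_lt_trans (ge0 (x - 1))); apply: gauss_cdf_lt; rewrite gtrBl.
by apply: (lt_le_trans _ (le1 (x + 1))); apply: gauss_cdf_lt; rewrite ltrDl.
Qed.

End real_laws.

(** * Normal variables coded by coins *)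


Lemma measure_eq_off (R : realType) d (T : measurableType d)
    (mu : {measure set T -> \bar R}) (A B N : set T) :
  measurable A -> measurable B -> measurable N -> mu N = 0%E ->
  (forall x, ~ N x -> A x <-> B x) -> mu A = mu B.
Proof.
suff H C D : measurable C -> measurable D -> measurable N -> mu N = 0%E ->
    (forall x, ~ N x -> C x -> D x) -> (mu C <= mu D)%E.
  by move=> mA mB mN N0 AB; apply/eqP; rewrite eq_le !H// => x /AB[].
move=> mC mD mN N0 CD; rewrite -(measureU0 mD mN N0).
apply: le_measure; rewrite ?inE//; first exact: measurableU.
by move=> x Cx; have [Nx|Nx] := pselect (N x); [right|left; exact: CD].
Qed.

Section quantile.
Variable R : realType.
Implicit Types u x : R.

(** The inverse of [gauss_cdf] on []0, 1[], with default value 0 elsewhere. *)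
Definition quantile u : R :=
  if pselect (exists x, gauss_cdf x = u) is left e then projT1 (cid e) else 0.

Lemma gauss_cdf_quantile u : 0 < u < 1 -> gauss_cdf (quantile u) = u.
Proof.
move=> /gauss_cdf_surj e; rewrite /quantile; case: pselect => // e'.
by case: cid.
Qed.

Lemma quantile_out u : ~ (0 < u < 1) -> quantile u = 0.
Proof.
move=> u01; rewrite /quantile; case: pselect => // -[x xu].
by case: u01; rewrite -xu; exact: gauss_cdf_bounds.
Qed.

Lemma quantile_lt u x : 0 < u < 1 -> (quantile u < x) = (u < gauss_cdf x).
Proof.
move=> u01; have mono : {mono (@gauss_cdf R) : x y / x < y}.
  by apply: leW_mono; apply: le_mono => y z; exact: gauss_cdf_lt.
by rewrite -mono gauss_cdf_quantile.
Qed.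

Lemma measurable_quantile : measurable_fun setT quantile.
Proof.
apply: (measurability _ (RGenInftyO.measurableE R)) => //.
move=> _ [_ [x ->] <-]; rewrite setTI.
have -> : quantile @^-1` `]-oo, x[%classic =
    (`]0, 1[%classic `&` `]-oo, gauss_cdf x[%classic) `|`
    (~` `]0, 1[%classic `&` [set _ | 0 < x]).
  apply/seteqP; split => u /=; rewrite !in_itv/=.
    have [u01|u01] := pselect (0 < u < 1); first by rewrite quantile_lt//; left.
    by rewrite (quantile_out u01) => ?; right.
  move=> [[u01]|[u01]]; first by rewrite quantile_lt.
  by rewrite (quantile_out u01).
apply: measurableU; apply: measurableI; try exact: measurable_itv.
  by apply: measurableC; exact: measurable_itv.
have [x0|x0] := pselect (0 < x).
  by rewrite (_ : [set _ | _] = setT)//; apply/seteqP; split.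
by rewrite (_ : [set _ | _] = set0)//; apply/seteqP; split.
Qed.

Lemma unif01_interior : unif01 R (~` `]0, 1[%classic) = 0%E.
Proof.
have m01 : measurable (`]0, 1[%classic : set R) by exact: measurable_itv.
rewrite probability_setC// (_ : unif01 R _ = 1%E) ?subee//.
rewrite -[RHS](_ : unif01 R `[0, 1[%classic = 1%E); last by rewrite unif01_itv// subr0.
rewrite (_ : `[0, 1[%classic = `]0, 1[%classic `|` [set 0]); last first.
  apply/seteqP; split => x /=; rewrite !in_itv/=.
    by rewrite le_eqVlt => /andP[/predU1P[<-|-> ->]]; [right|left].
  by move=> [/andP[/ltW -> ->]//|->]; rewrite lexx ltr01.
have /null_content_dominatesP h := dominates_uniform_prob (@ltr01 R).
by rewrite measureU0//; exact: (h _ (measurable_set1 0) (lebesgue_measure_set1 0)).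
Qed.

(** Inverse transform sampling: [quantile u < x] amounts to [u < gauss_cdf x] on []0, 1[], an event
    of uniform mass [gauss_cdf x]. *)
Lemma quantile_law (A : set R) : measurable A ->
  unif01 R (quantile @^-1` A) = normal_prob 0 1 A.
Proof.
have [nu nuE] := @pushforward_measureP R _ _ _ (measurableTypeR R) (unif01 R) _ measurable_quantile.
move=> mA; transitivity (nu A); first by rewrite nuE.
apply: (@real_measure_unique R nu [the measure _ _ of normal_prob 0 1]) => //.
- by rewrite nuE; exact: le_lt_trans (probability_le1 (unif01 R) measurableT) (ltry 1).
- transitivity (1%E : \bar R); last exact/esym/(@probability_setT _ _ _ [the probability _ _ of normal_prob 0 1]).
  by rewrite nuE; exact: (@probability_setT _ _ _ (unif01 R)).
move=> x; rewrite nuE /pushforward/=.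
have /andP[p0 p1] := gauss_cdf_bounds x.
have <- : unif01 R `[0, gauss_cdf x[%classic = normal_prob 0 1 `]-oo, x[%classic.
  by rewrite unif01_itv ?subr0 ?gauss_cdfE// ltW.
apply: measure_eq_off unif01_interior _ => //.
- rewrite -[X in measurable X]setTI; exact: measurable_quantile.
- by apply: measurableC; exact: measurable_itv.
move=> u /= /contrapT; rewrite !in_itv/= => u01.
by rewrite quantile_lt//; case/andP: u01 => /ltW -> _.
Qed.

End quantile.

Section second_moment.
Variable R : realType.

Definition second_moment : R := fine (\int[normal_prob 0 1]_x (x ^+ 2)%:E)%E.

Let msqr : measurable_fun setT (fun x : R => (x ^+ 2)%:E).
Proof. by apply/measurable_EFinP; exact: measurable_funX. Qed.

(** From [x ^+ 2 <= 4 * expR (x ^+ 2 / 4)], the integrand is at most [C] times the normal density of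
    variance 2. *)
Lemma second_moment_lty : (\int[normal_prob 0 1]_x ((x : R) ^+ 2)%:E < +oo)%E.
Proof.
rewrite (@ge0_integral_density _ _ _ lebesgue_measure [the measure _ _ of normal_prob 0 1]
    (normal_pdf 0 1)); last 5 first.
- by move=> x; exact: normal_pdf_ge0.
- exact: measurable_normal_pdf.
- by [].
- exact: msqr.
- by move=> x; rewrite lee_fin sqr_ge0.
have s2 : Num.sqrt 2 != 0 :> R by rewrite gt_eqF// sqrtr_gt0.
have p2 : 0 < normal_peak (Num.sqrt 2 : R) by exact: normal_peak_gt0.
pose C : R := 4 * normal_peak 1 / normal_peak (Num.sqrt 2).
have C0 : 0 <= C by rewrite divr_ge0 ?mulr_ge0 ?normal_peak_ge0.
apply: (@le_lt_trans _ _ (\int[lebesgue_measure]_x (C%:E * (normal_pdf 0 (Num.sqrt 2) x)%:E))%E).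
  apply: ge0_le_integral => //.
  - by move=> x _; rewrite lee_fin mulr_ge0 ?sqr_ge0 ?normal_pdf_ge0.
  - apply: emeasurable_funM => //; apply/measurable_EFinP; exact: measurable_normal_pdf.
  - apply: emeasurable_funM => //; apply/measurable_EFinP; exact: measurable_normal_pdf.
  move=> x _; rewrite -!EFinM lee_fin !normal_pdf_neq0 ?oner_neq0//.
  rewrite (_ : C * _ = normal_peak 1 * (4 * normal_fun 0 (Num.sqrt 2) x)); last first.
    by rewrite /C; field; rewrite gt_eqF.
  rewrite mulrCA ler_wpM2l ?normal_peak_ge0//.
  rewrite /normal_fun subr0 sqr_sqrtr// expr1n.
  have -> : - x ^+ 2 / (1 *+ 2) = - (x ^+ 2 / 4) + - x ^+ 2 / (2 *+ 2).
    by rewrite !mulr2n; field.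
  rewrite expRD mulrA ler_wpM2r ?expR_ge0// expRN ler_pdivrMr ?expR_gt0//.
  have := expR_ge1Dx (x ^+ 2 / 4); lra.
rewrite ge0_integralZl//; last 2 first.
- apply/measurable_EFinP; exact: measurable_normal_pdf.
- by move=> x _; rewrite lee_fin normal_pdf_ge0.
by rewrite integral_normal_pdf mule1 ltry.
Qed.

Lemma second_momentE : (\int[normal_prob 0 1]_x ((x : R) ^+ 2)%:E = second_moment%:E)%E.
Proof.
rewrite /second_moment fineK// ge0_fin_numE ?second_moment_lty//.
by apply: integral_ge0 => x _; rewrite lee_fin sqr_ge0.
Qed.

(** A zero second moment would concentrate the law at 0, which it does not charge. *)
Lemma second_moment_gt0 : 0 < second_moment.
Proof.
rewrite -lte_fin -second_momentE lt0e; apply/andP; split; last first.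
  by apply: integral_ge0 => x _; rewrite lee_fin sqr_ge0.
apply/negP => /eqP i0.
have := @ae_eq_integral_abs _ _ R [the measure _ _ of normal_prob 0 1] setT measurableT
  (fun x => (x ^+ 2)%:E) msqr.
move=> [+ _]; rewrite -{1}i0.
have -> : (\int[normal_prob 0 1]_x `|((x : R) ^+ 2)%:E| =
    \int[normal_prob 0 1]_x (x ^+ 2)%:E)%E.
  by apply: eq_integral => x _; rewrite gee0_abs// lee_fin sqr_ge0.
move=> /(_ erefl) [N [mN N0 sN]].
have : normal_prob 0 1 (~` [set (0 : R)]) = 0%E.
  apply: subset_measure0 N0 => //; first by apply: measurableC; exact: measurable_set1.
  move=> x /= x0; apply: sN => /= /(_ I) []; move/eqP.
  by rewrite sqrf_eq0 => /eqP.
have -> : normal_prob 0 1 (~` [set (0 : R)]) = (1 - normal_prob 0%R 1%R [set (0%R : R)])%E.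
  exact: (@probability_setC _ _ _ [the probability _ _ of normal_prob 0 1]).
have -> : normal_prob 0 1 [set (0 : R)] = 0%E.
  have /null_content_dominatesP h := @normal_prob_dominates R 0 1.
  exact: (h _ (measurable_set1 0) (lebesgue_measure_set1 0)).
by rewrite sube0 => /eqP; rewrite onee_eq0.
Qed.

(* Normalizes the variance to 1 without evaluating that of [normal_prob 0 1]. *)
Definition unit_scale : R := (Num.sqrt second_moment)^-1.

Lemma unit_scale_gt0 : 0 < unit_scale.
Proof. by rewrite invr_gt0 sqrtr_gt0 second_moment_gt0. Qed.

Lemma normal_second_moment (s : R) : s != 0 ->
  (\int[normal_prob 0 (s * unit_scale)]_x (x ^+ 2)%:E = (s ^+ 2)%:E)%E.
Proof.
move=> s0; set c := s * unit_scale.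
have c0 : c != 0 by rewrite mulf_neq0// gt_eqF// unit_scale_gt0.
pose g : measurableTypeR R -> measurableTypeR R := fun y => 0 + c * y.
have mg : measurable_fun setT g by exact: measurable_affine.
have [nu nuE] := pushforward_measureP [the measure _ _ of normal_prob 0 1] mg.
pose f (x : R) : \bar R := (x ^+ 2)%:E.
transitivity (\int[nu]_x f x)%E.
  apply: eq_measure_integral => A mA _; rewrite nuE /pushforward/= -normal_prob_affine ?oner_neq0//.
  by rewrite mulr0 addr0 mulr1.
rewrite nuE ge0_integral_pushforward//; last first.
  by move=> x _; rewrite lee_fin sqr_ge0.
rewrite preimage_setT /=.
under eq_integral do rewrite /f /g add0r exprMn EFinM.
rewrite ge0_integralZl//; last 2 first.
- by move=> x _; rewrite lee_fin sqr_ge0.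
- by rewrite lee_fin sqr_ge0.
rewrite second_momentE -EFinM /c /unit_scale exprMn exprVn sqr_sqrtr ?ltW ?second_moment_gt0//.
by rewrite divfK// gt_eqF// second_moment_gt0.
Qed.

End second_moment.

Section coordinates.
Variable R : realType.
Notation bits2 := (bits (nat * nat)%type).
Notation P := (coin R (nat * nat)%type).

(** Row [n] of the coins supplies the binary digits of a uniform variable, which the quantile
    function turns into a normal one. *)
Definition uniform_coordinate (n : nat) (y : bits2) : R := expansion 2 (fun k => y (n, k)).
Definition gauss_coordinate (n : nat) (y : bits2) : R :=
  unit_scale R * quantile (uniform_coordinate n y).

Lemma measurable_uniform_coordinate n : measurable_fun setT (uniform_coordinate n).
Proof. by apply: measurable_expansion => // k; exact: measurable_coordinate. Qed.

Lemma measurable_gauss_coordinate n : measurable_fun setT (gauss_coordinate n).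
Proof.
apply: measurable_funM => //.
exact: (measurableT_comp (@measurable_quantile R) (measurable_uniform_coordinate n)).
Qed.

Lemma coin_section n (E : set (bits nat)) : measurable E ->
  P [set y | E (fun k => y (n, k))] = unif01 R (@coin_map R nat @^-1` E).
Proof.
move=> mE; rewrite -coinE.
by apply: (@coin_reindex R (nat * nat)%type nat (fun k => (n, k)) E) => // k k' [].
Qed.

Lemma uniform_coordinate_law n (A : set R) : measurable A ->
  P (uniform_coordinate n @^-1` A) = unif01 R A.
Proof.
move=> mA; have mexp : measurable_fun setT (fun c : bits nat => expansion (2 : R) c).
  by apply: measurable_expansion => // k; exact: measurable_coordinate.
rewrite (@coin_section n [set c | A (expansion 2 c)]); last first.
  by rewrite -[X in measurable X]setTI; exact: mexp.
apply: measure_eq_off (unif01_interior R) _ => //.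
- rewrite -[X in measurable X]setTI; apply: (measurableT_comp mexp) => //.
  exact: measurable_coin_map.
- by apply: measurableC; exact: measurable_itv.
move=> x /= /contrapT; rewrite in_itv/= => /andP[x0 x1].
by rewrite /coin_map expansion_binary_digits// x1 ltW.
Qed.

Lemma gauss_coordinate_law n (A : set R) : measurable A ->
  P (gauss_coordinate n @^-1` A) = normal_prob 0 (unit_scale R) A.
Proof.
move=> mA; have := @normal_prob_affine R 0 (unit_scale R) 0 1 A.
rewrite mulr0 addr0 mulr1 => ->//; last by rewrite gt_eqF// unit_scale_gt0.
have mA' : measurable ((fun y => 0 + unit_scale R * y) @^-1` A).
  by rewrite -[X in measurable X]setTI; exact: measurable_affine.
rewrite -quantile_law// -(uniform_coordinate_law n).
  by congr (P _); apply/seteqP; split => y; rewrite /= add0r.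
by rewrite -[X in measurable X]setTI; exact: measurable_quantile.
Qed.

(** The distribution function undoes the quantile, and taking binary digits undoes the expansion.
    This fails only if the uniform variable leaves []0, 1[] or the row is not the digit sequence of
    its own sum, both null events. It is what makes the normal variables generate the
    sigma-algebra. *)
Lemma gauss_coordinate_decode n : {ae P, forall y, forall k,
  digit 2 k (gauss_cdf (gauss_coordinate n y / unit_scale R)) = y (n, k)}.
Proof.
pose D := [set c : bits nat | forall k, digit 2 k (expansion (2 : R) c) = c k].
pose U : set R := ~` `]0, 1[%classic.
have mexp : measurable_fun setT (fun c : bits nat => expansion (2 : R) c).
  by apply: measurable_expansion => // k; exact: measurable_coordinate.
have mD : measurable (~` D).
  apply: measurableC; rewrite (_ : D = \bigcap_k [set c | digit 2 k (expansion (2 : R) c) = c k]).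
    apply: bigcap_measurableType => k _.
    rewrite (_ : [set c | _] =
      (fun c : bits nat => (digit 2 k (expansion (2 : R) c), c k)) @^-1`
        [set z | z.1 == z.2]).
      apply: finite_label_preimage; apply: finite_label_pair.
        rewrite (_ : (fun c : bits nat => _) =
            fun c => `[< [set c : bits nat | digit 2 k (expansion (2 : R) c)] c >]).
          apply: finite_label_bool; rewrite -[X in measurable X]setTI.
          by apply: (mexp measurableT [set x | digit 2 k x]); exact: measurable_digit.
        by apply/funext => c; apply/idP/asboolP.
      rewrite (_ : (fun c : bits nat => _) = fun c => `[< [set c : bits nat | c k] c >]).
        by apply: finite_label_bool; exact: measurable_coordinate.
      by apply/funext => c; apply/idP/asboolP.
    by apply/seteqP; split => c /= /eqP.
  by apply/seteqP; split => c /=; [move=> cD k _|move=> cD k]; exact: cD.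
have mU : measurable U by apply: measurableC; exact: measurable_itv.
exists ([set y | (~` D) (fun k => y (n, k))] `|` uniform_coordinate n @^-1` U); split.
- apply: measurableU.
    have := @measurable_reindex (nat * nat)%type nat (fun k => (n, k)) measurableT _ mD.
    by rewrite setTI.
  by rewrite -[X in measurable X]setTI; exact: measurable_uniform_coordinate.
- rewrite measureU0//.
  + rewrite [LHS](coin_section n mD); apply: subset_measure0 (unif01_interior R).
    * by rewrite -[X in measurable X]setTI; exact: measurable_coin_map.
    * by apply: measurableC; exact: measurable_itv.
    move=> x /= nD; rewrite in_itv/= => /andP[x0 x1]; apply: nD => k.
    by rewrite /coin_map expansion_binary_digits// x1 ltW.
  + have := @measurable_reindex (nat * nat)%type nat (fun k => (n, k)) measurableT _ mD.
    by rewrite setTI.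
  + by rewrite -[X in measurable X]setTI; exact: measurable_uniform_coordinate.
  + by rewrite [LHS](uniform_coordinate_law n mU) unif01_interior.
move=> y /= /existsNP[k yk]; apply: contrapT => /not_orP[/contrapT yD].
rewrite /U/= => /contrapT; rewrite in_itv/= => y01; apply: yk.
rewrite /gauss_coordinate mulrC mulKf ?gt_eqF ?unit_scale_gt0// gauss_cdf_quantile//.
Qed.

End coordinates.

(** * Gaussian sums *)


Section square_integral.
Variables (R : realType) (d : measure_display) (T : measurableType d).
Variable P : probability T R.
Implicit Types (f g : T -> R).

Definition sqint f : \bar R := (\int[P]_x ((f x) ^+ 2)%:E)%E.

Lemma measurable_sqr f : measurable_fun setT f ->
  measurable_fun setT (fun x => ((f x) ^+ 2)%:E).
Proof. by move=> mf; apply/measurable_EFinP; exact: measurable_funX. Qed.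

Lemma sqint_ge0 f : (0 <= sqint f)%E.
Proof. by apply: integral_ge0 => x _; rewrite lee_fin sqr_ge0. Qed.

Lemma sqintD_le f g : measurable_fun setT f -> measurable_fun setT g ->
  (sqint (fun x => f x + g x)%R <= 2%:E * sqint f + 2%:E * sqint g)%E.
Proof.
move=> mf mg; rewrite /sqint -!ge0_integralZl//; try exact: measurable_sqr;
  try by move=> x _; rewrite lee_fin sqr_ge0.
rewrite -ge0_integralD//; last first.
- by apply: measurable_funeM; exact: measurable_sqr.
- by move=> x _; rewrite mule_ge0// lee_fin sqr_ge0.
- by apply: measurable_funeM; exact: measurable_sqr.
- by move=> x _; rewrite mule_ge0// lee_fin sqr_ge0.
apply: ge0_le_integral => //.
- by move=> x _; rewrite lee_fin sqr_ge0.
- by apply: measurable_sqr; exact: measurable_funD.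
- by apply: emeasurable_funD; apply: measurable_funeM; exact: measurable_sqr.
move=> x _; rewrite -!EFinM -EFinD lee_fin.
have := sqr_ge0 (f x - g x); rewrite sqrrB sqrrD; lra.
Qed.

Lemma sqintZ c f : measurable_fun setT f ->
  sqint (fun x => c * f x)%R = ((c ^+ 2)%:E * sqint f)%E.
Proof.
move=> mf; rewrite /sqint -ge0_integralZl//.
- by apply: eq_integral => x _; rewrite exprMn EFinM.
- exact: measurable_sqr.
- by move=> x _; rewrite lee_fin sqr_ge0.
- by rewrite lee_fin sqr_ge0.
Qed.

Lemma sqint_eq0 f : measurable_fun setT f -> sqint f = 0%E -> f = cst 0 %[ae P].
Proof.
move=> mf f0; have [+ _] := @ae_eq_integral_abs _ _ R P setT measurableT
  (fun x => ((f x) ^+ 2)%:E) (measurable_sqr mf).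
have -> : (\int[P]_x `|((f x) ^+ 2)%:E| = 0)%E.
  by rewrite -f0; apply: eq_integral => x _; rewrite gee0_abs// lee_fin sqr_ge0.
move=> /(_ erefl); apply: filterS => x /(_ I)/= [/eqP]; rewrite sqrf_eq0 => /eqP fx _.
exact: fx.
Qed.

Lemma measurable_gt_norm f e : measurable_fun setT f -> measurable [set x | (e < `|f x|)%R].
Proof.
move=> mf; rewrite (_ : [set x | _] = (fun x => `|f x|) @^-1` `]e, +oo[%classic).
  rewrite -[X in measurable X]setTI.
  have : measurable_fun setT (fun x => `|f x|) by exact: measurableT_comp.
  by apply => //; exact: measurable_itv.
by apply/seteqP; split => x /=; rewrite in_itv/= andbT.
Qed.

Lemma sqint_chebyshev f e : measurable_fun setT f -> 0 < e ->
  ((e ^+ 2)%:E * P [set x | (e < `|f x|)%R] <= sqint f)%E.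
Proof.
move=> mf e0; have mE := measurable_gt_norm e mf.
have <- : (\int[P]_(x in [set x | (e < `|f x|)%R]) (e ^+ 2)%:E =
    (e ^+ 2)%:E * P [set x | (e < `|f x|)%R])%E by rewrite integral_cst.
apply: (@le_trans _ _ (\int[P]_(x in [set x | (e < `|f x|)%R]) ((f x) ^+ 2)%:E)%E).
  apply: ge0_le_integral => //.
  - by move=> x _; rewrite lee_fin sqr_ge0.
  - by apply: measurable_funTS; exact: measurable_sqr.
  move=> x /= /ltW ex; rewrite lee_fin -[leRHS]real_normK ?num_real//.
  by rewrite lerXn2r// nnegrE ltW.
apply: ge0_subset_integral => //; first exact: measurable_sqr.
by move=> x _; rewrite lee_fin sqr_ge0.
Qed.

(* Along a subsequence convergence holds almost everywhere, by Borel-Cantelli;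
   Fatou's lemma transfers the bound to the limit. *)
Lemma sqint_complete (S : nat -> T -> R) (r : nat -> R) :
  (forall n, measurable_fun setT (S n)) ->
  (forall m n, (m <= n)%N -> (sqint (fun x => S n x - S m x)%R <= (r m)%:E)%E) ->
  r n @[n --> \oo] --> 0 ->
  exists2 W : T -> R, measurable_fun setT W & forall n, (sqint (fun x => W x - S n x)%R <= (r n)%:E)%E.
Proof.
move=> mS rS r0.
(* With [r <= 8 ^- i], Chebyshev's inequality at level [2 ^- i] leaves probability at most
   [4 ^ i / 8 ^ i = 2 ^- i], which is summable. *)
have /choice[nn nnP] i : exists n, (i <= n)%N /\ forall m, (n <= m)%N -> r m <= (8 ^+ i)^-1.
  have i0 : 0 < (8 ^+ i)^-1 :> R by rewrite invr_gt0 exprn_gt0.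
  near \oo => n; exists n; split; first by near: n; exact: nbhs_infty_ge.
  near: n; have /cvgrPdist_le/(_ _ i0)[N _ NP] := r0.
  exists N => // n /= Nn m nm; have := NP m (leq_trans Nn nm).
  by rewrite sub0r normrN; apply: le_trans; exact: ler_norm.
have nnI i : (i <= nn i)%N by case: (nnP i).
pose D i x := S (nn i.+1) x - S (nn i) x.
have mD i : measurable_fun setT (D i) by exact: measurable_funB.
have sD i : (sqint (D i) <= ((8 ^+ i)^-1)%:E)%E.
  (* The selected indices are not assumed increasing, so both orders are treated. *)
  have [le|/ltnW le] := leqP (nn i) (nn i.+1).
    by apply: le_trans (rS _ _ le) _; rewrite lee_fin; case: (nnP i) => _; exact.
  have -> : sqint (D i) = sqint (fun x => S (nn i) x - S (nn i.+1) x)%R.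
    by apply: eq_integral => x _; rewrite /D -sqrrN opprB.
  apply: le_trans (rS _ _ le) _; rewrite lee_fin.
  case: (nnP i.+1) => _ /(_ _ (leqnn _))/le_trans; apply.
  by rewrite lef_pV2 ?posrE ?exprn_gt0// ler_weXn2l ?ler1n.
pose F i := [set x | ((2 ^+ i)^-1 < `|D i x|)%R].
have mF i : measurable (F i) by exact: measurable_gt_norm.
have PF i : (P (F i) <= ((2 ^+ i)^-1)%:E)%E.
  have i0 : 0 < (2 ^+ i)^-1 :> R by rewrite invr_gt0 exprn_gt0.
  have := le_trans (sqint_chebyshev (mD i) i0) (sD i).
  rewrite -[P (F i)]fineK ?fin_num_measure// -/(F i) => h.
  rewrite lee_fin; move: h; rewrite -EFinM lee_fin mulrC -ler_pdivlMr ?exprn_gt0//.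
  move=> /le_trans; apply; rewrite le_eqVlt; apply/orP; left; apply/eqP.
  have -> : (8 : R) = 2 ^+ 3 by rewrite !exprS expr0; ring.
  have t0 : 2 ^+ i != 0 :> R by rewrite expf_neq0.
  by rewrite -exprM mulnC exprM; field.
have BC : P (lim_sup_set F) = 0%E.
  apply: lim_sup_set_cvg0 => //.
  apply: (@le_lt_trans _ _ (\sum_(i <oo) ((2 ^+ i)^-1)%:E)%E).
    by apply: lee_nneseries => [i *|i *]; [exact: measure_ge0|exact: PF].
  apply: le_lt_trans (ltry 2); apply: le_trans (epsilon_trick0 xpredT (ler0n R 2)).
  apply: lee_nneseries => i *; first by rewrite lee_fin invr_ge0 exprn_ge0.
  by rewrite lee_fin natrX exprS invfM mulrA divff ?mul1r.
have cvgS x : ~ lim_sup_set F x -> cvgn (fun i => S (nn i) x).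
  move=> /existsNP[N /not_implyP[_ nF]].
  have DN i : (N <= i)%N -> `|D i x| <= (2 ^+ i)^-1.
    move=> Ni; rewrite leNgt; apply/negP => iF; apply: nF.
    by exists i.
  (* Telescoping with geometric increments; the bound is written as a difference so that the
     induction closes. *)
  have B i k : (N <= i)%N -> `|S (nn (i + k)%N) x - S (nn i) x| <=
      2 * (2 ^+ i)^-1 - 2 * (2 ^+ (i + k))^-1.
    move=> Ni; elim: k => [|k IH]; first by rewrite addn0 !subrr normr0.
    rewrite addnS (_ : _ - _ = D (i + k)%N x + (S (nn (i + k)%N) x - S (nn i) x)); last first.
      by rewrite /D; ring.
    apply: le_trans (ler_normD _ _) _.
    have := DN (i + k)%N (leq_trans Ni (leq_addr _ _)).
    rewrite exprS invfM mulrA divff// mul1r; move: IH; lra.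
  apply/cauchy_cvgP/cauchy_exP => e e0.
  have [i [Ni ie]] : exists i, (N <= i)%N /\ 2 * (2 ^+ i)^-1 < e.
    near \oo => i; exists i; split; first by near: i; exact: nbhs_infty_ge.
    rewrite -ltr_pdivlMl// -[ltLHS]ger0_norm ?invr_ge0 ?exprn_ge0//.
    rewrite -exprVn -[X in `|X|]subr0 distrC.
    near: i; have e2 : 0 < 2^-1 * e by rewrite mulr_gt0.
    have /cvgrPdist_lt := @cvg_expr R (2^-1) ltac:(by rewrite ger0_norm//; lra).
    exact.
  exists (S (nn i) x); exists i => //= j ij; rewrite /ball/=.
  have := B i (j - i)%N Ni; rewrite subnKC// distrC => /le_lt_trans; apply.
  by apply: le_lt_trans ie; rewrite gerBl mulr_ge0// invr_ge0 exprn_ge0.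
(* The upper limit is measurable everywhere and is the limit off the null set. *)
pose W x := fine (limn_esup (fun i => (S (nn i) x)%:E)).
have mW : measurable_fun setT W.
  apply: measurableT_comp => //; apply: measurable_fun_limn_esup => n.
  exact/measurable_EFinP.
exists W => // n.
have cvgW x : ~ lim_sup_set F x -> S (nn i) x @[i --> \oo] --> W x.
  move=> /cvgS /cvg_ex[l Sl]; suff -> : W x = l by [].
  have : (S (nn i) x)%:E @[i --> \oo] --> l%:E by apply: cvg_EFin => //; exact: nearW.
  by rewrite /W => /cvg_limn_einf_sup[_ ->].
have fat := @fatou _ _ R P setT measurableT (fun i x => ((S (nn i) x - S n x) ^+ 2)%:E).
apply: (@le_trans _ _ (\int[P]_x limn_einf (fun i => ((S (nn i) x - S n x) ^+ 2)%:E))%E).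
  rewrite le_eqVlt; apply/orP; left; apply/eqP; apply: ge0_ae_eq_integral => //.
  - by apply: measurable_sqr; exact: measurable_funB.
  - apply: (measurableT_comp (f := -%E)) => //; apply: measurable_fun_limn_esup => i.
    apply: measurableT_comp => //; apply: measurable_sqr; exact: measurable_funB.
  - by move=> x _; rewrite lee_fin sqr_ge0.
  - move=> x _; rewrite limn_einf_lim; apply: lime_ge; first exact: is_cvg_einfs.
    by apply: nearW => i; apply: le_ereal_inf_tmp => _ [k _ <-]; rewrite lee_fin sqr_ge0.
  exists (lim_sup_set F); split => //.
    by apply: bigcap_measurable => // i _; apply: bigcup_measurable.
  move=> x /= nx; apply: contrapT => /cvgW Wx; apply: nx => _.
  have h : ((S (nn i) x - S n x) ^+ 2)%:E @[i --> \oo] --> ((W x - S n x) ^+ 2)%:E.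
    apply: cvg_EFin; first exact: nearW.
    have c : S (nn i) x - S n x @[i --> \oo] --> W x - S n x.
      by apply: cvgB => //; exact: cvg_cst.
    exact: (cvgM c c).
  by have [-> _] := cvg_limn_einf_sup h.
apply: le_trans (fat _ _) _.
- by move=> i; apply: measurable_sqr; exact: measurable_funB.
- by move=> i x _; rewrite lee_fin sqr_ge0.
rewrite limn_einf_lim; apply: lime_le; first exact: is_cvg_einfs.
(* Each tail infimum is at most its term at [maxn i n], where [nn] is at least [n] and the bound
   [r n] applies. *)
apply: nearW => i; apply: le_trans (rS n (nn (maxn i n)) _); last first.
  exact: leq_trans (leq_maxr i n) (nnI _).
by apply: ereal_inf_lbound => /=; exists (maxn i n) => //=; exact: leq_maxl.
Unshelve. all: by end_near. Qed.


Definition normal_law f s := forall A : set R, measurable A -> P (f @^-1` A) = normal_prob 0 s A.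

Lemma normal_law_cdf f s x : 0 < s -> normal_law f s ->
  P (f @^-1` `]-oo, x[%classic) = (gauss_cdf (x / s))%:E.
Proof.
move=> s0 fs; rewrite fs; last exact: measurable_itv.
have := @normal_prob_affine R 0 s 0 1 `]-oo, x[%classic.
rewrite mulr0 addr0 mulr1 => ->//; last by rewrite gt_eqF.
rewrite -gauss_cdfE; congr (normal_prob _ _ _); apply/seteqP.
by split => y /=; rewrite !in_itv/= add0r ltr_pdivlMr// mulrC.
Qed.

Lemma cdf_normal_law f s : measurable_fun setT f -> 0 < s ->
  (forall x, P (f @^-1` `]-oo, x[%classic) = (gauss_cdf (x / s))%:E) -> normal_law f s.
Proof.
move=> mf s0 fs A mA.
have [nu nuE] := @pushforward_measureP R _ _ _ (measurableTypeR R) P _ mf.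
transitivity (nu A); first by rewrite nuE.
apply: (@real_measure_unique R nu [the measure _ _ of normal_prob 0 s]) => //.
- by rewrite nuE; exact: le_lt_trans (probability_le1 P measurableT) (ltry 1).
- transitivity (1%E : \bar R); last exact/esym/(@probability_setT _ _ _ [the probability _ _ of normal_prob 0 s]).
  by rewrite nuE; exact: (@probability_setT _ _ _ P).
move=> x; rewrite nuE [LHS]fs; apply/esym; change (normal_prob 0 s `]-oo, x[%classic = (gauss_cdf (x / s))%:E).
have := @normal_prob_affine R 0 s 0 1 `]-oo, x[%classic.
rewrite mulr0 addr0 mulr1 => ->//; last by rewrite gt_eqF.
rewrite -gauss_cdfE; congr (normal_prob _ _ _); apply/seteqP.
by split => y /=; rewrite !in_itv/= add0r ltr_pdivlMr// mulrC.
Qed.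

(** Convergence in probability: [P (W < x)] lies between the distribution functions of [S n] at
    [x - e] and [x + e], up to [r n / e ^+ 2]. Let [n] grow, then let [e] tend to 0 by continuity of
    [gauss_cdf]. *)
Lemma normal_law_limit (S : nat -> T -> R) (W : T -> R) (s r : nat -> R) (t : R) :
  (forall n, measurable_fun setT (S n)) -> measurable_fun setT W ->
  (\forall n \near \oo, 0 < s n /\ normal_law (S n) (s n)) ->
  s n @[n --> \oo] --> t -> 0 < t ->
  (forall n, (sqint (fun x => W x - S n x)%R <= (r n)%:E)%E) ->
  r n @[n --> \oo] --> 0 ->
  normal_law W t.
Proof.
move=> mS mW lS st t0 WS r0; apply: cdf_normal_law => // x.
have mray f y : measurable_fun setT f -> measurable (f @^-1` `]-oo, y[%classic).
  by move=> mf; rewrite -[X in measurable X]setTI; apply: mf => //; exact: measurable_itv.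
rewrite -[LHS]fineK; last by rewrite fin_num_measure//; exact: mray.
congr EFin; set p := fine _.
have Pe n e : 0 < e -> fine (P [set y | (e < `|W y - S n y|)%R]) <= r n / e ^+ 2.
  move=> e0; have mD : measurable_fun setT (fun y => W y - S n y) by exact: measurable_funB.
  have := le_trans (sqint_chebyshev mD e0) (WS n).
  rewrite -[P _]fineK ?fin_num_measure//; last exact: measurable_gt_norm.
  by rewrite -EFinM lee_fin mulrC -ler_pdivlMr ?exprn_gt0.
have cdf_cvg y : gauss_cdf (y / s n) @[n --> \oo] --> gauss_cdf (y / t).
  apply: continuous_cvg; first exact: continuous_gauss_cdf.
  by apply: cvgM; [exact: cvg_cst|apply: cvgV => //; rewrite gt_eqF].
have r_cvg e : r n / e ^+ 2 @[n --> \oo] --> 0.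
  by rewrite -[X in _ --> X](mul0r (e ^+ 2)^-1); apply: cvgM => //; exact: cvg_cst.
have ub e : 0 < e -> p <= gauss_cdf ((x + e) / t).
  move=> e0; have h : gauss_cdf ((x + e) / s n) + r n / e ^+ 2 @[n --> \oo] -->
      gauss_cdf ((x + e) / t) + 0 by apply: cvgD; [exact: cdf_cvg|exact: r_cvg].
  rewrite -[leRHS]addr0; apply: (cvgr_to_ge h); near=> n.
  have [sn lSn] : 0 < s n /\ normal_law (S n) (s n) by near: n.
  have := normal_law_cdf (x + e) sn lSn => /(congr1 fine)/= <-.
  apply: le_trans (lerD (lexx _) (Pe n e e0)).
  have mE := measurable_gt_norm e (measurable_funB mW (mS n)).
  apply: le_trans (fine_measureU_le P (mray _ _ (mS n)) mE).
  apply: fine_probability_le; [exact: mray|by apply: measurableU => //; exact: mray|].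
  move=> y /=; rewrite !in_itv/= => Wy.
  have [h1|h1] := ltP e `|W y - S n y|; [by right|left].
  by rewrite -ltrBlDr; apply: le_lt_trans Wy; rewrite lerBlDr -lerBlDl -normrN opprB in h1 *;
    exact: le_trans (ler_norm _) h1.
have lb e : 0 < e -> gauss_cdf ((x - e) / t) <= p.
  move=> e0; have h : gauss_cdf ((x - e) / s n) - r n / e ^+ 2 @[n --> \oo] -->
      gauss_cdf ((x - e) / t) - 0 by apply: cvgB; [exact: cdf_cvg|exact: r_cvg].
  rewrite -[leLHS]subr0; apply: (cvgr_to_le h); near=> n.
  have [sn lSn] : 0 < s n /\ normal_law (S n) (s n) by near: n.
  have := normal_law_cdf (x - e) sn lSn => /(congr1 fine)/= <-.
  rewrite lerBlDr; apply: le_trans (lerD (lexx _) (Pe n e e0)).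
  have mE := measurable_gt_norm e (measurable_funB mW (mS n)).
  apply: le_trans (fine_measureU_le P (mray _ _ mW) mE).
  apply: fine_probability_le; [exact: mray|by apply: measurableU => //; exact: mray|].
  move=> y /=; rewrite !in_itv/= => Sy.
  have [h1|h1] := ltP e `|W y - S n y|; [by right|left].
  have := le_trans (ler_norm _) h1; lra.
have e_cvg (c : R) : (x + c * (k.+1%:R)^-1) / t @[k --> \oo] --> x / t.
  apply: cvgM; last exact: cvg_cst.
  rewrite -[X in _ --> X]addr0; apply: cvgD; first exact: cvg_cst.
  rewrite -[X in _ --> X](mulr0 c); apply: cvgM; first exact: cvg_cst.
  exact: cvg_harmonic.
have cdf_e_cvg c : gauss_cdf ((x + c * (k.+1%:R)^-1) / t) @[k --> \oo] --> gauss_cdf (x / t).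
  by apply: continuous_cvg; [exact: continuous_gauss_cdf|exact: e_cvg].
apply/eqP; rewrite eq_le; apply/andP; split.
  apply: (cvgr_to_ge (cdf_e_cvg 1)); apply: nearW => k.
  by apply: ub; rewrite mul1r invr_gt0.
apply: (cvgr_to_le (cdf_e_cvg (-1))); apply: nearW => k.
by rewrite mulN1r; apply: lb; rewrite invr_gt0.
Unshelve. all: by end_near. Qed.

Lemma normal_law_sqint f s : measurable_fun setT f -> s != 0 ->
  normal_law f (s * unit_scale R) -> sqint f = (s ^+ 2)%:E.
Proof.
move=> mf s0 lf; rewrite -normal_second_moment//.
have [nu nuE] := @pushforward_measureP R _ _ _ (measurableTypeR R) P _ mf.
pose g (x : R) : \bar R := (x ^+ 2)%:E.
transitivity (\int[nu]_x g x)%E; last first.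
  by apply: eq_measure_integral => A mA _; rewrite nuE; exact: lf.
have mg : measurable_fun setT g by apply/measurable_EFinP; exact: measurable_funX.
by rewrite nuE ge0_integral_pushforward// => x _; rewrite lee_fin sqr_ge0.
Qed.

End square_integral.

Section gauss_sums.
Variable R : realType.
Notation bits2 := (bits (nat * nat)%type).
Notation P := (coin R (nat * nat)%type).
Implicit Types (h : nat -> R).

Definition gauss_sum h (n : nat) (y : bits2) : R :=
  \sum_(k < n) h k * gauss_coordinate R k y.

Lemma measurable_gauss_sum h n : measurable_fun setT (gauss_sum h n).
Proof.
apply: measurable_sum => k; apply: measurable_funM => //.
exact: measurable_gauss_coordinate.
Qed.

Lemma gauss_coordinate_scaled_law c n : c != 0 ->
  normal_law P (fun y => c * gauss_coordinate R n y) (c * unit_scale R).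
Proof.
move=> c0 A mA; have := @normal_prob_affine R 0 c 0 (unit_scale R) A.
rewrite mulr0 addr0 => ->//; last by rewrite gt_eqF// unit_scale_gt0.
rewrite -(gauss_coordinate_law n).
  by congr (P _); apply/seteqP; split => y; rewrite /= add0r.
by rewrite -[X in measurable X]setTI; exact: measurable_affine.
Qed.

(** The sum depends on the rows of index below [n], the new term on row [n] only. *)
Lemma gauss_sum_independent h c n (A B : set R) : measurable A -> measurable B ->
  P (gauss_sum h n @^-1` A `&` (fun y => c * gauss_coordinate R n y) @^-1` B) =
  (P (gauss_sum h n @^-1` A) * P ((fun y => c * gauss_coordinate R n y)%R @^-1` B))%E.
Proof.
move=> mA mB.
apply: (@coin_independent R _ [set i | (i.1 < n)%N] [set i | i.1 = n]).
- by move=> [i j] ij /= E; move: ij; rewrite /= E ltnn.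
- pose f (z : bits ('I_n * nat)%type) : R := \sum_(k < n) h k *
    (unit_scale R * quantile (expansion 2 (fun j => z (k, j)))).
  have mf : measurable_fun setT f.
    apply: measurable_sum => k; apply: measurable_funM => //; apply: measurable_funM => //.
    apply: measurableT_comp; first exact: measurable_quantile.
    by apply: measurable_expansion => // j; exact: measurable_coordinate.
  apply: (@reindex_sigma (nat * nat)%type ('I_n * nat)%type (fun i => (val i.1, i.2)) _ [set z | A (f z)]).
    by move=> [i j] /=.
  by rewrite -[X in measurable X]setTI; exact: mf.
pose f (z : bits nat) : R := c * (unit_scale R * quantile (expansion 2 z)).
have mf : measurable_fun setT f.
  apply: measurable_funM => //; apply: measurable_funM => //.
  apply: measurableT_comp; first exact: measurable_quantile.
  by apply: measurable_expansion => // j; exact: measurable_coordinate.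
apply: (@reindex_sigma (nat * nat)%type nat (fun j => (n, j)) _ [set z | B (f z)]) => //.
by rewrite -[X in measurable X]setTI; exact: mf.
Qed.

(** Variances add along the induction. The zero sum is kept as a separate alternative, since
    [normal_prob] with zero scale is not its law. *)
Lemma gauss_sum_law h n : (forall k, (k < n)%N -> h k = 0) \/
  (0 < \sum_(k < n) h k ^+ 2 /\
   normal_law P (gauss_sum h n) (Num.sqrt (\sum_(k < n) h k ^+ 2) * unit_scale R)).
Proof.
elim: n => [|n IH]; first by left.
have [hn|hn] := eqVneq (h n) 0.
  have E : gauss_sum h n.+1 = gauss_sum h n.
    by apply/funext => y; rewrite /gauss_sum big_ord_recr/= hn mul0r addr0.
  rewrite E big_ord_recr/= hn expr0n addr0; case: IH => [IH|IH]; [left|by right].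
  by move=> k; rewrite ltnS leq_eqVlt => /predU1P[->//|]; exact: IH.
right; have hn2 : 0 < h n ^+ 2 by rewrite lt0r sqrf_eq0 hn sqr_ge0.
rewrite big_ord_recr/=; case: IH => [IH|[s0 IH]].
  rewrite big1 ?add0r; last by move=> k _; rewrite IH// expr0n.
  split => // A mA.
  have -> : gauss_sum h n.+1 = (fun y => h n * gauss_coordinate R n y).
    apply/funext => y; rewrite /gauss_sum big_ord_recr/= big1 ?add0r// => k _.
    by rewrite IH// mul0r.
  rewrite (gauss_coordinate_scaled_law n hn mA) sqrtr_sqr.
  have [h0|h0] := leP 0 (h n); first by rewrite (ger0_norm h0).
  by rewrite (ltr0_norm h0) mulNr /normal_prob normal_pdfN.
split; first by rewrite ltr_pwDr// ltW.
move=> A mA.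
have -> : gauss_sum h n.+1 = (fun y => gauss_sum h n y + h n * gauss_coordinate R n y).
  by apply/funext => y; rewrite /gauss_sum big_ord_recr.
have u0 := unit_scale_gt0 R.
have a0 : Num.sqrt (\sum_(k < n) h k ^+ 2) * unit_scale R != 0.
  by rewrite mulf_neq0// gt_eqF// sqrtr_gt0.
have b0 : h n * unit_scale R != 0 by rewrite mulf_neq0// gt_eqF.
have mY : measurable_fun setT (fun y => h n * gauss_coordinate R n y).
  by apply: measurable_funM => //; exact: measurable_gauss_coordinate.
rewrite (@gaussian_independent_sum R _ _ P _ _ _ _ a0 b0 (measurable_gauss_sum h n) mY IH
  (gauss_coordinate_scaled_law n hn) (gauss_sum_independent h (h n) n) A mA).
have -> : Num.sqrt (\sum_(k < n) h k ^+ 2 + h n ^+ 2) * unit_scale R =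
    Num.sqrt ((Num.sqrt (\sum_(k < n) h k ^+ 2) * unit_scale R) ^+ 2 + (h n * unit_scale R) ^+ 2).
  rewrite !exprMn sqr_sqrtr ?ltW// -mulrDl sqrtrM ?addr_ge0 ?ltW//.
  by rewrite sqrtr_sqr gtr0_norm.
by [].
Qed.

Lemma sqint_gauss_sum h n : sqint P (gauss_sum h n) = (\sum_(k < n) h k ^+ 2)%:E.
Proof.
have [h0|[s0 law]] := gauss_sum_law h n.
  rewrite big1; last by move=> k _; rewrite h0// expr0n.
  apply: integral0_eq => y _; rewrite /gauss_sum big1 ?expr0n// => k _.
  by rewrite h0// mul0r.
rewrite (normal_law_sqint (measurable_gauss_sum h n) _ law).
  by rewrite sqr_sqrtr// ltW.
by rewrite gt_eqF// sqrtr_gt0.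
Qed.

Lemma sqint_gauss_sumB h m n : (m <= n)%N ->
  sqint P (fun y => gauss_sum h n y - gauss_sum h m y) =
  (\sum_(k < n) h k ^+ 2 - \sum_(k < m) h k ^+ 2)%:E.
Proof.
(* The difference is itself a Gaussian sum, with the coefficients below [m] replaced by 0. *)
move=> mn; pose g k := if (m <= k)%N then h k else 0.
have split_sum (F : nat -> R) : \sum_(k < n) (if (m <= k)%N then F k else 0) =
    \sum_(k < n) F k - \sum_(k < m) F k.
  rewrite -(subnKC mn); elim: (n - m)%N => [|i IH].
    rewrite addn0 subrr big1// => k _; by rewrite leqNgt ltn_ord.
  by rewrite addnS !big_ord_recr/= IH leq_addr addrAC.
transitivity (sqint P (gauss_sum g n)).
  apply: eq_integral => y _; congr ((_ ^+ 2)%:E).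
  rewrite /gauss_sum -(split_sum (fun k => h k * gauss_coordinate R k y)).
  by apply: eq_bigr => k _; rewrite /g; case: ifP => // _; rewrite mul0r.
rewrite sqint_gauss_sum; congr EFin; rewrite -(split_sum (fun k => h k ^+ 2)).
by apply: eq_bigr => k _; rewrite /g; case: ifP => // _; rewrite expr0n.
Qed.

End gauss_sums.

(** * Square-summable sequences *)


Section square_summable.
Variable R : realType.
Implicit Types x y : nat -> R.

Definition square_summable x := exists M : R, forall n, \sum_(k < n) x k ^+ 2 <= M.

Definition l2_pred : {pred nat -> R} := [pred x | `[< square_summable x >]].

Lemma square_summableD a x y : square_summable x -> square_summable y ->
  square_summable (fun k => a * x k + y k).
Proof.
move=> [M xM] [N yN]; exists (2 * a ^+ 2 * M + 2 * N) => n.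
apply: (@le_trans _ _ (\sum_(k < n) (2 * a ^+ 2 * x k ^+ 2 + 2 * y k ^+ 2))).
  apply: ler_sum => k _; have := sqr_ge0 (a * x k - y k).
  by rewrite sqrrB sqrrD exprMn; lra.
rewrite big_split/= -!mulr_sumr; apply: lerD.
  by apply: ler_wpM2l; [rewrite mulr_ge0// sqr_ge0|exact: xM].
by apply: ler_wpM2l => //; exact: yN.
Qed.

Lemma l2_submod_closed : submod_closed l2_pred.
Proof.
split; first by apply/asboolP; exists 0 => n; rewrite big1// => k _; rewrite expr0n.
move=> a x y /asboolP xs /asboolP ys; apply/asboolP.
exact: (square_summableD a xs ys).
Qed.

HB.instance Definition _ := GRing.isSubmodClosed.Build R (nat -> R) l2_pred l2_submod_closed.

Record l2 := L2 { l2_val :> nat -> R; l2_valP : l2_val \in l2_pred }.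

HB.instance Definition _ := [isSub for l2_val].
HB.instance Definition _ := [Choice of l2 by <:].
HB.instance Definition _ := [SubChoice_isSubLmodule of l2 by <:].

End square_summable.

Section l2_space.
Variable R : realType.
Implicit Types x y z : l2 R.

Lemma l2P x : square_summable x.
Proof. by apply/asboolP; exact: (l2_valP x). Qed.

Definition l2_of (x : nat -> R) (xs : square_summable x) : l2 R :=
  @L2 R x (asboolT xs : x \in @l2_pred R).

Lemma l2_ext x y : (forall k, x k = y k) -> x = y.
Proof. by move=> xy; apply: val_inj; apply/funext. Qed.

Lemma l2_add x y k : (x + y) k = x k + y k. Proof. by []. Qed.
Lemma l2_opp x k : (- x) k = - x k. Proof. by []. Qed.
Lemma l2_zero k : (0 : l2 R) k = 0. Proof. by []. Qed.

Definition l2_psum x y (n : nat) : R := \sum_(k < n) x k * y k.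
Definition l2_dot x y : R := limn (l2_psum x y).

Lemma l2_psum_nd x : nondecreasing_seq (l2_psum x x).
Proof.
by apply/nondecreasing_seqP => n; rewrite /l2_psum big_ord_recr/= lerDl -expr2 sqr_ge0.
Qed.

Lemma l2_sqr_cvg x : cvgn (l2_psum x x).
Proof.
apply: nondecreasing_is_cvgn; first exact: l2_psum_nd.
have [M xM] := l2P x; exists M => _ [n _ <-]; rewrite /l2_psum.
by under eq_bigr do rewrite -expr2.
Qed.

(** Polarization reduces to the series of squares, which are monotone and bounded. *)
Lemma l2_dot_cvg x y : l2_psum x y n @[n --> \oo] --> l2_dot x y.
Proof.
suff : cvgn (l2_psum x y) by [].
have -> : l2_psum x y = (fun n =>
    2^-1 * (l2_psum (x + y) (x + y) n - l2_psum x x n - l2_psum y y n)).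
  apply/funext => n; rewrite /l2_psum -!sumrB mulr_sumr; apply: eq_bigr => k _.
  by rewrite !l2_add; field.
by apply: is_cvgMr; apply: is_cvgB; [apply: is_cvgB|]; exact: l2_sqr_cvg.
Qed.

Lemma l2_dotE x y (l : R) : l2_psum x y n @[n --> \oo] --> l -> l2_dot x y = l.
Proof. by move=> h; exact: (cvg_unique _ (@l2_dot_cvg x y) h). Qed.

Lemma l2_dot_linear a x y z : l2_dot (a *: x + y) z = a * l2_dot x z + l2_dot y z.
Proof.
apply: l2_dotE.
have -> : l2_psum (a *: x + y) z = (fun n => a * l2_psum x z n + l2_psum y z n).
  apply/funext => n; rewrite /l2_psum mulr_sumr -big_split/=; apply: eq_bigr => k _.
  by transitivity ((a * x k + y k) * z k) => //; ring.
by apply: cvgD; [apply: cvgM; [exact: cvg_cst|]|]; exact: l2_dot_cvg.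
Qed.

Lemma l2_dotC x y : l2_dot x y = l2_dot y x.
Proof.
rewrite /l2_dot (_ : l2_psum x y = l2_psum y x)//.
by apply/funext => n; apply: eq_bigr => k _; rewrite mulrC.
Qed.

Lemma l2_dotDl x y z : l2_dot (x + y) z = l2_dot x z + l2_dot y z.
Proof. by rewrite -[x]scale1r l2_dot_linear mul1r scale1r. Qed.

Lemma l2_dot0 z : l2_dot 0 z = 0.
Proof. by apply: (addrI (l2_dot 0 z)); rewrite -l2_dotDl !addr0. Qed.

Lemma l2_dotZl a x z : l2_dot (a *: x) z = a * l2_dot x z.
Proof. by rewrite -[a *: x]addr0 l2_dot_linear l2_dot0 addr0. Qed.

Lemma l2_dotDr x y z : l2_dot z (x + y) = l2_dot z x + l2_dot z y.
Proof. by rewrite l2_dotC l2_dotDl !(l2_dotC z). Qed.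

Lemma l2_dotZr a x z : l2_dot z (a *: x) = a * l2_dot z x.
Proof. by rewrite l2_dotC l2_dotZl (l2_dotC z). Qed.

Lemma l2_sum_le x n : \sum_(k < n) x k ^+ 2 <= l2_dot x x.
Proof.
under eq_bigr do rewrite expr2.
exact: (nondecreasing_cvgn_le (@l2_psum_nd x) (@l2_sqr_cvg x)).
Qed.

Lemma l2_dot_ge0 x : 0 <= l2_dot x x.
Proof. by apply: le_trans (l2_sum_le x 0); rewrite big_ord0. Qed.

Lemma l2_dot_le x M : (forall n, \sum_(k < n) x k ^+ 2 <= M) -> l2_dot x x <= M.
Proof.
move=> xM; apply: (cvgr_to_le (@l2_dot_cvg x x)); apply: nearW => n.
by rewrite /l2_psum; under eq_bigr do rewrite -expr2.
Qed.

Lemma l2_dot_eq0 x : l2_dot x x = 0 -> x = 0.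
Proof.
move=> x0; apply: l2_ext => k; rewrite l2_zero; apply/eqP.
rewrite -sqrf_eq0 eq_le sqr_ge0 andbT; apply: le_trans (_ : l2_dot x x <= 0); last by rewrite x0.
apply: le_trans (l2_sum_le x k.+1); rewrite big_ord_recr/= lerDr.
by apply: sumr_ge0 => i _; exact: sqr_ge0.
Qed.

Lemma l2_dotD x y : l2_dot (x + y) (x + y) = l2_dot x x + 2 * l2_dot x y + l2_dot y y.
Proof. by rewrite l2_dotDl !l2_dotDr (l2_dotC y x); ring. Qed.

Definition l2_norm x : R := Num.sqrt (l2_dot x x).

Lemma l2_normE x : l2_norm x ^+ 2 = l2_dot x x.
Proof. by rewrite sqr_sqrtr// l2_dot_ge0. Qed.

(** The squared distance from [x] to its projection on the line of [y] is nonnegative. *)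
Lemma l2_cauchy_schwarz x y : l2_dot x y <= l2_norm x * l2_norm y.
Proof.
have [y0|y0] := eqVneq (l2_dot y y) 0.
  by rewrite (l2_dot_eq0 y0) l2_dotC l2_dot0 mulr_ge0// sqrtr_ge0.
have yp : 0 < l2_dot y y by rewrite lt0r y0 l2_dot_ge0.
have := l2_dot_ge0 (x + (- (l2_dot x y / l2_dot y y)) *: y).
rewrite l2_dotD l2_dotZl !l2_dotZr -(pmulr_lge0 _ yp) => h.
rewrite /l2_norm -sqrtrM ?l2_dot_ge0//; apply: le_trans (ler_norm _) _.
rewrite -sqrtr_sqr ler_wsqrtr// -subr_ge0.
apply: le_trans h _; rewrite le_eqVlt; apply/orP; left; apply/eqP.
by field.
Qed.

Lemma l2_normD x y : l2_norm (x + y) <= l2_norm x + l2_norm y.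
Proof.
rewrite -(@ler_pXn2r _ 2)// ?nnegrE ?addr_ge0 ?sqrtr_ge0//.
rewrite l2_normE l2_dotD sqrrD !l2_normE lerD2r lerD2l -[leRHS]mulr_natl.
apply: ler_wpM2l => //; exact: l2_cauchy_schwarz.
Qed.

Lemma l2_normZ a x : l2_norm (a *: x) = `|a| * l2_norm x.
Proof. by rewrite /l2_norm l2_dotZl l2_dotZr mulrA -expr2 sqrtrM ?sqr_ge0// sqrtr_sqr. Qed.

Lemma l2_norm_eq0 x : l2_norm x = 0 -> x = 0.
Proof. by move=> x0; apply: l2_dot_eq0; rewrite -l2_normE x0 expr0n. Qed.

HB.instance Definition _ := @Lmodule_isNormed.Build R (l2 R) l2_norm l2_normD l2_normZ l2_norm_eq0.

Lemma l2_sqr_norm x : `|x| ^+ 2 = l2_dot x x.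
Proof. exact: l2_normE. Qed.

Lemma l2_coord_le x k : `|x k| <= `|x|.
Proof.
rewrite -(@ler_pXn2r _ 2)// ?nnegrE//= l2_sqr_norm real_normK ?num_real//.
apply: le_trans (l2_sum_le x k.+1); rewrite big_ord_recr/= lerDr.
by apply: sumr_ge0 => i _; exact: sqr_ge0.
Qed.

Lemma l2_sumB_le x y n : \sum_(k < n) (x k - y k) ^+ 2 <= `|x - y| ^+ 2.
Proof.
rewrite l2_sqr_norm; apply: le_trans (l2_sum_le _ n).
by apply: ler_sum => k _; rewrite l2_add l2_opp.
Qed.

(** Coordinates converge by completeness of the reals. Each finite partial sum of a squared distance
    passes to the limit, with a bound uniform in its length; this gives both summability of the
    limit and convergence in norm. *)
Lemma l2_cauchy_cvg (F : set_system (l2 R)) : ProperFilter F -> cauchy F -> cvg F.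
Proof.
move=> FF Fc0.
have Fc (e : R) : 0 < e -> exists x : l2 R, F (ball x e).
  by move=> e0; have /cauchyP/(_ e e0) := Fc0.
pose p k (x : l2 R) : R := x k.
have coord_cvg k : cvg (p k @ F).
  apply/cauchy_cvgP/cauchy_exP => e e0; have [x Fx] := Fc e e0.
  exists (p k x); change (F (p k @^-1` ball (p k x) e)).
  apply: filterS Fx => y; rewrite -ball_normE /ball_/= => xy.
  rewrite /ball/=; apply: le_lt_trans xy.
  by have := l2_coord_le (x - y) k; rewrite l2_add l2_opp.
pose a (k : nat) : R := lim (p k @ F).
have ball_sum (e : R) : 0 < e -> \forall x \near F,
    forall n, \sum_(k < n) ((x : l2 R) k - a k) ^+ 2 <= e ^+ 2.
  move=> e0; have e20 : 0 < e / 2 by rewrite divr_gt0.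
  have [z Fz] := Fc _ e20; apply: filterS (Fz) => x zx n.
  have h : \sum_(k < n) (x k - p k y) ^+ 2 @[y --> F] --> (\sum_(k < n) (x k - a k) ^+ 2 : R).
    have c k : x k - p k y @[y --> F] --> x k - a k.
      by apply: cvgB; [exact: cvg_cst|exact: coord_cvg].
    elim: n => [|n IH].
      by rewrite big_ord0; under eq_fun do rewrite big_ord0; exact: cvg_cst.
    rewrite big_ord_recr/=; under eq_fun do rewrite big_ord_recr/=.
    by apply: cvgD => //; exact: (cvgM (@c n) (@c n)).
  apply: (cvgr_to_le h); apply: filterS (Fz) => y zy.
  apply: le_trans (l2_sumB_le x y n) _; rewrite lerXn2r// ?nnegrE ?normr_ge0 ?(ltW e0)//; apply: ltW.
  move: zx zy; rewrite -ball_normE /ball_/= distrC => zx zy.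
  by rewrite (splitr e) (le_lt_trans (ler_distD z _ _))// ltrD.
have as_ : square_summable a.
  have [x xa] := filter_ex (ball_sum 1 ltr01).
  have [M xM] := l2P x.
  exists (2 * M + 2 * 1 ^+ 2) => n; have := xa n; have := xM n; move=> h1 h2.
  apply: (@le_trans _ _ (\sum_(k < n) (2 * x k ^+ 2 + 2 * (x k - a k) ^+ 2))).
    apply: ler_sum => k _; have := sqr_ge0 (2 * x k - a k); rewrite !sqrrB; lra.
  by rewrite big_split/= -!mulr_sumr lerD// ler_pM2l.
apply/cvg_ex; exists (l2_of as_); apply/cvgrPdist_le => e e0.
apply: filterS (ball_sum _ e0) => x xe; rewrite distrC.
rewrite -(@ler_pXn2r _ 2)// ?nnegrE//= ?(ltW e0)// l2_sqr_norm; apply: l2_dot_le => n.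
exact: xe.
Qed.

HB.instance Definition _ := Uniform_isComplete.Build (l2 R) l2_cauchy_cvg.

Let l2_bilinear_left z : linear_for *%R (fun x => l2_dot x z).
Proof. by move=> a x y; rewrite l2_dot_linear. Qed.

Let l2_bilinear_right z : linear_for (idfun \; *%R) (l2_dot z).
Proof. by move=> a x y; rewrite l2_dotDr l2_dotZr. Qed.

HB.instance Definition _ := @bilinear_isBilinear.Build R (l2 R) (l2 R) R *%R
  (idfun \; *%R) l2_dot (l2_bilinear_left, l2_bilinear_right).

Let l2_hermitian x y : l2_dot x y = (-1) ^+ false * idfun (l2_dot y x).
Proof. by rewrite expr0 mul1r l2_dotC. Qed.

HB.instance Definition _ := @isHermitianSesquilinear.Build R (l2 R) false idfun l2_dot l2_hermitian.

Let l2_dot_gt0 x : x != 0 -> 0 < l2_dot x x.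
Proof.
move=> x0; rewrite lt0r l2_dot_ge0 andbT.
by apply: contraNneq x0 => /l2_dot_eq0 ->.
Qed.

HB.instance Definition _ := @isDotProduct.Build R (l2 R) l2_dot l2_dot_gt0.

Definition finite_seq_summable (s : seq R) : square_summable (fun k => nth 0 s k).
Proof.
exists (\sum_(k < size s) nth 0 s k ^+ 2) => n.
have [ns|/ltnW ns] := leqP n (size s).
  rewrite -!(big_mkord xpredT (fun k => nth 0 s k ^+ 2)) (big_cat_nat (leq0n _) ns)//= lerDl.
  by apply: sumr_ge0 => k _; exact: sqr_ge0.
rewrite -!(big_mkord xpredT (fun k => nth 0 s k ^+ 2)) (big_cat_nat (leq0n _) ns)//=.
rewrite [X in _ + X]big_nat_cond [X in _ + X]big1 ?addr0// => k.
by rewrite andbT => /andP[sk _]; rewrite nth_default// expr0n.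
Qed.

Definition l2_seq (s : seq R) : l2 R := l2_of (finite_seq_summable s).

Lemma l2_norm_le (x : l2 R) (M : R) : 0 <= M ->
  (forall n, \sum_(k < n) x k ^+ 2 <= M ^+ 2) -> `|x| <= M.
Proof.
move=> M0 xM; rewrite -(@ler_pXn2r _ 2)// ?nnegrE//= l2_sqr_norm.
exact: l2_dot_le.
Qed.

Lemma l2_separable : separable (l2 R).
Proof.
exists (range (fun s : seq rat => l2_seq (map ratr s))).
  by apply: (sub_countable (card_image_le _ _)); exact: countableP.
move=> O [x Ox] oO.
have [e e0 xe] : exists2 e : R, 0 < e & ball x e `<=` O.
  by move: oO; rewrite openE => /(_ x Ox); rewrite /interior -nbhs_ballE => -[e /= ? ?]; exists e.
pose e' := e / 2; have e'0 : 0 < e' by rewrite divr_gt0.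
have h : 0 < e' ^+ 2 / 2 by rewrite divr_gt0// exprn_gt0.
have [n nx] : exists n, l2_dot x x - l2_psum x x n <= e' ^+ 2 / 2.
  near \oo => n; exists n.
  apply: le_trans (ler_norm _) _; near: n.
  have := @l2_dot_cvg x x; move=> /cvgrPdist_le/(_ _ h); exact.
(* Chosen so that [n * dl ^+ 2 <= e' ^+ 2 / 2]: the first [n] coordinates and the tail each use half
   of the squared error. *)
pose dl := e' / (2 * n.+1%:R); have dl0 : 0 < dl by rewrite divr_gt0// mulr_gt0.
have /choice[q qP] k : exists q : rat, x k < ratr q < x k + dl.
  have : x k < x k + dl by rewrite ltrDl.
  by move=> /rat_in_itvoo[q]; rewrite in_itv/=; exists q.
pose s := mkseq q n; exists (l2_seq (map ratr s)); split; last by exists s.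
apply: xe; rewrite -ball_normE /ball_/=.
apply: (@le_lt_trans _ _ e'); last by rewrite /e' ltr_pdivrMr// mulr2n mulrDr mulr1 ltrDl.
have snth k : (k < n)%N -> nth 0 (map ratr s) k = ratr (q k) :> R.
  by move=> kn; rewrite (nth_map 0) ?size_mkseq// nth_mkseq.
have snth0 k : (n <= k)%N -> nth 0 (map ratr s) k = 0 :> R.
  by move=> nk; rewrite nth_default// size_map size_mkseq.
apply: l2_norm_le => [|m]; first exact: ltW.
pose f k : R := if (k < n)%N then dl ^+ 2 else x k ^+ 2.
have fk k : (x - l2_seq (map ratr s)) k ^+ 2 <= f k.
  rewrite l2_add l2_opp /= /f; case: ltnP => kn; last by rewrite snth0// subr0.
  rewrite snth// -sqrrN opprB -(@ger0_norm _ dl) ?(ltW dl0)// real_normK ?num_real//.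
  have /andP[q1 q2] := qP k.
  by rewrite lerXn2r// ?nnegrE ?subr_ge0 ?ltW// ltrBlDl.
apply: (@le_trans _ _ (\sum_(k < maxn m n) f k)).
  apply: (@le_trans _ _ (\sum_(k < m) f k)); first by apply: ler_sum => k _; exact: fk.
  rewrite -!(big_mkord xpredT f) (big_cat_nat (leq0n _) (leq_maxl m n))//= lerDl.
  by apply: sumr_ge0 => k _; rewrite /f; case: ifP => _; exact: sqr_ge0.
have E : \sum_(k < maxn m n) f k = n%:R * dl ^+ 2 + (l2_psum x x (maxn m n) - l2_psum x x n).
  rewrite -(big_mkord xpredT f) (big_cat_nat (leq0n _) (leq_maxr m n))//=; congr (_ + _).
    rewrite big_mkord (eq_bigr (fun=> dl ^+ 2)); last by move=> k _; rewrite /f ltn_ord.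
    by rewrite sumr_const card_ord mulr_natl.
  rewrite /l2_psum -!(big_mkord xpredT (fun k => x k * x k)).
  have D : \sum_(0 <= k < maxn m n) x k * x k =
      \sum_(0 <= k < n) x k * x k + \sum_(n <= k < maxn m n) x k * x k.
    exact: big_cat_nat (leq0n _) (leq_maxr m n).
  rewrite D [X in _ = X - _]addrC addrK.
  by apply: eq_big_nat => k /andP[nk _]; rewrite /f ltnNge nk expr2.
rewrite E (splitr (e' ^+ 2)); apply: lerD.
  rewrite /dl expr_div_n mulrCA ler_wpM2l ?exprn_ge0 ?(ltW e'0)//.
  rewrite ler_pdivrMr ?exprn_gt0 ?mulr_gt0// exprMn expr2 -[2 * 2]/(2 * 2) !mulrA mulVf// mul1r.
  by rewrite -!natrM ler_nat; nia.
apply: le_trans nx; rewrite lerD2r.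
have := l2_sum_le x (maxn m n); rewrite /l2_psum.
by under eq_bigr do rewrite expr2.
Unshelve. all: by end_near. Qed.

Definition l2_basis (n : nat) : l2 R := l2_seq (rcons (nseq n 0) 1).

Lemma l2_basisE n k : l2_basis n k = (k == n)%:R.
Proof.
rewrite /l2_basis /= nth_rcons size_nseq nth_nseq; case: ltngtP => //.
Qed.

(** If [n] vectors spanned the first [n + 1] basis vectors, the identity matrix of size [n + 1]
    would factor through rank [n]. *)
Lemma l2_infinite_dimensional : infinite_dimensional (l2 R).
Proof.
move=> n v; apply: contrapT => /forallNP nv.
have /choice[c cP] (j : 'I_n.+1) : exists c : 'I_n -> R, l2_basis j = \sum_(i < n) c i *: v i.
  by have /existsNP[c /contrapT] := nv (l2_basis j); exists c.
pose C : 'M[R]_(n.+1, n) := \matrix_(j, i) c j i.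
pose V : 'M[R]_(n, n.+1) := \matrix_(i, k) v i k.
have CV : C *m V = 1%:M.
  apply/matrixP => j k; rewrite !mxE.
  have := congr1 (fun x : l2 R => x k) (cP j); rewrite l2_basisE => e.
  have -> : (j == k)%:R = (\sum_(i < n) c j i *: v i : l2 R) k.
    by rewrite -e eq_sym.
  rewrite (big_morph (fun x : l2 R => x k) (id1 := 0) (op1 := +%R))//.
  by apply: eq_bigr => i _; rewrite !mxE.
have := mxrankM_maxl C V; rewrite CV mxrank1 => /leq_trans/(_ (rank_leq_col C)).
by rewrite ltnn.
Qed.

Lemma sum_injective_le (t : nat -> nat) (f : nat -> R) n : injective t ->
  (forall k, 0 <= f k) -> exists N, \sum_(k < n) f (t k) <= \sum_(k < N) f k.
Proof.
move=> tI f0; pose N := (\max_(k < n) t k).+1; exists N.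
have tN (k : 'I_n) : (t k < N)%N by rewrite ltnS; exact: (leq_bigmax k).
pose j (k : 'I_n) := Ordinal (tN k).
have jI : injective j by move=> k l /(congr1 val)/= /tI/val_inj.
rewrite (_ : \sum_(k < n) f (t k) = \sum_(i in j @: finset.setT) f i); last first.
  rewrite big_imset/=; last by move=> k l _ _; exact: jI.
  by apply: eq_bigl => k; rewrite finset.in_setT.
rewrite big_mkcond/=; apply: ler_sum => i _; by case: ifP.
Qed.

Lemma translate_inj p : injective (translate p).
Proof. exact: can_inj (translateK p). Qed.

Lemma l2_translate_summable p x : square_summable (fun k => x (translate p k)).
Proof.
exists (l2_dot x x) => n.
have [N] := @sum_injective_le (translate p) (fun k => x k ^+ 2) n (@translate_inj p) (fun k => sqr_ge0 _).
by move=> /le_trans; apply; exact: l2_sum_le.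
Qed.

Definition l2_translate p x : l2 R := l2_of (l2_translate_summable p x).

Lemma l2_translate_linear p : linear (l2_translate p).
Proof. by move=> a x y; apply: l2_ext. Qed.

Lemma l2_translateK p x : l2_translate (- p) (l2_translate p x) = x.
Proof. by apply: l2_ext => k /=; rewrite translateVK. Qed.

(** Translations are contractions, by injectivity on indices; a contraction whose inverse is a
    contraction is an isometry, and polarization gives inner products. *)
Lemma l2_translate_dot p x y : l2_dot (l2_translate p x) (l2_translate p y) = l2_dot x y.
Proof.
have le q z : l2_dot (l2_translate q z) (l2_translate q z) <= l2_dot z z.
  apply: l2_dot_le => n /=.
  have [N] := @sum_injective_le (translate q) (fun k => z k ^+ 2) n (@translate_inj q) (fun k => sqr_ge0 _).
  by move=> /le_trans; apply; exact: l2_sum_le.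
have iso z : l2_dot (l2_translate p z) (l2_translate p z) = l2_dot z z.
  apply/eqP; rewrite eq_le; apply/andP; split; first exact: le.
  by rewrite -{1 2}(l2_translateK p z); exact: le.
have add : l2_translate p (x + y) = l2_translate p x + l2_translate p y by exact: l2_ext.
have := iso (x + y); rewrite add !l2_dotD !iso; lra.
Qed.

End l2_space.

(** * The Gaussian automorphism *)


Section ae_tools.
Variables (R : realType) (d : measure_display) (T : measurableType d).
Variable P : probability T R.
Implicit Types f g : T -> R.

Lemma ae_eq_sqint f g : measurable_fun setT f -> measurable_fun setT g ->
  f = g %[ae P] -> sqint P f = sqint P g.
Proof.
move=> mf mg fg; apply: ge0_ae_eq_integral => //.
- exact: measurable_sqr.
- exact: measurable_sqr.
- by move=> x _; rewrite lee_fin sqr_ge0.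
- by move=> x _; rewrite lee_fin sqr_ge0.
- by apply: filterS fg => x fgx _; rewrite fgx.
Qed.

Lemma ae_eq_preimage f g (A : set R) : measurable_fun setT f -> measurable_fun setT g ->
  measurable A -> f = g %[ae P] -> P (f @^-1` A) = P (g @^-1` A).
Proof.
move=> mf mg mA [N [mN N0 fgN]]; apply: measure_eq_off mN N0 _.
- by rewrite -[X in measurable X]setTI; exact: mf.
- by rewrite -[X in measurable X]setTI; exact: mg.
move=> x Nx; rewrite /= (_ : f x = g x)//; apply: contrapT => fg.
by apply: Nx; apply: fgN => /= h; apply: fg; exact: h.
Qed.

Lemma sqint_lim_eq f g (u : nat -> R) : measurable_fun setT f -> measurable_fun setT g ->
  (forall n, (sqint P (fun x => f x - g x)%R <= (u n)%:E)%E) -> u n @[n --> \oo] --> 0 ->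
  f = g %[ae P].
Proof.
move=> mf mg fgu u0; have mfg : measurable_fun setT (fun x => f x - g x) by exact: measurable_funB.
have : (fun x => f x - g x) = cst 0 %[ae P].
  apply: sqint_eq0 => //; apply/eqP; rewrite eq_le sqint_ge0 andbT.
  have uE : (u n)%:E @[n --> \oo] --> 0%:E by apply: cvg_EFin => //; exact: nearW.
  apply: (@le_trans _ _ (limn (fun n => (u n)%:E))); last by rewrite (cvg_lim _ uE).
  by apply: lime_ge; [apply/cvg_ex; exists 0%:E|exact: nearW].
by apply: filterS => x h xT; apply/eqP; rewrite -subr_eq0; apply/eqP; exact: h.
Qed.

Lemma sqintB_le f g (h : T -> R) : measurable_fun setT f -> measurable_fun setT g -> measurable_fun setT h ->
  (sqint P (fun x => f x - h x)%R <=
   2%:E * sqint P (fun x => f x - g x)%R + 2%:E * sqint P (fun x => h x - g x)%R)%E.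
Proof.
move=> mf mg mh.
have -> : sqint P (fun x => h x - g x)%R = sqint P (fun x => g x - h x)%R.
  by apply: eq_integral => x _; rewrite -sqrrN opprB.
have -> : sqint P (fun x => f x - h x)%R = sqint P (fun x => (f x - g x) + (g x - h x))%R.
  by apply: eq_integral => x _; congr ((_ ^+ 2)%:E); ring.
by apply: sqintD_le; exact: measurable_funB.
Qed.

End ae_tools.

Section isonormal.
Variable R : realType.
Notation bits2 := (bits (nat * nat)%type).
Notation P := (coin R (nat * nat)%type).
Implicit Types h : l2 R.

Definition l2_tail h n : R := l2_dot h h - \sum_(k < n) h k ^+ 2.

Lemma l2_tail_cvg h : l2_tail h n @[n --> \oo] --> 0.
Proof.
rewrite -(subrr (l2_dot h h)); apply: cvgB; first exact: cvg_cst.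
have -> : (fun n => \sum_(k < n) h k ^+ 2) = l2_psum h h.
  by apply/funext => n; apply: eq_bigr => k _; rewrite expr2.
exact: l2_dot_cvg.
Qed.

Lemma isonormal_exists h : exists2 W : bits2 -> R, measurable_fun setT W &
  forall n, (sqint P (fun y => W y - gauss_sum h n y)%R <= (l2_tail h n)%:E)%E.
Proof.
apply: sqint_complete => [n|m n mn|]; first exact: measurable_gauss_sum.
  by rewrite sqint_gauss_sumB// lee_fin lerD2r l2_sum_le.
exact: l2_tail_cvg.
Qed.

(** A version, fixed by choice, of the series of [h k] times the [k]-th normal coordinate; linearity
    in [h] therefore holds only almost everywhere. *)
Definition isonormal_fun h : bits2 -> R := projT1 (cid2 (isonormal_exists h)).

Lemma measurable_isonormal h : measurable_fun setT (isonormal_fun h).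
Proof. by rewrite /isonormal_fun; case: cid2. Qed.

Definition isonormal h : {RV P >-> R} := mfun_Sub (mem_set (@measurable_isonormal h)).

Lemma isonormalP h n : (sqint P (fun y => isonormal h y - gauss_sum h n y)%R <= (l2_tail h n)%:E)%E.
Proof. by rewrite /isonormal/= /isonormal_fun; case: cid2. Qed.

Lemma measurable_isonormalT h : measurable_fun setT (isonormal h).
Proof. exact: measurable_isonormal. Qed.

Lemma isonormal_unique h (W : bits2 -> R) (u : nat -> R) : measurable_fun setT W ->
  (forall n, (sqint P (fun y => W y - gauss_sum h n y)%R <= (u n)%:E)%E) ->
  u n @[n --> \oo] --> 0 -> isonormal h = W %[ae P].
Proof.
move=> mW Wu u0.
apply: (@sqint_lim_eq _ _ _ _ _ _ (fun n => 2 * l2_tail h n + 2 * u n)) => //.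
- move=> n; apply: le_trans (sqintB_le _ (measurable_isonormalT h) (measurable_gauss_sum h n) mW) _.
  have -> : (2 * l2_tail h n + 2 * u n)%:E = (2%:E * (l2_tail h n)%:E + 2%:E * (u n)%:E)%E.
    by rewrite -!EFinM -EFinD.
  by apply: leeD; apply: lee_wpmul2l => //; exact: isonormalP.
- rewrite -[X in _ --> X](addr0 0) -[X in _ --> X + _](mulr0 2) -[X in _ --> _ + X](mulr0 2).
  by apply: cvgD; apply: cvgM => //; try exact: cvg_cst; exact: l2_tail_cvg.
Qed.

Lemma isonormal_linear a h h' :
  isonormal (a *: h + h') = (fun y => a * isonormal h y + isonormal h' y) %[ae P].
Proof.
have mh := measurable_isonormalT h; have mh' := measurable_isonormalT h'.
have m1 : measurable_fun setT (fun y => a * isonormal h y).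
  exact: measurable_funM.
apply: (@isonormal_unique _ _ (fun n => 2 * (a ^+ 2 * l2_tail h n) + 2 * l2_tail h' n)).
- exact: measurable_funD.
- move=> n.
  have -> : sqint P (fun y => (a * isonormal h y + isonormal h' y) - gauss_sum (a *: h + h') n y)%R =
      sqint P (fun y => a * (isonormal h y - gauss_sum h n y) +
        (isonormal h' y - gauss_sum h' n y))%R.
    apply: eq_integral => y _; congr ((_ ^+ 2)%:E).
    have -> : gauss_sum (a *: h + h') n y = a * gauss_sum h n y + gauss_sum h' n y.
      rewrite /gauss_sum mulr_sumr -big_split/=; apply: eq_bigr => k _.
      by transitivity ((a * h k + h' k) * gauss_coordinate R k y) => //; ring.
    ring.
  have mS k : measurable_fun setT (fun y => isonormal k y - gauss_sum k n y).
    by apply: measurable_funB; [exact: measurable_isonormalT|exact: measurable_gauss_sum].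
  apply: le_trans (sqintD_le _ _ _) _; [by apply: measurable_funM|exact: mS|].
  rewrite sqintZ//.
  have -> : (2 * (a ^+ 2 * l2_tail h n) + 2 * l2_tail h' n)%:E =
      (2%:E * ((a ^+ 2)%:E * (l2_tail h n)%:E) + 2%:E * (l2_tail h' n)%:E)%E.
    by rewrite -!EFinM -EFinD.
  apply: leeD; apply: lee_wpmul2l => //; last exact: isonormalP.
  by apply: lee_wpmul2l; [rewrite lee_fin sqr_ge0|exact: isonormalP].
rewrite -[X in _ --> X](addr0 0) -[X in _ --> X + _](mulr0 2) -[X in _ --> _ + X](mulr0 2).
apply: cvgD; apply: cvgM; try exact: cvg_cst; last exact: l2_tail_cvg.
rewrite -[X in _ --> X](mulr0 (a ^+ 2)).
by apply: cvgM; [exact: cvg_cst|exact: l2_tail_cvg].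
Qed.

Lemma isonormal_law h : isonormal h = cst 0 %[ae P] /\ l2_dot h h = 0 \/
  0 < l2_dot h h /\ normal_law P (isonormal h) (Num.sqrt (l2_dot h h) * unit_scale R).
Proof.
have [h0|h0] := eqVneq (l2_dot h h) 0.
  left; split=> //; apply: sqint_eq0; first exact: measurable_isonormalT.
  apply/eqP; rewrite eq_le sqint_ge0 andbT.
  have := isonormalP h 0; rewrite /l2_tail big_ord0 subr0 h0.
  congr (_ <= _)%E; apply: eq_integral => y _; congr ((_ ^+ 2)%:E).
  by rewrite /gauss_sum big_ord0 subr0.
right; have hp : 0 < l2_dot h h by rewrite lt0r h0 l2_dot_ge0.
have u0 := unit_scale_gt0 R.
have sum_cvg : (\sum_(k < n) h k ^+ 2 : R) @[n --> \oo] --> l2_dot h h.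
  have -> : (fun n => \sum_(k < n) h k ^+ 2 : R) = l2_psum h h.
    by apply/funext => n; apply: eq_bigr => k _; rewrite expr2.
  exact: l2_dot_cvg.
split => //.
apply: (@normal_law_limit _ _ _ P (gauss_sum h) _
  (fun n => Num.sqrt (\sum_(k < n) h k ^+ 2) * unit_scale R) (l2_tail h)).
- by move=> n; exact: measurable_gauss_sum.
- exact: measurable_isonormalT.
- near=> n.
  have sn : 0 < \sum_(k < n) h k ^+ 2 by near: n; exact: (cvgr_gt _ sum_cvg).
  split; first by rewrite mulr_gt0// sqrtr_gt0.
  have [z|[_ //]] := gauss_sum_law h n.
  by move: sn; rewrite big1 ?ltxx// => k _; rewrite z// expr0n.
- apply: cvgM; last exact: cvg_cst.
  by apply: continuous_cvg => //; exact: sqrt_continuous.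
- by rewrite mulr_gt0// sqrtr_gt0.
- exact: isonormalP.
- exact: l2_tail_cvg.
Unshelve. all: by end_near. Qed.

Lemma isonormal_sqint h : sqint P (isonormal h) = (l2_dot h h)%:E.
Proof.
have [[h0 ->]|[hp lh]] := isonormal_law h.
  rewrite (ae_eq_sqint (measurable_isonormalT h) _ h0)//.
  by apply: integral0_eq => y _; rewrite expr0n.
rewrite (normal_law_sqint (measurable_isonormalT h) _ lh).
  by rewrite sqr_sqrtr// ltW.
by rewrite gt_eqF// sqrtr_gt0.
Qed.

(** Polarization of the second moments, with linearity applied to [h + h']. *)
Lemma isonormal_covariance h h' :
  (\int[P]_y (isonormal h y * isonormal h' y)%:E = (l2_dot h h')%:E)%E.
Proof.
have mh := measurable_isonormalT h; have mh' := measurable_isonormalT h'.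
have int_sqr f : measurable_fun setT f -> (sqint P f < +oo)%E ->
    P.-integrable setT (fun y => ((f y) ^+ 2)%:E).
  move=> mf fy; apply/integrableP; split; first exact: measurable_sqr.
  rewrite (_ : (\int[P]_x `|((f x) ^+ 2)%:E|)%E = sqint P f)//.
  by apply: eq_integral => x _; rewrite gee0_abs// lee_fin sqr_ge0.
have mD : measurable_fun setT (fun y => isonormal h y + isonormal h' y) by exact: measurable_funD.
have sD : sqint P (fun y => isonormal h y + isonormal h' y) = (l2_dot (h + h') (h + h'))%:E.
  rewrite -isonormal_sqint; apply: ae_eq_sqint => //.
  have := isonormal_linear 1 h h'; rewrite scale1r; apply: filterS => y H yT.
  by rewrite H// mul1r.
have iD := int_sqr _ mD; have ih := int_sqr _ mh; have ih' := int_sqr _ mh'.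
rewrite sD ltry in iD; rewrite isonormal_sqint ltry in ih; rewrite isonormal_sqint ltry in ih'.
move: iD ih ih' => /(_ isT) iD /(_ isT) ih /(_ isT) ih'.
transitivity (\int[P]_y (2^-1%:E * (((isonormal h y + isonormal h' y) ^+ 2)%:E -
    ((isonormal h y) ^+ 2)%:E - ((isonormal h' y) ^+ 2)%:E)))%E.
  by apply: eq_integral => y _; rewrite -!EFinB -EFinM; congr EFin; field.
rewrite integralZl//; last by apply: integrableB => //; exact: integrableB.
rewrite integralB//; last exact: integrableB.
rewrite integralB//.
rewrite -/(sqint P (fun y => isonormal h y + isonormal h' y)) sD.
rewrite -/(sqint P (isonormal h)) -/(sqint P (isonormal h')) !isonormal_sqint.
by rewrite -!EFinB -EFinM l2_dotD; congr EFin; field.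
Qed.

Lemma isonormal_sum n (c : 'I_n -> R) (v : 'I_n -> l2 R) :
  isonormal (\sum_(i < n) c i *: v i) = (fun y => \sum_(i < n) c i * isonormal (v i) y) %[ae P].
Proof.
elim: n c v => [|n IH] c v.
  have [[+ _]|[+ _]] := isonormal_law (\sum_(i < 0) c i *: v i).
    by apply: filterS => y H yT; rewrite H// big_ord0.
  by rewrite big_ord0 l2_dot0 ltxx.
have H1 := IH (fun i => c (widen_ord (leqnSn n) i)) (fun i => v (widen_ord (leqnSn n) i)).
have := isonormal_linear (c ord_max) (v ord_max)
  (\sum_(i < n) c (widen_ord (leqnSn n) i) *: v (widen_ord (leqnSn n) i)).
have <- : \sum_(i < n.+1) c i *: v i = c ord_max *: v ord_max +
    \sum_(i < n) c (widen_ord (leqnSn n) i) *: v (widen_ord (leqnSn n) i).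
  by rewrite big_ord_recr/= addrC.
apply: filterS2 H1 => y H1 H2 yT; rewrite H2// H1//.
by rewrite [RHS]big_ord_recr/= addrC.
Qed.

Lemma sum_delta (F : nat -> R) n m :
  \sum_(k < m) F k * (k == n :> nat)%:R = if (n < m)%N then F n else 0.
Proof.
elim: m => [|m IH]; first by rewrite big_ord0.
rewrite big_ord_recr/= IH ltnS [in RHS]leq_eqVlt.
rewrite [m == n]eq_sym; case: (ltngtP n m) => [nm|mn|<-] /=; rewrite ?mulr0 ?addr0//.
by rewrite mulr1 add0r.
Qed.

Lemma isonormal_basis n : isonormal (l2_basis R n) = gauss_coordinate R n %[ae P].
Proof.
have sumE m : \sum_(k < m) l2_basis R n k ^+ 2 = (n < m)%:R.
  rewrite -(_ : (if (n < m)%N then 1 else 0) = (n < m)%:R); last by case: ltnP.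
  rewrite -(sum_delta (fun=> 1)); apply: eq_bigr => k _.
  by rewrite l2_basisE mul1r; case: eqP => _; rewrite ?expr1n ?expr0n.
have gE : gauss_sum (l2_basis R n) n.+1 = gauss_coordinate R n.
  apply/funext => y; rewrite /gauss_sum.
  under eq_bigr do rewrite l2_basisE mulrC.
  by rewrite (sum_delta (gauss_coordinate R ^~ y)) ltnSn.
apply: (@sqint_lim_eq _ _ _ _ _ _ (cst 0)); [exact: measurable_isonormalT| | |exact: cvg_cst].
  exact: measurable_gauss_coordinate.
move=> i; rewrite -gE; apply: le_trans (isonormalP _ _) _.
rewrite lee_fin subr_le0 sumE ltnSn; apply: l2_dot_le => m; rewrite sumE.
by case: ltnP.
Qed.

Lemma isonormal_gaussian_family : centered_gaussian_family isonormal.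
Proof.
move=> n c h; set X := (\sum_(i < n) _).
have XE y : X y = \sum_(i < n) c i * isonormal (h i) y.
  by rewrite /X (big_morph (fun f : {mfun bits2 >-> R} => f y) (id1 := 0) (op1 := +%R)).
have XW : isonormal (\sum_(i < n) c i *: h i) = X %[ae P].
  by apply: filterS (isonormal_sum c h) => y H yT; rewrite H// XE.
have mX : measurable_fun setT X by [].
have [[W0 _]|[hp lW]] := isonormal_law (\sum_(i < n) c i *: h i); [left|right].
  by apply: filterS2 W0 XW => y W0 XW yT; rewrite -XW// W0.
exists (Num.sqrt (l2_dot (\sum_(i < n) c i *: h i) (\sum_(i < n) c i *: h i)) * unit_scale R).
  by rewrite mulr_gt0 ?unit_scale_gt0// sqrtr_gt0.
move=> A mA; rewrite -(lW A mA); apply: (ae_eq_preimage mX (measurable_isonormalT _) mA).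
by apply: filterS XW => y H yT; rewrite H.
Qed.

Lemma isonormal_generates : generates_mod_null isonormal.
Proof.
pose G := [set C | exists h (D : set R), measurable D /\ C = isonormal h @^-1` D].
rewrite /generates_mod_null -/G.
pose D k := [set x : R | digit 2 k (gauss_cdf (x / unit_scale R))].
have mD k : measurable (D k).
  have m1 : measurable_fun setT (fun x : R => gauss_cdf (x / unit_scale R)).
    apply: measurableT_comp; last exact: measurable_funM.
    by apply: continuous_measurable_fun; exact: continuous_gauss_cdf.
  rewrite -[X in measurable X]setTI; apply: (m1 measurableT [set x | digit 2 k x]).
  exact: measurable_digit.
pose psi (y : bits2) : bits2 := fun i => `[< D i.2 (isonormal (l2_basis R i.1) y) >].
have psiG A : measurable A -> <<s G >> (psi @^-1` A).
  move: A; apply: smallest_sub.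
    have sG := smallest_sigma_algebra setT G; split.
    - by rewrite preimage_set0; case: sG.
    - by move=> A fA; case: sG => _ sG _; exact: (sG _ fA).
    - by move=> A fA; rewrite preimage_bigcup; case: sG => _ _; exact.
  move=> _ [i ->]; apply: sub_sigma_algebra; exists (l2_basis R i.1), (D i.2); split => //.
  by apply/seteqP; split => y /asboolP.
have psi_id : {ae P, forall y, psi y = y}.
  have : {ae P, forall y, forall n, isonormal (l2_basis R n) y = gauss_coordinate R n y /\
      forall k, digit 2 k (gauss_cdf (gauss_coordinate R n y / unit_scale R)) = y (n, k)}.
    apply/ae_foralln => n.
    by apply: filterS2 (isonormal_basis n) (gauss_coordinate_decode R n) => y H1 H2; split => //; exact: H1.
  apply: filterS => y H; apply/funext => -[n k]; rewrite /psi/= /D/=.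
  have [H1 H2] := H n; rewrite -(H2 k) -H1.
  by apply/asboolP/idP.
move=> A mA; exists (psi @^-1` A); first exact: psiG.
have [N [mN N0 psiN]] := psi_id.
have mpsi : measurable (psi @^-1` A).
  have : <<s G >> `<=` measurable.
    apply: smallest_sub; first exact: sigma_algebra_measurable.
    move=> _ [h [B [mB ->]]]; rewrite -[X in measurable X]setTI.
    exact: measurable_isonormalT.
  by apply; exact: psiG.
apply: subset_measure0 N0 => //; first exact: measurable_setY.
move=> y Ay; apply: psiN => /= py; move: Ay; rewrite setYE => -[+ +].
by rewrite /preimage/= py => -[] ? []; split.
Qed.

HB.instance Definition _ p :=
  GRing.isLinear.Build R (l2 R) (l2 R) *:%R (@l2_translate R p) (@l2_translate_linear R p).

(** On finite combinations of basis vectors the identity is an explicit change of index. Both sides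
    are continuous in [h] for the square mean, the shift being measure-preserving and the
    translation isometric. *)
Lemma isonormal_shift h :
  isonormal h \o bit_shift (- 1) = isonormal (l2_translate 1 h) %[ae P].
Proof.
have mh := measurable_isonormalT h.
have mW : measurable_fun setT (isonormal h \o bit_shift (- 1)).
  exact: measurableT_comp mh (measurable_bit_shift (- 1)).
pose f n : l2 R := \sum_(k < n) h k *: l2_basis R k.
have fE n : isonormal (f n) = gauss_sum h n %[ae P].
  have basis_ae : {ae P, forall y, forall k, isonormal (l2_basis R k) y = gauss_coordinate R k y}.
    by apply/ae_foralln => k; apply: filterS (isonormal_basis k) => y; exact.
  apply: filterS2 (isonormal_sum (fun k : 'I_n => h k) (fun k => l2_basis R k)) basis_ae.
  move=> y H1 H2 yT; rewrite H1//; apply: eq_bigr => k _.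
  by rewrite H2.
have UfE n : isonormal (l2_translate 1 (f n)) = gauss_sum h n \o bit_shift (- 1) %[ae P].
  have basis_ae : {ae P, forall y, forall k, isonormal (l2_basis R k) y = gauss_coordinate R k y}.
    by apply/ae_foralln => k; apply: filterS (isonormal_basis k) => y; exact.
  (* Translation moves the basis vector of index [k] to [translate (- 1) k], the coordinate that
     [bit_shift (- 1)] reads. *)
  have -> : l2_translate 1 (f n) = \sum_(k < n) h k *: l2_basis R (translate (- 1) k).
    rewrite /f linear_sum/=; apply: eq_bigr => k _; rewrite linearZ/=; congr (_ *: _).
    apply: l2_ext => m; transitivity (l2_basis R k (translate 1 m)) => //.
    rewrite !l2_basisE; congr (nat_of_bool _)%:R.
    by apply/eqP/eqP => [<-|->]; rewrite ?translateK ?translateVK.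
  apply: filterS2 (isonormal_sum (fun k : 'I_n => h k)
    (fun k => l2_basis R (translate (- 1) k))) basis_ae.
  move=> y H1 H2 yT; rewrite H1//; apply: eq_bigr => k _.
  by rewrite H2.
have tailE n : l2_dot (h - f n) (h - f n) <= l2_tail h n.
  rewrite -lee_fin -isonormal_sqint; apply: le_trans (isonormalP h n).
  rewrite le_eqVlt; apply/orP; left; apply/eqP; apply: ae_eq_sqint.
  - exact: measurable_isonormalT.
  - by apply: measurable_funB => //; exact: measurable_gauss_sum.
  apply: filterS2 (fE n) (isonormal_linear (- 1) (f n) h) => y H1 H2 yT.
  by rewrite addrC -scaleN1r H2// H1// mulN1r addrC.
have mS n : measurable_fun setT (gauss_sum h n \o bit_shift (- 1)).
  exact: measurableT_comp (measurable_gauss_sum h n) (measurable_bit_shift (- 1)).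
have mU := measurable_isonormalT (l2_translate 1 h).
apply: (@sqint_lim_eq _ _ _ _ _ _ (fun n => 2 * l2_tail h n + 2 * l2_tail h n)) => //.
- move=> n; apply: le_trans (sqintB_le _ mW (mS n) mU) _.
  have -> : (2 * l2_tail h n + 2 * l2_tail h n)%:E =
      (2%:E * (l2_tail h n)%:E + 2%:E * (l2_tail h n)%:E)%E.
    by rewrite -!EFinM -EFinD.
  apply: leeD; apply: lee_wpmul2l => //.
    apply: le_trans (isonormalP h n).
    pose g y := (isonormal h y - gauss_sum h n y) ^+ 2.
    have mg : measurable_fun setT (EFin \o g).
      by apply: measurable_sqr; apply: measurable_funB => //; exact: measurable_gauss_sum.
    have [nu nuE] := pushforward_measureP P (measurable_bit_shift (- 1)).
    rewrite le_eqVlt; apply/orP; left; apply/eqP.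
    transitivity (\int[nu]_y (EFin \o g) y)%E.
      rewrite nuE ge0_integral_pushforward//; last by move=> y _; rewrite lee_fin sqr_ge0.
      exact: measurable_bit_shift.
    apply: eq_measure_integral => A mA _; rewrite nuE /pushforward.
    exact: bit_shift_preserving.
  apply: le_trans (_ : (l2_dot (h - f n) (h - f n))%:E <= _)%E; last by rewrite lee_fin.
  rewrite -(l2_translate_dot 1) -isonormal_sqint.
  rewrite le_eqVlt; apply/orP; left; apply/eqP; apply: ae_eq_sqint.
  - by apply: measurable_funB.
  - exact: measurable_isonormalT.
  apply: filterS2 (UfE n) (isonormal_linear (- 1) (l2_translate 1 (f n)) (l2_translate 1 h)).
  move=> y H1 H2 yT.
  have -> : l2_translate 1 (h - f n) = -1 *: l2_translate 1 (f n) + l2_translate 1 h.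
    by rewrite linearB/= addrC scaleN1r.
  by rewrite H2// H1// mulN1r addrC.
rewrite -[X in _ --> X](addr0 0) -[X in _ --> X + _](mulr0 2) -[X in _ --> _ + X](mulr0 2).
by apply: cvgD; apply: cvgM; try exact: cvg_cst; exact: l2_tail_cvg.
Qed.

Lemma coin_shift_gaussian : gaussian_automorphism (coin_shift R).
Proof.
split; first exact: standard_coin.
exists (l2 R : completeNormedModType R), (@l2_dot R : {dot (l2 R) for idfun}),
  (@l2_translate R 1 : {linear l2 R -> l2 R}), isonormal; split.
- exact: l2_sqr_norm.
- by split; [exact: l2_separable|exact: l2_infinite_dimensional].
- split; first exact: l2_translate_dot.
  by move=> y; exists (l2_translate (- 1) y); have := l2_translateK (- 1) y; rewrite opprK.
split.
- exact: isonormal_gaussian_family.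
- exact: isonormal_linear.
- exact: isonormal_covariance.
- exact: isonormal_generates.
- exact: isonormal_shift.
Qed.

End isonormal.

Theorem theorem1 (R : realType) :
  (forall (d : measure_display) (X : measurableType d) (mu : probability X R)
      (S : automorphism mu),
    standard_probability mu -> KS_entropy S = 0%E ->
    exists (d' : measure_display) (Y : measurableType d')
        (nu : probability Y R) (G : automorphism nu) (L : nat -> nat),
      [/\ gaussian_automorphism G,
          forall j, (0 < j)%N -> (0 < L j)%N,
          L j @[j --> \oo] --> \oo,
          P_entropy (progressions L) S = 0%E &
          completely_positive_P_entropy (progressions L) G]) /\
  (forall (d : measure_display) (X : measurableType d) (mu : probability X R)
      (S : automorphism mu)
      (d' : measure_display) (Y : measurableType d')
      (nu : probability Y R) (G : automorphism nu) (L : nat -> nat),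
    standard_probability mu -> gaussian_automorphism G ->
    (forall j, (0 < j)%N -> (0 < L j)%N) ->
    L j @[j --> \oo] --> \oo ->
    P_entropy (progressions L) S = 0%E ->
    completely_positive_P_entropy (progressions L) G ->
    disjoint_automorphisms S G).
Proof.
split=> [d X mu S std h0|d X mu S d' Y nu G L std gG L0 Loo S0 cpe J mJ JSG f f2].
  have [L [L0 jL SL]] := zero_entropy_progressions h0 std.
  exists _, _, (coin R (nat * nat)%type), (coin_shift R), L; split => //.
  - exact: coin_shift_gaussian.
  - apply/cvgnyPge => A; exists A => // j /= Aj; exact: leq_trans Aj (jL j).
  - exact: coin_shift_cpe.
apply: (markov_trivial mJ JSG _ S0 cpe f2).
exists 1%N => // j /= j0; rewrite card_progressions//; exact: L0.
Qed.
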